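(* Let $Y,Z_1,Z_2$ be reflexive and separable Banach spaces, $T>0$, $Q=[0,T]$, $0=\tau_0<\tau_1<\cdots<\tau_m<\tau_{m+1}=T$, and $z_0\in Z_1$. Let $f:Q\times Z_1\times Z_2\to Z_1$, $A:Q\times Z_2\to Z_2^*$, $N:Z_2\to Y$, $J:Q\times Y\to\mathbb{R}$, $g:Q\times Z_1\to Z_2^*$ and $\Theta_j:Z_1\to Z_1$ ($j=1,\dots,m$) satisfy the following. (Hf) (i) For any $(z,y)\in Z_1\times Z_2$, $f(\cdot,z,y)$ is continuous; (ii) there is $M_1>0$ with $\|f(t,z_1,y_1)-f(t,z_2,y_2)\|_{Z_1}\le M_1(\|z_1-z_2\|_{Z_1}+\|y_1-y_2\|_{Z_2})$ for all $t\in Q$, $z_1,z_2\in Z_1$, $y_1,y_2\in Z_2$; (iii) there is a nonnegative $\phi\in L^{1/p}[0,T]$, where $0<p<\kappa<1$, with $\|f(t,z,y)\|_{Z_1}\le\phi(t)$ for all $(t,z,y)\in Q\times Z_1\times Z_2$. (HI) For each $j\in\{1,\dots,m\}$, $\Theta_j$ is bounded and there is $d_j>0$ with $\|\Theta_j(z_1)-\Theta_j(z_2)\|_{Z_1}\le d_j\|z_1-z_2\|_{Z_1}$ for all $z_1,z_2\in Z_1$. (HA) (i) For any $y\in Z_2$, $A(\cdot,y)$ is continuous; (ii) for any $t\in Q$, $A(t,\cdot)$ is bounded, demicontinuous, and strongly monotone with constant $m_A>0$ (independent of $t$). (HN) $N\in L(Z_2,Y)$ is a compact and surjective operator. (HJ)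 (i) For any $x\in Y$, $J(\cdot,x)$ is continuous; (ii) for any $t\in Q$, $J(t,\cdot)$ is locally Lipschitz; (iii) there is $m_J>0$ with $\|\partial J(t,x)\|_{Y^*}\le m_J(\|x\|_Y+1)$ for all $(t,x)\in Q\times Y$; (iv) there is $c_J>0$ with $\langle\theta_1-\theta_2,y_1-y_2\rangle\ge -c_J\|y_1-y_2\|_Y^2$ for all $t\in Q$, $y_i\in Y$, $\theta_i\in\partial J(t,y_i)$, $i=1,2$. (Hg) (i) For any $z\in Z_1$, $g(\cdot,z)$ is continuous; (ii) there is $m_g>0$ with $\|g(t,z_1)-g(t,z_2)\|_{Z_2^*}\le m_g\|z_1-z_2\|_{Z_1}$ for all $t\in Q$, $z_1,z_2\in Z_1$. (HO) (i) $m_A>c_J\|N\|^2$, where $\|N\|=\|N\|_{L(Z_2,Y)}$; (ii) $\dfrac{T^\kappa M_1m_g}{\kappa(m_A-c_J\|N\|^2)\Gamma(\kappa)}<1$. For each $\delta>0$ let $J_\delta:Q\times Y\to\mathbb{R}$ satisfy the four conditions of (HJ) (with $J$ replaced by $J_\delta$), with constants $m_{J\delta}>0$ and $c_{J\delta}>0$ in place of $m_J$ and $c_J$, and suppose in addition: (HJ$^*$) there is a function $V:\mathbb{R}^+\to\mathbb{R}^+$ such that (i) for all $(t,y)\in Q\times Z_2$ and $\delta>0$, $\|\zeta-\zeta_\delta\|_{Z_2^*}\le V(\delta)$ for all $\zeta\in N^*\partial J(t,Ny)$ and $\zeta_\delta\in N^*\partial J_\delta(t,Ny)$; (ii) $\lim_{\delta\to0}V(\delta)=0$;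 (HO$^*$) there is $m_{A0}>0$ such that for all $\delta>0$: (i) $m_A>m_{A0}>c_{J\delta}\|N\|^2$; (ii) $\dfrac{T^\kappa M_1m_g}{\kappa(m_A-c_{J\delta}\|N\|^2)\Gamma(\kappa)}<1$. Consider the problem $$\begin{cases}{}^{C}D_0^\kappa z(t)=f(t,z(t),y(t)),\quad t\in Q,\ t\ne\tau_j,\ j=1,\dots,m,\\ z(\tau_j^+)-z(\tau_j^-)=\Theta_j(z(\tau_j^-)),\quad j=1,\dots,m,\\ z(0)=z_0,\\ A(t,y(t))+N^*\partial J(t,Ny(t))\ni g(t,z(t)),\quad t\in Q,\end{cases}\tag{P}$$ and, for $\delta>0$, the perturbed problem (P$_\delta$) $$\begin{cases}{}^{C}D_0^\kappa z_\delta(t)=f(t,z_\delta(t),y_\delta(t)),\quad t\in Q,\ t\ne\tau_j,\ j=1,\dots,m,\\ z_\delta(\tau_j^+)-z_\delta(\tau_j^-)=\Theta_j(z_\delta(\tau_j^-)),\quad j=1,\dots,m,\\ z_\delta(0)=z_0,\\ \langle A(t,y_\delta(t)),x\rangle+J_\delta^\circ(t,Ny_\delta(t);Nx)\ge\langle g(t,z_\delta(t)),x\rangle,\quad\forall (t,x)\in Q\times Z_2.\end{cases}$$ Then: (i) for each $\delta>0$, problem (P$_\delta$) has a unique solution $(z_\delta,y_\delta)\in\mathcal{I}C(Q;Z_1)\times\mathcal{I}C(Q;Z_2)$; (ii) $(z_\delta,y_\delta)$ converges to the solution $(z,y)\in\mathcal{I}C(Q;Z_1)\times\mathcal{I}C(Q;Z_2)$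 of (P) in the sense that $(z_\delta(t),y_\delta(t))\to(z(t),y(t))$ as $\delta\to0$ for all $t\in Q$ (in $Z_1\times Z_2$).
   Context: $\mathcal{I}C(Q;X)$ (for a Banach space $X$) is the space of functions $x:Q\to X$ that are continuous on $Q\setminus\{\tau_1,\dots,\tau_m\}$ and such that the one-sided limits $x(\tau_j^+)$, $x(\tau_j^-)$ exist with $x(\tau_j)=x(\tau_j^-)$. Solution: a pair $(z,y)\in\mathcal{I}C(Q;Z_1)\times\mathcal{I}C(Q;Z_2)$ is a solution of (P) if $$z(t)=z_0+\sum_{i=1}^{j}\Theta_i(z(\tau_i^-))+\frac1{\Gamma(\kappa)}\int_0^t(t-s)^{\kappa-1}f(s,z(s),y(s))\,ds\quad\text{for }t\in(\tau_j,\tau_{j+1}],\ j=0,1,\dots,m,$$ (with $z(0)=z_0$ and the empty sum being $0$ for $j=0$), and for every $t\in Q$ there is $\eta\in N^*\partial J(t,Ny(t))$ with $A(t,y(t))+\eta=g(t,z(t))$. A solution of (P$_\delta$) is defined in the same way with $J$ replaced by $J_\delta$ (the inequality being read as the inclusion $A(t,y_\delta(t))+N^*\partial J_\delta(t,Ny_\delta(t))\ni g(t,z_\delta(t))$). (${}^{C}D_0^\kappa$ is the Caputo derivative of order $\kappa$; the problems are understood through this definition of solution.) Under the stated hypotheses (P) has a unique solution. For a locally Lipschitz functional $F:X\to\mathbb{R}$ on a Banach space, $F^\circ(x;z)=\limsup_{y\to x,\ \mu\to0^+}\frac{F(y+\mu z)-F(y)}{\mu}$ and $\partial F(v)=\{\eta\in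 X^*: F^\circ(v;z)\ge\langle\eta,z\rangle\ \forall z\in X\}$ (Clarke generalized gradient). $J^\circ(t,x;\cdot)$ and $\partial J(t,x)$ refer to the functional $J(t,\cdot)$ at $x$, likewise for $J_\delta$; $\|\partial J(t,x)\|\le c$ means every element has norm at most $c$. $N^*:Y^*\to Z_2^*$ is the adjoint of $N$. An operator $B:Z_2\to Z_2^*$ is strongly monotone with constant $m_B>0$ if $\langle Bx_1-Bx_2,x_1-x_2\rangle\ge m_B\|x_1-x_2\|^2$ for all $x_1,x_2$; demicontinuous if $z_n\to z$ in $Z_2$ implies $Bz_n\to Bz$ weakly in $Z_2^*$. A map is bounded if it sends bounded sets to bounded sets. $\Gamma$ is the gamma function. *)

(* Defs.v *)
From HB Require Import structures.
From mathcomp Require Import all_boot all_order all_algebra.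
From mathcomp Require Import all_classical all_reals all_analysis.

Set Implicit Arguments.
Unset Strict Implicit.
Unset Printing Implicit Defensive.
Import Order.TTheory GRing.Theory Num.Def Num.Theory.
Import numFieldNormedType.Exports.

Local Open Scope classical_set_scope.
Local Open Scope ring_scope.

Section bounded_operators.
Context {R : realType} {V W : normedModType R}.

Definition contlin : {pred V -> W} :=
  mem [set f : V -> W | linear f /\ continuous f].

(* L(V, W), with pointwise operations and, below, the operator norm *)
Record bop := BOp { bop_fun :> V -> W; bop_subproof : bop_fun \in contlin }.

HB.instance Definition _ := [isSub for bop_fun].
HB.instance Definition _ := [Choice of bop by <:].

Lemma contlin_submod_closed : submod_closed contlin.
Proof.
split=> [|a f g /set_mem[lf cf] /set_mem[lg cg]]; apply/mem_set; split.
- by move=> k u v; rewrite /= scaler0 addr0.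
- by move=> x; apply: cvg_cst.
- move=> k u v; rewrite /= !fctE.
  by rewrite lf lg !scalerDr !scalerA (mulrC a) addrACA.
- by move=> x; apply: cvgD; [apply: cvgZl_tmp; exact: cf | exact: cg].
Qed.

HB.instance Definition _ := GRing.isSubmodClosed.Build R (V -> W) contlin
  contlin_submod_closed.
HB.instance Definition _ := [SubChoice_isSubLmodule of bop by <:].

Lemma bopP (f g : bop) : f =1 g -> f = g.
Proof. by move=> fg; exact/val_inj/funext. Qed.

Lemma bop_linear (f : bop) : linear f.
Proof. by case: f => f /= /set_mem[]. Qed.

Lemma bop_continuous (f : bop) : continuous f.
Proof. by case: f => f /= /set_mem[]. Qed.

HB.instance Definition _ (f : bop) :=
  GRing.isLinear.Build R V W *:%R (bop_fun f) (@bop_linear f).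

Definition opnorm (f : bop) : R :=
  sup [set `|f x| | x in [set x : V | `|x| <= 1]].

Lemma opnorm_has_sup (f : bop) :
  has_sup [set `|f x| | x in [set x : V | `|x| <= 1]].
Proof.
split; first by exists `|f 0|, 0 => //=; rewrite normr0.
have /linear_bounded_continuous /bounded_funP /(_ 1)[M fM] :=
  @bop_continuous f.
by exists M => _ [x x1 <-]; exact: fM.
Qed.

Lemma opnorm_ub (f : bop) (x : V) : `|x| <= 1 -> `|f x| <= opnorm f.
Proof.
by move=> x1; apply: (ub_le_sup (opnorm_has_sup f).2); exists x.
Qed.

Lemma opnorm_le (f : bop) (M : R) :
  (forall x : V, `|x| <= 1 -> `|f x| <= M) -> opnorm f <= M.
Proof.
move=> fM; apply: ge_sup; first exact: (opnorm_has_sup f).1.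
by move=> _ [x x1 <-]; exact: fM.
Qed.

Lemma opnormD (f g : bop) : opnorm (f + g) <= opnorm f + opnorm g.
Proof.
apply: opnorm_le => x x1.
by rewrite (le_trans (ler_normD _ _))// lerD// opnorm_ub.
Qed.

Lemma opnormZ_le (a : R) (f : bop) : opnorm (a *: f) <= `|a| * opnorm f.
Proof.
by apply: opnorm_le => x x1; rewrite normrZ ler_wpM2l// opnorm_ub.
Qed.

Lemma opnormZ (a : R) (f : bop) : opnorm (a *: f) = `|a| * opnorm f.
Proof.
apply/eqP; rewrite eq_le opnormZ_le/=.
have [->|a0] := eqVneq a 0.
  rewrite normr0 mul0r (le_trans _ (opnorm_ub _ (x := 0) _))//.
  by rewrite normr0.
rewrite -ler_pdivlMl ?normr_gt0// -normfV.
by have := opnormZ_le a^-1 (a *: f); rewrite scalerA mulVf// scale1r.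
Qed.

Lemma opnorm0_eq0 (f : bop) : opnorm f = 0 -> f = 0.
Proof.
move=> f0; apply: bopP => x; apply: normr0_eq0.
have [->|x0] := eqVneq x 0; first by rewrite linear0 normr0.
have := @opnorm_ub f (`|x|^-1 *: x).
rewrite normrZ normfV normr_id mulVf ?normr_eq0// => /(_ (lexx _)).
rewrite f0 linearZ/= normrZ normfV normr_id => h.
apply: le_anti; rewrite normr_ge0 andbT -(@ler_pM2l _ `|x|^-1) ?mulr0//.
by rewrite invr_gt0 normr_gt0.
Qed.

HB.instance Definition _ :=
  Lmodule_isNormed.Build R bop opnormD opnormZ opnorm0_eq0.

End bounded_operators.
Arguments bop {R} V W.

Definition dual {R : realType} (V : normedModType R) := bop V R^o.
HB.instance Definition _ {R : realType} (V : normedModType R) :=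
  NormedModule.on (dual V).

Section adjoint.
Context {R : realType} {V W : normedModType R} (N : bop V W).

Lemma adjoint_subproof (th : dual W) :
  (fun x => th (N x)) \in @contlin R V R^o.
Proof.
apply/mem_set; split; first by move=> a u v /=; rewrite !linearP.
move=> x; apply: continuous_comp; exact: bop_continuous.
Qed.

Definition adjoint (th : dual W) : dual V := BOp (adjoint_subproof th).

End adjoint.

Section functional_analysis.
Context {R : realType}.

(* surjectivity of the canonical embedding of [V] into its bidual *)
Definition reflexive_space (V : normedModType R) :=
  forall xi : dual (dual V), exists x : V, forall f : dual V, xi f = f x.

Definition separable_space (V : normedModType R) :=
  exists2 S : set V, countable S & dense S.

Definition bounded_map (V W : normedModType R) (F : V -> W) :=
  forall B : set V, bounded_set B -> bounded_set (F @` B).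

Definition compact_operator (V W : normedModType R) (F : V -> W) :=
  forall B : set V, bounded_set B -> precompact (F @` B).

Definition strongly_monotone (V : normedModType R) (B : V -> dual V) (c : R) :=
  forall x1 x2 : V, c * `|x1 - x2| ^+ 2 <= (B x1 - B x2) (x1 - x2).

(* weak convergence in [dual V] is tested against the whole bidual *)
Definition demicontinuous (V : normedModType R) (B : V -> dual V) :=
  forall (u : nat -> V) (v : V), u n @[n --> \oo] --> v ->
  forall xi : dual (dual V), xi (B (u n)) @[n --> \oo] --> xi (B v).

Definition locally_lipschitz (V : normedModType R) (F : V -> R) :=
  forall x : V, exists2 U, nbhs x U & [lipschitz F y | y in U].

(* the limsup runs over pairs (y, mu) with y -> x and mu -> 0+ *)
Definition clarke_dd (V : normedModType R) (F : V -> R) (x z : V) : \bar R :=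
  limf_esup (fun p : V * R => ((F (p.1 + p.2 *: z) - F p.1) / p.2)%:E)
    (filter_prod (nbhs x) (0 : R)^'+).

Definition clarke_gradient (V : normedModType R) (F : V -> R) (x : V) :
    set (dual V) :=
  [set eta | forall z : V, ((eta z)%:E <= clarke_dd F x z)%E].

End functional_analysis.

Section bochner.
Context d (S : measurableType d) {R : realType} (X : normedModType R).
Variables (mu : {measure set S -> \bar R}) (D : set S).

Definition simple_vfun (s : S -> X) :=
  [/\ finite_set (range s), forall v, measurable (s @^-1` [set v]) &
      forall v, v != 0 -> (mu (D `&` s @^-1` [set v]) < +oo)%E].

Definition simple_vintegral (s : S -> X) : X :=
  \sum_(v \in range s) fine (mu (D `&` s @^-1` [set v])) *: v.

(* measurability of the distance is required separately: [mu] need not be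
   complete, so it does not follow from the almost everywhere convergence *)
Definition is_bochner_integral (u : S -> X) (v : X) :=
  exists s : nat -> S -> X,
  [/\ forall n, simple_vfun (s n),
      {ae mu, forall x, D x -> s n x @[n --> \oo] --> u x},
      forall n, measurable_fun D (fun x => `|u x - s n x|),
      (\int[mu]_(x in D) `|u x - s n x|%:E)%E @[n --> \oo] --> 0%E &
      simple_vintegral (s n) @[n --> \oo] --> v].

End bochner.

Definition Gamma {R : realType} (a : R) : R :=
  \int[lebesgue_measure]_(x in `]0, +oo[) (x `^ (a - 1) * expR (- x)).

Section problem.
Context {R : realType}.

Definition impulse_times (T : R) (m : nat) (tau : nat -> R) :=
  [/\ tau 0%N = 0, tau m.+1 = T & forall j, (j <= m)%N -> tau j < tau j.+1].

(* elements of this space are total functions on [R] whose values outside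
   [[0, T]] are irrelevant *)
Definition impulse_continuous (T : R) (m : nat) (tau : nat -> R)
    (X : normedModType R) (x : R -> X) :=
  {within `[0, T] `\` [set tau j | j in [set j | (1 <= j <= m)%N]],
    continuous x} /\
  forall j, (1 <= j <= m)%N ->
    x s @[s --> (tau j)^'-] --> x (tau j) /\ cvg (x s @[s --> (tau j)^'+]).

Definition hemivariational_potential (T : R) (Y : normedModType R) (J : R -> Y -> R)
    (mJ cJ : R) :=
  [/\ forall x, {within `[0, T], continuous (fun t : R => J t x)},
      forall t : R, t \in `[0, T] -> locally_lipschitz (J t),
      forall (t : R) x th, t \in `[0, T] -> clarke_gradient (J t) x th ->
        `|th| <= mJ * (`|x| + 1) &
      forall (t : R) y1 y2 th1 th2, t \in `[0, T] ->
        clarke_gradient (J t) y1 th1 -> clarke_gradient (J t) y2 th2 ->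
        - cJ * `|y1 - y2| ^+ 2 <= (th1 - th2) (y1 - y2)].

Definition is_solution (kappa T : R) (m : nat) (tau : nat -> R)
    (Y Z1 Z2 : normedModType R) (z0 : Z1) (f : R -> Z1 -> Z2 -> Z1)
    (Theta : nat -> Z1 -> Z1) (A : R -> Z2 -> dual Z2) (N : bop Z2 Y)
    (J : R -> Y -> R) (g : R -> Z1 -> dual Z2) (z : R -> Z1) (y : R -> Z2) :=
  [/\ impulse_continuous T m tau z, impulse_continuous T m tau y,
      z 0 = z0,
      forall j t, (j <= m)%N -> tau j < t <= tau j.+1 ->
        exists2 I : Z1,
          is_bochner_integral lebesgue_measure `[0, t]
            (fun s => (t - s) `^ (kappa - 1) *: f s (z s) (y s)) I &
          z t = z0
            + \sum_(1 <= i < j.+1) Theta i (lim (z s @[s --> (tau i)^'-]))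
            + (Gamma kappa)^-1 *: I &
      forall t : R, t \in `[0, T] ->
        exists2 eta, (adjoint N @` clarke_gradient (J t) (N (y t))) eta &
          A t (y t) + eta = g t (z t)].

(* uniqueness is that of functions on [[0, T]] *)
Definition is_unique_solution (T : R) (Z1 Z2 : normedModType R)
    (sol : (R -> Z1) -> (R -> Z2) -> Prop) (z : R -> Z1) (y : R -> Z2) :=
  sol z y /\
  forall z' y', sol z' y' ->
    forall t : R, t \in `[0, T] -> z' t = z t /\ y' t = y t.

End problem.

(* Main.v *)
Require Import Defs.
From HB Require Import structures.
From mathcomp Require Import all_boot all_order all_algebra.
From mathcomp Require Import all_classical all_reals all_analysis.
From mathcomp Require Import measurable_realfun ring lra.
Import Order.TTheory GRing.Theory Num.Theory.
Import numFieldNormedType.Exports.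
Local Open Scope classical_set_scope.
Local Open Scope ring_scope.

(** The inclusion determines [y] from [z] at each time, so that the coupled
    problem is a single integral equation for [z], with memory and impulses.

    For a fixed time, relaxed monotonicity of the generalized gradient, pulled
    back by [N], is absorbed by the strong monotonicity of the operator since
    [cJ * `|N| ^+ 2 < mA]. The sum is a strongly monotone graph. For finitely
    many of its points the monotone inequalities have a common solution because
    a skew-symmetric matrix game has value zero ([skew_game], [finite_minty]);
    strong monotonicity bounds these solutions, and an ultrafilter limit in the
    reflexive space solves all the inequalities at once ([minty_solution]).
    Minty's device and the upper semicontinuity of Clarke's directional
    derivative turn them into a variational inequality, and the surjectivity of
    [N] factors the resulting functional through [Y] ([inclusion_solvable]).
    Strong monotonicity also gives uniqueness and Lipschitz dependence on the
    right-hand side ([inclusion_stability]).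

    The response [y] depends continuously on time although the potentials are
    only pointwise continuous in time ([inclusion_cvg]). Along segments the
    potentials are convex up to a quadratic term ([semiconvex_subgradient]), so
    gradients can be traded for values of the potential; these converge
    uniformly on compact sets by the growth of the gradients, and [N] maps the
    bounded set of responses into a compact one. Thus [y] inherits from [z] the
    continuity between impulses and the one-sided limits at them.

    The equation for [z] is solved by Picard iteration ([mild_fixed_point]) in a
    supremum norm weighted by an exponential of the clock that advances by one
    unit at each impulse: a large rate makes both the fractional integral and
    the Lipschitz jumps contracting ([exists_weight]). Integrals are compared
    through [bochner_integral_le] and exist because a function that is
    continuous off finitely many points is approximated by its nearest points in
    a dense sequence ([bochner_integral_exists]).

    For the perturbed potentials, replacing a gradient of [Jd delta] by one of
    [J] at the same point changes the inclusion by at most [V delta]. The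
    difference of the two responses is then at most a multiple of the difference
    of the states plus a multiple of [V delta], and the weighted estimate gives a
    bound linear in [V delta], uniform in time ([mild_stability],
    [perturbed_solution_stability]). *)

Set Implicit Arguments.
Unset Strict Implicit.
Unset Printing Implicit Defensive.

(** * Sublinear functionals and the Hahn-Banach theorem *)

Section hahn_banach.
Context {R : realType} {V : lmodType R}.
Implicit Types (p q : V -> R) (x y v : V).

Definition sublinear q :=
  (forall x y, q (x + y) <= q x + q y) /\
  (forall a x, 0 < a -> q (a *: x) <= a * q x).


Lemma sublinear0 q : sublinear q -> q 0 = 0.
Proof.
move=> [_ qZ]; have h1 := qZ 2 0 ltac:(lra); have h2 := qZ 2^-1 0 ltac:(lra).
by rewrite !scaler0 in h1 h2; lra.
Qed.

Lemma sublinearZ q a x : sublinear q -> 0 <= a -> q (a *: x) = a * q x.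
Proof.
move=> sq; rewrite le_eqVlt => /predU1P[<-|a0].
  by rewrite scale0r mul0r sublinear0.
apply/eqP; rewrite eq_le (sq.2 _ _ a0)/= -ler_pdivlMl//.
by rewrite (le_trans _ (sq.2 _ _ _)) ?invr_gt0// scalerA mulVf ?gt_eqF// scale1r.
Qed.

Lemma sublinear_ge q x : sublinear q -> - q (- x) <= q x.
Proof.
by move=> sq; have := sq.1 x (- x); rewrite subrr (sublinear0 sq); lra.
Qed.

(** The largest sublinear functional below [q] whose value at [- v] is at most
    [- q v]; it makes [q] linear along the line spanned by [v]. *)
Definition tilt q v x := inf [set q (x + t *: v) - t * q v | t in [set t | 0 <= t]].

Lemma tilt_le q v x t : sublinear q -> 0 <= t ->
  tilt q v x <= q (x + t *: v) - t * q v.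
Proof.
move=> sq t0; apply: ge_inf; last by exists t.
exists (- q (- x)) => _ [s /= s0 <-].
have := sq.1 (- x) (x + s *: v).
by rewrite addrA addNr add0r (sublinearZ _ sq)//; lra.
Qed.

Lemma le_tilt q v x c : (forall t, 0 <= t -> c <= q (x + t *: v) - t * q v) ->
  c <= tilt q v x.
Proof.
move=> h; apply: lb_le_inf; last by move=> _ [t t0 <-]; exact: h.
by exists (q (x + 0 *: v) - 0 * q v), 0 => //=.
Qed.

Lemma tilt_sublinear q v : sublinear q -> sublinear (tilt q v).
Proof.
move=> sq; split=> [x y|a x a0].
  rewrite -lerBlDr; apply: le_tilt => t t0; rewrite lerBlDr -lerBlDl.
  apply: le_tilt => s s0; rewrite lerBlDl.
  apply: (le_trans (@tilt_le q v _ (s + t) sq (addr_ge0 s0 t0))).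
  have := sq.1 (y + s *: v) (x + t *: v).
  have -> : y + s *: v + (x + t *: v) = x + y + (s + t) *: v.
    by rewrite scalerDl addrACA (addrC y).
  by lra.
rewrite mulrC -ler_pdivrMr//; apply: le_tilt => t t0.
rewrite ler_pdivrMr//.
apply: (le_trans (@tilt_le q v _ (a * t) sq _)); first by rewrite mulr_ge0 ?(ltW a0).
by rewrite -scalerA -scalerDr (sublinearZ _ sq (ltW a0)); lra.
Qed.

(** Below any sublinear functional lies a minimal one, and a minimal sublinear
    functional is linear because tilting it in a direction cannot lower it. *)
Lemma exists_linear_below p : sublinear p ->
  exists f : V -> R, [/\ forall x y, f (x + y) = f x + f y,
    forall a x, f (a *: x) = a * f x & forall x, f x <= p x].
Proof.
move=> sp.
pose T := {q : V -> R | sublinear q /\ forall x, q x <= p x}.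
pose rel (s t : T) := `[< forall x, sval t x <= sval s x >].
have [||||[q [sq qp]] qmin] := @Zorn T rel.
- by move=> t; apply/asboolP.
- move=> r s t /asboolP rs /asboolP st; apply/asboolP => x.
  exact: le_trans (st x) (rs x).
- move=> [s hs] [t ht] /asboolP st /asboolP ts.
  apply: eq_exist => /=; apply/funext => x; apply/eqP; rewrite eq_le.
  by rewrite (st x) (ts x).
- move=> A totA.
  have [[a0 Aa0]|A0] := pselect (A !=set0); last first.
    exists (exist _ p (conj sp (fun x => lexx _))) => s As.
    by exfalso; apply: A0; exists s.
  pose S x := [set sval a x | a in A].
  have lbS x : has_lbound (S x).
    exists (- p (- x)) => _ [[q [sq qp]] Aq <-] /=.
    by apply: le_trans (sublinear_ge x sq); rewrite lerN2.
  have S0 x : S x !=set0 by exists (sval a0 x), a0.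
  pose q x := inf (S x).
  have qle a x : A a -> q x <= sval a x.
    by move=> Aa; apply: ge_inf => //; exists a.
  have sq : sublinear q.
    split=> [x y|c x c0].
      rewrite -lerBlDr; apply: lb_le_inf => // _ [a Aa <-].
      rewrite lerBlDr -lerBlDl; apply: lb_le_inf => // _ [b Ab <-].
      rewrite lerBlDr; have [ab|ba] := totA a b Aa Ab.
        move/asboolP in ab; apply: (le_trans (qle _ _ Ab)).
        apply: (le_trans ((proj1 (svalP b)).1 _ _)).
        by rewrite addrC lerD2l; exact: ab.
      move/asboolP in ba; apply: (le_trans (qle _ _ Aa)).
      apply: (le_trans ((proj1 (svalP a)).1 _ _)).
      by rewrite addrC lerD2r; exact: ba.
    rewrite mulrC -ler_pdivrMr//; apply: lb_le_inf => // _ [a Aa <-].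
    rewrite ler_pdivrMr// mulrC; apply: (le_trans (qle _ _ Aa)).
    exact: ((proj1 (svalP a)).2 _ _ c0).
  have qp x : q x <= p x by apply: le_trans (qle _ _ Aa0) ((svalP a0).2 _).
  by exists (exist _ q (conj sq qp)) => a Aa; apply/asboolP => x; exact: qle.
have tq v : tilt q v = q.
  have tle x : tilt q v x <= q x.
    by have := @tilt_le q v x 0 sq (lexx _); rewrite scale0r addr0 mul0r subr0.
  have tp x : tilt q v x <= p x by exact: le_trans (tle x) (qp x).
  have := qmin (exist _ (tilt q v) (conj (tilt_sublinear v sq) tp)).
  by move=> /(_ (asboolT tle)) [].
have qN v : q (- v) = - q v.
  apply/eqP; rewrite eq_le; apply/andP; split; last first.
    by have := sublinear_ge (- v) sq; rewrite opprK; lra.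
  have := @tilt_le q v (- v) 1 sq ler01; rewrite tq scale1r addNr (sublinear0 sq).
  by rewrite mul1r sub0r.
exists q; split => // [x y|a x].
  apply/eqP; rewrite eq_le sq.1/=.
  by have := sq.1 (- x) (- y); rewrite -opprD !qN; lra.
have [a0|a0] := leP 0 a; first exact: sublinearZ.
rewrite -(opprK a) scaleNr qN sublinearZ//; lra.
Qed.

(** Tilting [p] along [v] before minimizing forces the linear minorant to attain
    [p] at [v]. *)
Lemma hahn_banach p v : sublinear p ->
  exists f : V -> R, [/\ forall x y, f (x + y) = f x + f y,
    forall a x, f (a *: x) = a * f x, forall x, f x <= p x & f v = p v].
Proof.
move=> sp; have [f [fD fZ ft]] := exists_linear_below (tilt_sublinear v sp).
have fp x : f x <= p x.
  apply: (le_trans (ft x)).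
  by have := @tilt_le p v x 0 sp (lexx _); rewrite scale0r addr0 mul0r subr0.
exists f; split => //; apply/eqP; rewrite eq_le fp/=.
have := le_trans (ft (- v)) (@tilt_le p v (- v) 1 sp ler01).
rewrite scale1r addNr (sublinear0 sp) mul1r sub0r -scaleN1r fZ; lra.
Qed.

End hahn_banach.

Section dual_basics.
Context {R : realType}.

Lemma bop_bound (V W : normedModType R) (f : bop V W) (x : V) :
  `|f x| <= `|f| * `|x|.
Proof.
have [->|x0] := eqVneq x 0; first by rewrite linear0 !normr0 mulr0.
have := @opnorm_ub R V W f (`|x|^-1 *: x).
rewrite normrZ normfV normr_id mulVf ?normr_eq0// => /(_ (lexx _)).
rewrite linearZ/= normrZ normfV normr_id => h.
by rewrite -ler_pdivrMr ?normr_gt0// mulrC.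
Qed.

Lemma bop_norm_le (V W : normedModType R) (f : bop V W) (M : R) : 0 <= M ->
  (forall x : V, `|f x| <= M * `|x|) -> `|f| <= M.
Proof.
move=> M0 fM; apply: opnorm_le => x x1; apply: (le_trans (fM x)).
by rewrite -[leRHS]mulr1 ler_wpM2l.
Qed.

Lemma linear_functional_continuous (V W : normedModType R) (f : V -> W) (M : R) :
  linear f -> (forall x, `|f x| <= M * `|x|) -> continuous f.
Proof.
move=> lf fM.
pose F : {linear V -> W} := HB.pack f (GRing.isLinear.Build R V W *:%R f lf).
apply: (@bounded_linear_continuous _ _ _ F).
apply/linear_boundedP; near=> r => x; apply: (le_trans (fM x)).
by rewrite ler_wpM2r//; near: r; exact: nbhs_pinfty_ge.
Unshelve. all: by end_near. Qed.

(** A one-sided bound on an additive homogeneous functional is two-sided, by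
    oddness, so it gives continuity. *)
Lemma dominated_functional (V : normedModType R) (f : V -> R) (L : R) :
  (forall x y, f (x + y) = f x + f y) -> (forall a x, f (a *: x) = a * f x) ->
  (forall x, f x <= L * `|x|) -> exists th : dual V, forall x, th x = f x.
Proof.
move=> fD fZ fL.
have lf : linear (f : V -> R^o) by move=> a x y; rewrite fD fZ.
have fb x : `|(f : V -> R^o) x| <= L * `|x|.
  rewrite ler_norml fL andbT lerNl.
  by have := fL (- x); rewrite -scaleN1r fZ scaleN1r normrN mulN1r.
have h : (f : V -> R^o) \in @contlin R V R^o.
  by apply/mem_set; split => //; exact: (linear_functional_continuous lf fb).
by exists (BOp h).
Qed.

Lemma norming_functional (V : normedModType R) (v : V) :
  exists2 th : dual V, `|th| <= 1 & th v = `|v|.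
Proof.
have [|f [fD fZ fn fv]] := @hahn_banach R V (fun x => `|x|) v.
  by split=> [x y|a x a0]; [exact: ler_normD|rewrite normrZ gtr0_norm].
have [|th thE] := @dominated_functional V f 1 fD fZ.
  by move=> x; rewrite mul1r.
exists th; last by rewrite thE.
apply: bop_norm_le => // x; rewrite mul1r thE ler_norml fn andbT lerNl.
by have := fn (- x); rewrite -scaleN1r fZ mulN1r scaleN1r normrN.
Qed.

Lemma evaluation (V : normedModType R) (x : V) :
  exists xi : dual (dual V), forall f, xi f = f x.
Proof.
by apply: (@dominated_functional (dual V) (fun f => f x) `|x|) => // f;
  rewrite (le_trans (ler_norm _))// (le_trans (bop_bound f x))// mulrC.
Qed.

Lemma dual_le (V : normedModType R) (f : dual V) x : f x <= `|f| * `|x|.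
Proof. exact: le_trans (ler_norm _) (bop_bound _ _). Qed.

Lemma dualZ (V : normedModType R) (f : dual V) a x : f (a *: x) = a * f x :> R.
Proof. by rewrite linearZ. Qed.

Lemma dualD (V : normedModType R) (f : dual V) x y : f (x + y) = f x + f y :> R.
Proof. by rewrite linearD. Qed.

Lemma dualB (V : normedModType R) (f : dual V) x y : f (x - y) = f x - f y :> R.
Proof. by rewrite linearB. Qed.

Lemma dualN (V : normedModType R) (f : dual V) x : f (- x) = - f x :> R.
Proof. by rewrite linearN. Qed.

Lemma adjoint_norm (V W : normedModType R) (N : bop V W) (th : dual W) :
  `|adjoint N th| <= `|th| * `|N|.
Proof.
apply: bop_norm_le => [|x]; first by rewrite mulr_ge0.
apply: (le_trans (bop_bound th (N x))).
by rewrite -mulrA ler_wpM2l// bop_bound.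
Qed.

End dual_basics.

(** * Clarke's calculus in one direction *)

Lemma near_norm_le (R : realType) (V : normedModType R) (x : V) (e : R) :
  0 < e -> \forall y \near x, `|x - y| <= e.
Proof.
move=> e0; apply/nbhs_normP; exists e => //= y; exact: ltW.
Qed.

Section clarke.
Context {R : realType} {V : normedModType R} (F : V -> R).
Hypothesis lipF : locally_lipschitz F.
Implicit Types x v w : V.

Let base x := filter_prod (nbhs x) (0 : R)^'+.

Let quot v (p : V * R) : R := (F (p.1 + p.2 *: v) - F p.1) / p.2.

Definition clarke_dir x v : R := fine (clarke_dd F x v).

Lemma locally_lipschitz_bound x : exists2 L, 0 < L & exists2 U : set V, nbhs x U &
  forall y z, U y -> U z -> `|F y - F z| <= L * `|y - z|.
Proof.
have [U xU] := lipF x; rewrite /lipschitz_on => /pinfty_ex_gt0[L L0 UL].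
exists L => //; exists U => // y z Uy Uz.
exact: (UL (y, z) (conj Uy Uz)).
Qed.

Lemma locally_lipschitz_continuous : continuous F.
Proof.
move=> x; have [L L0 [U xU UL]] := locally_lipschitz_bound x.
apply/cvgrPdist_le => e e0; near=> y.
apply: (le_trans (UL _ _ (nbhs_singleton xU) _)); first by near: y.
rewrite -ler_pdivlMl//; near: y.
by apply: near_norm_le; rewrite mulr_gt0// invr_gt0.
Unshelve. all: by end_near. Qed.

Lemma base_snd x : snd @ base x --> (0 : R).
Proof. by apply: cvg_trans; [exact: cvg_snd|exact: cvg_within]. Qed.

(** Moving the base point along [v] by the increment itself does not leave the
    filter of the limsup; subadditivity of the directional derivative rests on
    this. *)
Lemma base_shift x v :
  (fun p : V * R => (p.1 + p.2 *: v, p.2)) @ base x --> base x.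
Proof.
apply: (@cvg_pair _ _ _ (base x) (nbhs x) (0 : R)^'+); last exact: cvg_snd.
rewrite -[X in _ --> nbhs X](addr0 x) -(scale0r v).
apply: cvgD; first exact: cvg_fst.
by apply: cvgZr_tmp; exact: base_snd.
Qed.

Lemma base_gt0 x : \forall p \near base x, 0 < p.2.
Proof.
exists (setT, [set r : R | 0 < r]) => /=; last by move=> ? [].
by split; [exact: filterT|exact: nbhs_right_gt].
Qed.

Lemma base_fst x U : nbhs x U -> \forall p \near base x, U p.1.
Proof.
move=> xU; exists (U, setT) => /=; last by move=> ? [].
by split => //; exact: filterT.
Qed.

Lemma clarke_dd_le x v c : (\forall p \near base x, quot v p <= c) ->
  (clarke_dd F x v <= c%:E)%E.
Proof.
move=> h; apply: (@le_trans _ _ (ereal_sup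
    ((fun p => (quot v p)%:E) @` [set p | quot v p <= c]))).
  by apply: ereal_inf_lbound; exists [set p | quot v p <= c].
by apply: ge_ereal_sup => _ [p /= pc <-]; rewrite lee_fin.
Qed.

Lemma le_clarke_dd x v c : (\forall p \near base x, c <= quot v p) ->
  (c%:E <= clarke_dd F x v)%E.
Proof.
move=> h; apply: le_ereal_inf_tmp => _ [B xB <-].
have [p [Bp cp]] := @filter_ex _ (base x) _ _ (@filterI _ (base x) _ _ _ xB h).
apply: le_trans (_ : (quot v p)%:E <= _)%E; first by rewrite lee_fin.
by apply: ereal_sup_ubound; exists p.
Qed.

Lemma quot_bound x : exists2 L, 0 < L & forall v,
  \forall p \near base x, `|quot v p| <= L * `|v|.
Proof.
have [L L0 [U xU UL]] := locally_lipschitz_bound x.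
exists L => // v; near=> p.
have p0 : 0 < p.2 by near: p; exact: base_gt0.
rewrite normrM normfV (gtr0_norm p0) ler_pdivrMr// -mulrA.
have -> : `|v| * p.2 = `|p.1 + p.2 *: v - p.1|.
  by rewrite addrAC subrr add0r normrZ gtr0_norm// mulrC.
apply: UL; near: p; last exact: base_fst.
exact: (@base_shift x v _ (base_fst xU)).
Unshelve. all: by end_near. Qed.

Lemma clarke_dirE x v : clarke_dd F x v = (clarke_dir x v)%:E.
Proof.
have [L L0 hL] := quot_bound x.
have h1 : (clarke_dd F x v <= (L * `|v|)%:E)%E.
  by apply: clarke_dd_le; apply: filterS (hL v) => p; rewrite ler_norml => /andP[].
have h2 : ((- (L * `|v|))%:E <= clarke_dd F x v)%E.
  by apply: le_clarke_dd; apply: filterS (hL v) => p; rewrite ler_norml => /andP[].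
rewrite /clarke_dir fineK// fin_numE; apply/andP; split.
  by apply/eqP => h; rewrite h in h2.
by apply/eqP => h; rewrite h in h1.
Qed.

Lemma clarke_dir_le x v c : (\forall p \near base x, quot v p <= c) ->
  clarke_dir x v <= c.
Proof. by move=> /clarke_dd_le; rewrite clarke_dirE lee_fin. Qed.

Lemma clarke_dir_near x v c : clarke_dir x v < c ->
  \forall p \near base x, quot v p <= c.
Proof.
rewrite -lte_fin -clarke_dirE => /ereal_inf_lt[_ [B xB <-] Bc].
apply: filterS xB => p Bp; rewrite -lee_fin; apply/ltW/le_lt_trans/Bc.
by apply: ereal_sup_ubound; exists p.
Qed.

Lemma clarke_gradientP x (th : dual V) :
  clarke_gradient F x th <-> forall v, th v <= clarke_dir x v.
Proof.
by split=> h v; have := h v; rewrite ?clarke_dirE lee_fin.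
Qed.

Lemma clarke_dir_bound x : exists2 L, 0 < L & forall v, clarke_dir x v <= L * `|v|.
Proof.
have [L L0 hL] := quot_bound x; exists L => // v; apply: clarke_dir_le.
by apply: filterS (hL v) => p; rewrite ler_norml => /andP[].
Qed.

Lemma clarke_dir_sublinear x : sublinear (clarke_dir x).
Proof.
split=> [v w|a v a0].
  apply/ler_addgt0Pr => e e0; apply: clarke_dir_le.
  have e2 : 0 < e / 2 by rewrite divr_gt0.
  have hv : clarke_dir x v < clarke_dir x v + e / 2 by rewrite ltrDl.
  have hw : clarke_dir x w < clarke_dir x w + e / 2 by rewrite ltrDl.
  have {}hw : \forall p \near base x,
      quot w (p.1 + p.2 *: v, p.2) <= clarke_dir x w + e / 2
    := @base_shift x v _ (clarke_dir_near hw).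
  near=> p; have h1 : quot v p <= clarke_dir x v + e / 2.
    by near: p; exact: clarke_dir_near.
  have h2 : quot w (p.1 + p.2 *: v, p.2) <= clarke_dir x w + e / 2 by near: p.
  have -> : quot (v + w) p = quot v p + quot w (p.1 + p.2 *: v, p.2).
    by rewrite /quot/= -mulrDl scalerDr addrA; congr (_ / _); ring.
  by lra.
apply/ler_addgt0Pr => e e0; apply: clarke_dir_le.
have h : clarke_dir x v < clarke_dir x v + e / a by rewrite ltrDl divr_gt0.
have cvga : (fun p : V * R => (p.1, a * p.2)) @ base x --> base x.
  apply: (@cvg_pair _ _ _ (base x) (nbhs x) (0 : R)^'+); first exact: cvg_fst.
  move=> B B0; have ha : a * p.2 @[p --> base x] --> (0 : R).
    by rewrite -(mulr0 a); apply: cvgMl_tmp; exact: base_snd.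
  have hB : \forall p \near base x, 0 < a * p.2 -> B (a * p.2) := ha _ B0.
  suff : \forall p \near base x, B (a * p.2) by [].
  by apply: filterS2 (base_gt0 x) hB => p p0; apply; exact: mulr_gt0.
have hq : \forall p \near base x, quot v (p.1, a * p.2) <= clarke_dir x v + e / a
  := cvga _ (clarke_dir_near h).
near=> p.
have p0 : 0 < p.2 by near: p; exact: base_gt0.
have h1 : quot v (p.1, a * p.2) <= clarke_dir x v + e / a by near: p.
have -> : quot (a *: v) p = a * quot v (p.1, a * p.2).
  by rewrite /quot/= scalerA (mulrC p.2) invfM mulrCA mulVKf// gt_eqF.
rewrite -ler_pdivlMl// mulrDr mulKf ?gt_eqF//.
by rewrite (mulrC _ e).
Unshelve. all: by end_near. Qed.

(** The Hahn-Banach theorem, applied to the sublinear functional [clarke_dir x]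
    along [v], produces a subgradient that attains the directional derivative.
    This is how hypotheses on gradients give information on the function. *)
Lemma clarke_gradient_max x v :
  exists2 th : dual V, clarke_gradient F x th & th v = clarke_dir x v.
Proof.
have [f [fD fZ fle fv]] := hahn_banach v (clarke_dir_sublinear x).
have [L L0 hL] := clarke_dir_bound x.
have [th thE] := dominated_functional fD fZ (fun w => le_trans (fle w) (hL w)).
by exists th; rewrite ?thE//; apply/clarke_gradientP => w; rewrite thE.
Qed.

Lemma clarke_dir_usc x v c : clarke_dir x v < c ->
  \forall x' \near x, clarke_dir x' v <= c.
Proof.
move=> /clarke_dir_near[[A B]/= [xA B0] AB].
apply: filterS (nbhs_interior xA) => x' Ax'.
by apply: clarke_dir_le; exists (A, B).
Qed.

Lemma le_clarke_dir_near x v e : 0 < e -> \forall h \near (0 : R)^'+,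
  F (x + h *: v) - F x <= h * (clarke_dir x v + e).
Proof.
move=> e0; have : clarke_dir x v < clarke_dir x v + e by rewrite ltrDl.
move=> /clarke_dir_near[[A B]/= [xA B0] AB]; near=> h.
have h0 : 0 < h by near: h; exact: nbhs_right_gt.
rewrite mulrC -ler_pdivrMr//; apply: (AB (x, h)); split => /=.
  exact: nbhs_singleton.
by near: h.
Unshelve. all: by end_near. Qed.

End clarke.

(** Mean value theorem for Dini derivatives. With the slack [e s] added, the
    points where [psi] lies below its value at [1] have an infimum; the slope
    hypothesis at this infimum would produce a smaller such point, unless it
    is [0]. *)
Lemma dini_le {R : realType} (psi : R -> R) : continuous psi ->
  (forall s, 0 < s <= 1 -> forall e, 0 < e ->
    \forall h \near 0^'+, psi (s - h) - psi s <= h * e) ->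
  psi 0 <= psi 1.
Proof.
move=> cpsi hpsi; apply/ler_addgt0Pr => e e0.
pose phi s := psi s + e * s.
have cphi : continuous phi.
  move=> s; apply: cvgD; first exact: cpsi.
  by apply: cvgMl_tmp; exact: cvg_id.
pose E := [set s | 0 <= s <= 1 /\ phi s <= phi 1].
have E1 : E 1 by split; rewrite ?ler01 ?lexx.
have lbE : has_lbound E by exists 0 => s [/andP[]].
have infE : has_inf E by split => //; exists 1.
have i0 : 0 <= inf E by apply: lb_le_inf; [exists 1|move=> s [/andP[]]].
have i1 : inf E <= 1 by exact: ge_inf.
have Ei : phi (inf E) <= phi 1.
  rewrite leNgt; apply/negP => h.
  have /nbhs_normP[d /= d0 hd] : \forall s \near inf E, phi 1 < phi s.
    exact: (cvgr_gt (phi (inf E)) (cphi (inf E))) h.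
  have [s Es sd] := inf_adherent d0 infE.
  have : phi 1 < phi s.
    apply: hd => /=; rewrite ltr_distlC; have := ge_inf lbE Es.
    by move=> ?; apply/andP; split; lra.
  by rewrite ltNge Es.2.
have [i00|ipos] := eqVneq (inf E) 0.
  by move: Ei; rewrite i00 /phi mulr0 addr0 mulr1.
have {}ipos : 0 < inf E by rewrite lt_neqAle eq_sym ipos.
exfalso.
have hi : \forall h \near (0 : R)^'+, psi (inf E - h) - psi (inf E) <= h * e.
  by apply: hpsi => //; rewrite ipos.
have [h [h0 hle hE]] : exists h, [/\ 0 < h, h <= inf E &
    psi (inf E - h) - psi (inf E) <= h * e].
  apply: (@filter_ex _ (0 : R)^'+); near=> h; split; near: h => //.
    exact: nbhs_right_gt.
  exact: nbhs_right_le.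
have : E (inf E - h).
  split; first by apply/andP; split; lra.
  by apply: le_trans Ei; rewrite /phi; lra.
by move/(ge_inf lbE); lra.
Unshelve. all: by end_near. Qed.

Section clarke_mean_value.
Context {R : realType} {V : normedModType R} (F : V -> R).
Hypothesis lipF : locally_lipschitz F.
Implicit Types x v w : V.

(** The backward slope of [s |-> F (x + s w)] is at most the directional
    derivative in direction [- w]; adding the primitive of [a + b s] makes it
    nonpositive, and [dini_le] applies. *)
Lemma clarke_mean_value x w (a b : R) :
  (forall s, 0 < s <= 1 -> clarke_dir F (x + s *: w) (- w) <= a + b * s) ->
  F x <= F (x + w) + a + b / 2.
Proof.
move=> hab; pose psi s := F (x + s *: w) + (a * s + b / 2 * s ^+ 2).
have : psi 0 <= psi 1.
  apply: dini_le => [s|s s01 e e0].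
    apply: cvgD.
      apply: (@cvg_comp _ _ _ (fun r : R => x + r *: w) F _ (nbhs (x + s *: w))).
        by apply: cvgD; [exact: cvg_cst|apply: cvgZr_tmp; exact: cvg_id].
      exact: locally_lipschitz_continuous.
    by apply: cvgD; apply: cvgMl_tmp; [exact: cvg_id|exact: exprn_continuous].
  have e2 : 0 < e / 2 by rewrite divr_gt0.
  near=> h.
  have h0 : 0 < h by near: h; exact: nbhs_right_gt.
  have h1 : F (x + s *: w + h *: (- w)) - F (x + s *: w) <=
      h * (clarke_dir F (x + s *: w) (- w) + e / 2).
    by near: h; exact: le_clarke_dir_near.
  have hb : h * `|b| <= e.
    have : h <= e / (`|b| + 1) by near: h; apply: nbhs_right_le; rewrite divr_gt0// ltr_wpDl.
    rewrite ler_pdivlMr ?ltr_wpDl// mulrDr mulr1; nra.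
  have hbb : h * b <= e.
    by apply: le_trans hb; rewrite ler_pM2l// ler_norm.
  have -> : psi (s - h) - psi s = (F (x + s *: w + h *: (- w)) - F (x + s *: w))
      + h * (b / 2 * h - a - b * s).
    have eqx : x + (s - h) *: w = x + s *: w + h *: (- w).
      by rewrite scalerBl scalerN addrA.
    by rewrite /psi eqx; field.
  have := hab _ s01 => h2.
  have h3 : h * (clarke_dir F (x + s *: w) (- w) + e / 2) <= h * (a + b * s + e / 2).
    by rewrite ler_pM2l// lerD2r.
  have h4 : h * (b * h) <= h * e by rewrite ler_pM2l// mulrC.
  nra.
rewrite /psi scale0r scale1r addr0; lra.
Unshelve. all: by end_near. Qed.

(** Lebourg's mean value inequality, in the form needed for a gradient bounded
    along a half-open segment. *)
Lemma lipschitz_of_gradient_bound x w (L : R) :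
  (forall s th, 0 < s <= 1 -> clarke_gradient F (x + s *: w) th -> `|th| <= L) ->
  F x <= F (x + w) + L * `|w|.
Proof.
move=> hL; have := @clarke_mean_value x w (L * `|w|) 0.
rewrite mul0r addr0; apply => s s01; rewrite mul0r addr0.
have [th thF <-] := clarke_gradient_max lipF (x + s *: w) (- w).
rewrite (le_trans (dual_le _ _))// normrN ler_wpM2r//; exact: hL thF.
Qed.

(** Relaxed monotonicity of the generalized gradient, integrated along a
    segment, makes [F] convex up to a quadratic term. *)
Lemma semiconvex_subgradient (c : R) x w th :
  (forall y1 y2 th1 th2, clarke_gradient F y1 th1 -> clarke_gradient F y2 th2 ->
    - c * `|y1 - y2| ^+ 2 <= (th1 - th2) (y1 - y2)) ->
  clarke_gradient F x th ->
  th w <= F (x + w) - F x + c / 2 * `|w| ^+ 2.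
Proof.
move=> hc hth.
suff : F x <= F (x + w) + - th w + (c * `|w| ^+ 2) / 2 by lra.
apply: clarke_mean_value => s /andP[s0 s1].
have [th' thF <-] := clarke_gradient_max lipF (x + s *: w) (- w).
have := hc _ _ _ _ thF hth; rewrite addrAC subrr add0r normrZ gtr0_norm//.
rewrite linearZ/= linearN /= => h.
have : - c * (s * `|w|) ^+ 2 <= s * (th' w - th w) by [].
have -> : - c * (s * `|w|) ^+ 2 = s * (- c * s * `|w| ^+ 2) by ring.
by rewrite ler_pM2l//; lra.
Qed.

End clarke_mean_value.

(** * A skew-symmetric game and finite systems of monotone inequalities *)

Section skew_game.
Context {R : realType} {n : nat}.
Implicit Types (l : 'I_n.+1 -> R) (K : 'I_n.+1 -> 'I_n.+1 -> R).

Definition weights l := (forall i, 0 <= l i) /\ \sum_i l i = 1.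

Lemma weights_compact :
  compact [set v : 'rV[R]_n.+1 | weights (fun i => v ord0 i)].
Proof.
have -> : [set v : 'rV[R]_n.+1 | weights (fun i => v ord0 i)] =
    [set v : 'rV[R]_n.+1 | forall i, `[0, 1]%classic (v ord0 i)] `&`
    (fun v : 'rV[R]_n.+1 => \sum_i v ord0 i) @^-1` [set 1].
  apply/seteqP; split => [v [v0 v1]|v [v01 v1]]; split => // i.
    rewrite /= in_itv/= v0/= -v1 (bigD1 i)//= lerDl sumr_ge0//.
  by have := v01 i; rewrite /= in_itv/= => /andP[].
apply: compact_closedI.
  by apply: (@rV_compact R _ (fun=> `[0, 1]%classic)) => _; exact: segment_compact.
apply: closed_comp; last exact: closed_eq.
move=> v _; apply: continuous_big => [|i _]; first exact: add_continuous.
exact: coord_continuous.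
Qed.

(* squared Euclidean norm of the shortfall, i.e. of the negative part of [K l] *)
Let loss K l : R := \sum_i (Num.max 0 (- \sum_j K i j * l j)) ^+ 2.

Lemma scaled_coord_continuous (c : R) j :
  continuous (fun v : 'rV[R]_n.+1 => c * v ord0 j).
Proof.
move=> v; apply: (@cvgMl_tmp R _ (nbhs v) _ (fun w : 'rV[R]_n.+1 => w ord0 j)).
exact: coord_continuous.
Qed.

Lemma loss_min K : exists2 l, weights l & forall l', weights l' -> loss K l <= loss K l'.
Proof.
have [||v vA vmin] := @compact_EVT_min _ R (fun v : 'rV[R]_n.+1 => loss K (fun i => v ord0 i))
   _ _ weights_compact _.
- exists (\row_i (i == ord0)%:R); split => [i|]; rewrite ?mxE//.
  rewrite (bigD1 ord0)//= mxE eqxx big1 ?addr0// => i /negPf i0.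
  by rewrite mxE i0.
- apply: continuous_subspaceT => v.
  apply: continuous_big => [|i _ x]; first exact: add_continuous.
  apply: (@continuous_comp _ _ _
    (fun v : 'rV[R]_n.+1 => Num.max 0 (- \sum_j K i j * v ord0 j))
    (fun x : R => x ^+ 2) x); last exact: exprn_continuous.
  apply: (@continuous_max R _ (fun=> 0) (fun v : 'rV[R]_n.+1 => - \sum_j K i j * v ord0 j)).
    exact: cst_continuous.
  apply: continuousN; move: x.
  apply: continuous_big => [|j _ y]; first exact: add_continuous.
  exact: scaled_coord_continuous.
exists (fun i => v ord0 i); first by move/set_mem: vA.
move=> l' wl'; have := vmin (\row_i l' i).
have E : (fun i => (\row_i l' i) ord0 i) = l' by apply/funext => i; rewrite mxE.
by rewrite E; apply; apply/mem_set; rewrite /= E.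
Qed.

(** A skew-symmetric matrix game has value zero.  At a minimizer of the squared
    shortfall, the shortfall vector itself, if nonzero, is (after scaling) an
    optimal strategy. *)
Lemma skew_game K : (forall i j, K i j = - K j i) ->
  exists2 l, weights l & forall i, 0 <= \sum_j K i j * l j.
Proof.
move=> skewK; have [l wl lmin] := loss_min K.
pose u i := \sum_j K i j * l j.
pose r i := Num.max 0 (- u i).
have r0 i : 0 <= r i by rewrite le_max lexx.
have [rz|rnz] := eqVneq (\sum_i r i) 0.
  exists l => // i; have /eqP := rz.
  rewrite psumr_eq0// => /allP/(_ i (mem_index_enum _))/eqP ri.
  have : - u i <= r i by rewrite le_max lexx orbT.
  by rewrite ri oppr_le0.
have rpos : 0 < \sum_i r i by rewrite lt_neqAle eq_sym rnz sumr_ge0.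
have ru i : r i * u i = - r i ^+ 2.
  by rewrite /r; case: (leP 0 (- u i)) => h; rewrite ?expr2 ?mul0r ?oppr0//; ring.
(* first-order condition at [l] in the direction of the vertex [k] *)
have key k : 0 <= \sum_j K k j * r j.
  pose d i := K i k - u i.
  have hd s : 0 < s <= 1 -> (\sum_i r i * d i) * 2 <= s * \sum_i d i ^+ 2.
    move=> /andP[s0 s1].
    pose l' i := l i + s * ((i == k)%:R - l i).
    have wl' : weights l'.
      split => [i|].
        rewrite /l' mulrBr addrCA -{1}(mul1r (l i)) -mulrBl.
        by rewrite addr_ge0// mulr_ge0 ?ler0n ?(ltW s0) ?subr_ge0// wl.1.
      rewrite big_split/= wl.2 -mulr_sumr sumrB wl.2 (bigD1 k)//= eqxx.
      by rewrite big1 => [|i /negPf->//]; rewrite addr0 subrr mulr0 addr0.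
    have ul' i : \sum_j K i j * l' j = u i + s * d i.
      rewrite /l' /d.
      have <- : \sum_j K i j * (j == k)%:R = K i k.
        rewrite (bigD1 k)//= eqxx mulr1.
        by rewrite big1 ?addr0// => j /negPf->; rewrite mulr0.
      under eq_bigr do rewrite mulrDr mulrCA mulrBr.
      by rewrite big_split/= -mulr_sumr sumrB.
    have : loss K l <= \sum_i (r i - s * d i) ^+ 2.
      apply: (le_trans (lmin _ wl')); apply: ler_sum => i _; rewrite ul'.
      rewrite -[leRHS]real_normK ?num_real// ler_pXn2r ?nnegrE ?le_max ?lexx//.
      rewrite ge_max normr_ge0/= (le_trans _ (ler_norm _))//.
      have : - u i <= r i by rewrite le_max lexx orbT.
      by lra.
    have -> : \sum_i (r i - s * d i) ^+ 2 =
        loss K l + s * (s * \sum_i d i ^+ 2 - (\sum_i r i * d i) * 2).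
      rewrite /loss -/(u _) mulrBr mulrA mulr_suml !mulr_sumr -sumrB -big_split/=.
      by apply: eq_bigr => i _; rewrite -/(u i) -/(r i); ring.
    by rewrite lerDl pmulr_rge0// subr_ge0.
  have hrd : \sum_i r i * d i <= 0.
    rewrite leNgt; apply/negP => h.
    have h1 := hd 1 ltac:(by rewrite ltr01 lexx).
    set D := \sum_i d i ^+ 2 in hd h1; set P := \sum_i r i * d i in h hd h1.
    have D0 : 0 < D by lra.
    have PD : 0 < P / D <= 1.
      by rewrite divr_gt0//= ler_pdivrMr//; lra.
    have := hd _ PD; rewrite divfK ?gt_eqF//; lra.
  have -> : \sum_j K k j * r j = - \sum_i r i * d i + \sum_i r i ^+ 2.
    rewrite -sumrN -big_split/=; apply: eq_bigr => i _.
    by rewrite skewK /d mulrBr ru; ring.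
  rewrite addr_ge0 ?oppr_ge0// sumr_ge0// => i _; exact: sqr_ge0.
exists (fun i => r i / \sum_i r i).
  by split => [i|]; [rewrite divr_ge0// ltW|rewrite -mulr_suml divff].
move=> i; under eq_bigr do rewrite mulrA.
by rewrite -mulr_suml divr_ge0// ltW.
Qed.

End skew_game.

Section minty.
Context {R : realType} {X : normedModType R}.
Implicit Types (G : set (X * dual X)) (s : seq (X * dual X)).

Lemma sqr_sum_le n (l t : 'I_n.+1 -> R) : weights l ->
  (\sum_j l j * t j) ^+ 2 <= \sum_j l j * t j ^+ 2.
Proof.
move=> [l0 l1]; set S := \sum_j l j * t j.
have : 0 <= \sum_j l j * (t j - S) ^+ 2.
  by apply: sumr_ge0 => j _; rewrite mulr_ge0// sqr_ge0.
have -> : \sum_j l j * (t j - S) ^+ 2 =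
    \sum_j l j * t j ^+ 2 - (S *+ 2) * \sum_j l j * t j + S ^+ 2 * \sum_j l j.
  rewrite !mulr_sumr -sumrB -big_split/=.
  by apply: eq_bigr => j _; ring.
by rewrite l1 -/S; lra.
Qed.

Definition strongly_monotone_graph G (mu : R) :=
  forall p q, G p -> G q -> mu * `|p.1 - q.1| ^+ 2 <= (p.2 - q.2) (p.1 - q.1).

(** Seek [y] as a convex combination of the first components. The inequalities
    to solve then form a matrix game whose symmetric part is nonnegative by
    monotonicity, so its skew part, of value zero, is already winning. Half of
    the monotonicity constant is spent on this; the other half gives the
    quadratic term, which bounds [y] independently of the finite family. *)
Lemma finite_minty G (mu : R) s : 0 <= mu -> strongly_monotone_graph G mu ->
  (forall p, p \in s -> G p) ->
  exists y, forall p, p \in s -> mu / 2 * `|p.1 - y| ^+ 2 <= p.2 (p.1 - y).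
Proof.
move=> mu0 Gmu sG; case: s sG => [|p0 s'] sG; first by exists 0.
set s := p0 :: s' in sG *; pose n := size s'.
pose x (i : 'I_n.+1) := (nth p0 s i).1; pose b (i : 'I_n.+1) := (nth p0 s i).2.
have Gi i : G (x i, b i) by rewrite /x /b -surjective_pairing; apply: sG; exact: mem_nth.
(* payoff of the game; [K] is its skew part *)
pose a i j := b i (x i - x j) - mu / 2 * `|x i - x j| ^+ 2.
have aa i j : 0 <= a i j + a j i.
  have h : mu * `|x i - x j| ^+ 2 <= b i (x i - x j) - b j (x i - x j) :=
    Gmu _ _ (Gi i) (Gi j).
  have : b j (x j - x i) = - b j (x i - x j) by rewrite -opprB linearN.
  by rewrite /a (distrC (x j)); lra.
pose K i j := (a i j - a j i) / 2.
have [|l wl hl] := @skew_game R n K.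
  by move=> i j; rewrite /K; field.
exists (\sum_j l j *: x j) => p ps.
have [i -> ->] : exists2 i : 'I_n.+1, p.1 = x i & p.2 = b i.
  have hi : (index p s < n.+1)%N by rewrite index_mem.
  by exists (Ordinal hi); rewrite /x /b/= nth_index.
set y := \sum_j l j *: x j.
have xy : x i - y = \sum_j l j *: (x i - x j).
  under [RHS]eq_bigr do rewrite scalerBr.
  by rewrite sumrB -scaler_suml wl.2 scale1r.
have h1 : 0 <= \sum_j a i j * l j.
  apply: (le_trans (hl i)); apply: ler_sum => j _; rewrite ler_wpM2r ?wl.1//.
  by have := aa i j; rewrite /K; lra.
have h2 : \sum_j a i j * l j = b i (x i - y) - mu / 2 * \sum_j l j * `|x i - x j| ^+ 2.
  rewrite xy raddf_sum mulr_sumr -sumrB; apply: eq_bigr => j _.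
    by rewrite /= dualZ /a; ring.
have h3 : `|x i - y| ^+ 2 <= \sum_j l j * `|x i - x j| ^+ 2.
  apply: le_trans (sqr_sum_le _ wl); rewrite ler_pXn2r ?nnegrE//; last first.
    by apply: sumr_ge0 => j _; rewrite mulr_ge0// wl.1.
  rewrite xy (le_trans (ler_norm_sum _ _ _))//; apply: ler_sum => j _.
  by rewrite normrZ ger0_norm// wl.1.
have : mu / 2 * `|x i - y| ^+ 2 <= mu / 2 * \sum_j l j * `|x i - x j| ^+ 2.
  by rewrite ler_wpM2l// divr_ge0.
by move: h1; rewrite h2; lra.
Qed.

(** Along an ultrafilter on the finite subsets of the graph, the bounded finite
    solutions converge weakly: the limits of their values under functionals
    define an element of the bidual, which reflexivity represents. The
    inequalities are affine in [y], hence survive the limit. *)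
Lemma minty_solution G (mu : R) : reflexive_space X -> 0 < mu ->
  G !=set0 -> strongly_monotone_graph G mu ->
  exists y, forall p, G p -> 0 <= p.2 (p.1 - y).
Proof.
move=> reflX mu0 [p0 Gp0] Gmu.
pose I := seq (X * dual X).
have hY s : exists y, (forall p, p \in s -> G p) ->
    forall p, p \in s -> mu / 2 * `|p.1 - y| ^+ 2 <= p.2 (p.1 - y).
  have [sG|nsG] := pselect (forall p, p \in s -> G p); last by exists 0 => /nsG.
  by have [y yP] := finite_minty (ltW mu0) Gmu sG; exists y.
have [Y YP] := choice hY.
pose B := [set s : I | forall p, p \in s -> G p].
pose above (t : I) := [set s : I | B s /\ {subset t <= s}].
have FF : Filter (filter_from B above).
  apply: filter_from_filter; first by exists [::].
  move=> s t Bs Bt; exists (s ++ t).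
    by move=> p; rewrite mem_cat => /orP[/Bs|/Bt].
  move=> r [Br str]; split; split => // p ps; apply: str; rewrite mem_cat ps ?orbT//.
have PF : ProperFilter (filter_from B above).
  by apply: filter_from_proper => s Bs; exists s; split.
have [U [UU FU]] := ultraFilterLemma PF.
have near_in p : G p -> U [set s | B s /\ p \in s].
  move=> Gp; apply: FU; exists [:: p].
    by move=> q; rewrite inE => /eqP->.
  by move=> s [Bs /(_ p)]; rewrite inE eqxx => /(_ isT).
have Uineq p : G p -> \forall s \near U,
    mu / 2 * `|p.1 - Y s| ^+ 2 <= p.2 (p.1 - Y s).
  by move=> Gp; apply: filterS (near_in _ Gp) => s [Bs ps]; exact: YP.
pose C := `|p0.1| + 2 * `|p0.2| / mu.
have UC : \forall s \near U, `|Y s| <= C.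
  apply: filterS (Uineq _ Gp0) => s /le_trans/(_ (dual_le _ _)).
  set d := `|p0.1 - Y s| => h.
  have dle : d <= 2 * `|p0.2| / mu.
    rewrite ler_pdivlMr//; have [d0|d0] := eqVneq d 0.
      by rewrite d0 mul0r mulr_ge0.
    have dpos : 0 < d by rewrite lt_neqAle eq_sym d0 normr_ge0.
    have : d * (mu / 2 * d) <= d * `|p0.2| by move: h; rewrite expr2; lra.
    by rewrite ler_pM2l//; lra.
  have -> : Y s = p0.1 - (p0.1 - Y s) by rewrite opprB addrC subrK.
  by rewrite (le_trans (ler_normB _ _))// /C lerD2l.
have UPF : ProperFilter U by exact: ultra_proper.
have cvgY (f : dual X) : cvg ((f (Y s) : R) @[s --> U]).
  pose c := `|f| * C.
  have [|l [_ hl]] := @segment_compact R (- c) c ((f (Y s) : R) @[s --> U]) _.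
    suff: \forall s \near U, `[- c, c]%classic (f (Y s)) by [].
    near=> s; rewrite /= in_itv/= -ler_norml.
    apply: (le_trans (bop_bound f (Y s))); rewrite ler_wpM2l//.
    by near: s.
  apply/cvg_ex; exists l => O lO.
  have [//|UB] := in_ultra_setVsetC ((fun s => f (Y s)) @^-1` O) UU.
  by have [r []] := hl (~` O) O UB lO.
pose xi (f : dual X) : R := lim ((f (Y s) : R) @[s --> U]).
have xiP (f : dual X) : (f (Y s) : R) @[s --> U] --> xi f by exact: cvgY.
have [|||xi' xi'E] := @dominated_functional R (dual X) xi C.
- move=> f g; apply: cvg_lim => //; apply: cvgD; exact: xiP.
- move=> a f; apply: cvg_lim => //; apply: cvgMl_tmp; exact: xiP.
- move=> f; apply: limr_le; first exact: cvgY.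
  near=> s; apply: (le_trans (dual_le _ _)); rewrite mulrC ler_wpM2r//.
  by near: s.
have [y yP] := reflX xi'.
exists y => p Gp; rewrite linearB/= -yP xi'E subr_ge0.
apply: limr_le; first exact: cvgY.
near=> s; rewrite -subr_ge0.
have h : mu / 2 * `|p.1 - Y s| ^+ 2 <= p.2 (p.1 - Y s) by near: s; exact: Uineq.
move: h; rewrite linearB/=; apply: le_trans.
by rewrite mulr_ge0// ?divr_ge0 ?ltW// sqr_ge0.
Unshelve. all: by end_near. Qed.

End minty.

(** * The stationary inclusion *)

Section static_inclusion.
Context {R : realType} {X Y : normedModType R}.
Variables (N : bop X Y) (mA : R) (Aop : X -> dual X).
Hypothesis monoA : strongly_monotone Aop mA.
Implicit Types (F : Y -> R) (w : dual X) (x y : X).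

Definition relaxed_monotone F (c : R) := forall (y1 y2 : Y) th1 th2,
  clarke_gradient F y1 th1 -> clarke_gradient F y2 th2 ->
  - c * `|y1 - y2| ^+ 2 <= (th1 - th2) (y1 - y2).

Definition solves_inclusion F w y :=
  exists2 eta, (adjoint N @` clarke_gradient F (N y)) eta & Aop y + eta = w.

(** Pulling back by [N] costs a factor [`|N| ^+ 2]; this is why [mA] is compared
    with [c * `|N| ^+ 2]. *)
Lemma pullback_gradient_monotone F (c : R) y1 y2 z1 z2 : 0 <= c ->
  relaxed_monotone F c ->
  (adjoint N @` clarke_gradient F (N y1)) z1 ->
  (adjoint N @` clarke_gradient F (N y2)) z2 ->
  - (c * `|N| ^+ 2) * `|y1 - y2| ^+ 2 <= z1 (y1 - y2) - z2 (y1 - y2).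
Proof.
move=> c0 Fc [th1 h1 <-] [th2 h2 <-] /=.
have h : - c * `|N y1 - N y2| ^+ 2 <= th1 (N y1 - N y2) - th2 (N y1 - N y2) :=
  Fc _ _ _ _ h1 h2.
rewrite linearB; apply: le_trans h.
rewrite !mulNr lerN2 -mulrA ler_wpM2l// -exprMn.
rewrite ler_pXn2r ?nnegrE ?mulr_ge0//.
by rewrite -linearB bop_bound.
Qed.

(** An approximate solution [y1], whose residual element [z1] need not belong to
    the pulled-back gradient, is compared with an exact one. *)
Lemma inclusion_stability F (c : R) y1 y2 w1 w2 z1 z1' : 0 <= c ->
  relaxed_monotone F c -> Aop y1 + z1 = w1 ->
  (adjoint N @` clarke_gradient F (N y1)) z1' -> solves_inclusion F w2 y2 ->
  (mA - c * `|N| ^+ 2) * `|y1 - y2| <= `|w1 - w2| + `|z1 - z1'|.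
Proof.
move=> c0 Fc e1 hz1' [z2 hz2 e2]; set d := y1 - y2.
have [->|d0] := eqVneq d 0; first by rewrite normr0 mulr0 addr_ge0.
have dpos : 0 < `|d| by rewrite normr_gt0.
rewrite -(ler_pM2r dpos) -mulrA -expr2 mulrBl [leRHS]mulrDl.
have h1 : mA * `|d| ^+ 2 <= Aop y1 d - Aop y2 d := monoA y1 y2.
have h2 := pullback_gradient_monotone c0 Fc hz1' hz2; rewrite -/d in h2.
have h3 : w1 d - w2 d <= `|w1 - w2| * `|d| := dual_le (w1 - w2) d.
have h4 : - (z1 d - z1' d) <= `|z1 - z1'| * `|d|.
  have := dual_le (z1' - z1) d; rewrite -(normrN (z1' - z1)) opprB.
  by rewrite opprB; exact.
have e1d : w1 d = Aop y1 d + z1 d :> R by rewrite -e1.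
have e2d : w2 d = Aop y2 d + z2 d :> R by rewrite -e2.
by lra.
Qed.

Hypothesis reflX : reflexive_space X.
Hypothesis demiA : demicontinuous Aop.
Hypothesis surjN : forall u : Y, exists v : X, N v = u.

(** A functional on [X] dominated by [p \o N] vanishes on the kernel of [N],
    so it factors through the surjection [N]. *)
Lemma factor_through_surjection (w : dual X) (p : Y -> R) (L : R) : p 0 = 0 ->
  (forall u, p u <= L * `|u|) -> (forall x, w x <= p (N x)) ->
  exists2 th : dual Y, (forall u, th u <= p u) & adjoint N th = w.
Proof.
move=> p0 pL wp.
have ker x : N x = 0 -> w x = 0 :> R.
  move=> Nx; apply/eqP; rewrite eq_le; apply/andP; split.
    by rewrite (le_trans (wp _))// Nx p0.
  rewrite -oppr_le0 -dualN (le_trans (wp _))// linearN/= Nx oppr0 p0//.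
have eqN x x' : N x = N x' -> w x = w x' :> R.
  move=> e; apply/eqP; rewrite -subr_eq0 -dualB; apply/eqP/ker.
  by rewrite linearB/= e subrr.
have [sec secP] := choice surjN.
have [||u|th thE] := @dominated_functional R Y (fun u => w (sec u)) L.
- by move=> u v; rewrite -dualD; apply: eqN; rewrite linearD/= !secP.
- by move=> a u; rewrite -dualZ; apply: eqN; rewrite linearZ/= !secP.
- by rewrite (le_trans (wp _))// secP.
exists th => [u|]; first by rewrite thE (le_trans (wp _))// secP.
by apply: bopP => x /=; rewrite thE; apply: eqN; rewrite secP.
Qed.

(** Minty's device. The point [y] found by [minty_solution] satisfies the
    inequality at all points of the graph; testing at [y + v / (n + 1)] and
    letting [n] grow, demicontinuity and upper semicontinuity of the directional
    derivative turn it into a variational inequality at [y] itself, which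
    [factor_through_surjection] reads as membership in the gradient. *)
Lemma inclusion_solvable F (c : R) w : 0 <= c -> locally_lipschitz F ->
  relaxed_monotone F c -> c * `|N| ^+ 2 < mA ->
  exists y, solves_inclusion F w y.
Proof.
move=> c0 lipF Fc cA.
pose G := [set p : X * dual X | exists2 z, (adjoint N @` clarke_gradient F (N p.1)) z &
  p.2 = Aop p.1 + z - w].
have grad x : exists z, (adjoint N @` clarke_gradient F (N x)) z.
  by have [th hth _] := clarke_gradient_max lipF (N x) 0; exists (adjoint N th), th.
have [|||y yP] := @minty_solution R X G (mA - c * `|N| ^+ 2) reflX.
- by rewrite subr_gt0.
- by have [z hz] := grad 0; exists (0, Aop 0 + z - w), z.
- move=> [x1 b1] [x2 b2] [z1 hz1 /= ->] [z2 hz2 /= ->]; set d := x1 - x2.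
  have h1 : mA * `|d| ^+ 2 <= Aop x1 d - Aop x2 d := monoA x1 x2.
  have h2 := pullback_gradient_monotone c0 Fc hz1 hz2; rewrite -/d in h2.
  suff : (mA - c * `|N| ^+ 2) * `|d| ^+ 2 <=
    (Aop x1 d + z1 d - w d) - (Aop x2 d + z2 d - w d) by [].
  by rewrite mulrBl; lra.
have [L L0 hL] := clarke_dir_bound lipF (N y).
have var v : (w - Aop y) v <= clarke_dir F (N y) (N v).
  apply/ler_addgt0Pr => e e0.
  pose xn n := y + n.+1%:R^-1 *: v.
  have s0 : (n.+1%:R^-1 : R) @[n --> \oo] --> (0 : R) by exact: cvg_harmonic.
  have cx : xn n @[n --> \oo] --> y.
    rewrite -[X in _ --> X]addr0 -(scale0r v).
    by apply: cvgD; [exact: cvg_cst|exact: cvgZr_tmp].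
  have [xi xiE] := evaluation v.
  have := @demiA xn y cx xi; rewrite xiE.
  under eq_fun do rewrite xiE.
  move=> cA'.
  suff h : w v - clarke_dir F (N y) (N v) - e <= Aop y v.
    have : w v - Aop y v <= clarke_dir F (N y) (N v) + e by lra.
    by [].
  rewrite -(cvg_lim _ cA')//; apply: limr_ge; first by apply/cvg_ex; eexists; exact: cA'.
  have usc : \forall n \near \oo, clarke_dir F (N (xn n)) (N v) <= clarke_dir F (N y) (N v) + e.
    have cN : N (xn n) @[n --> \oo] --> N y.
      by apply: cvg_comp cx _; exact: bop_continuous.
    have lt : clarke_dir F (N y) (N v) < clarke_dir F (N y) (N v) + e.
      by rewrite ltrDl.
    exact: cN _ (clarke_dir_usc lipF lt).
  near=> n.
  have [z hz] := grad (xn n); have [th hth thz] := hz.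
  have : 0 <= (Aop (xn n) + z - w) (xn n - y).
    exact: (yP (xn n, Aop (xn n) + z - w) (ex_intro2 _ _ z hz erefl)).
  have -> : xn n - y = n.+1%:R^-1 *: v by rewrite /xn addrAC subrr add0r.
  rewrite dualZ pmulr_rge0//.
  have : z v <= clarke_dir F (N y) (N v) + e.
    rewrite -thz; apply: (@le_trans _ _ (clarke_dir F (N (xn n)) (N v))).
      by apply: (clarke_gradientP lipF _ _).1.
    by near: n.
  move=> h1 h2; have : 0 <= Aop (xn n) v + z v - w v by [].
  by lra.
have [th thp thE] := @factor_through_surjection (w - Aop y) (clarke_dir F (N y)) L
  (sublinear0 (clarke_dir_sublinear lipF _)) hL var.
exists y; exists (w - Aop y); last by rewrite addrC subrK.
by exists th => //; apply/clarke_gradientP.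
Unshelve. all: by end_near. Qed.

End static_inclusion.

(** * Stability of the inclusion under perturbation *)

Section inclusion_convergence.
Context {R : realType} {X Y : normedModType R}.
Variables (N : bop X Y) (mA mJ c : R).
Hypotheses (c0 : 0 <= c) (cA : c * `|N| ^+ 2 < mA).
Hypothesis compactN : compact_operator N.

Definition gradient_growth (F : Y -> R) := forall (u : Y) (th : dual Y),
  clarke_gradient F u th -> `|th| <= mJ * (`|u| + 1).

Lemma growth_lipschitz (F : Y -> R) (u v : Y) : 0 <= mJ -> locally_lipschitz F ->
  gradient_growth F -> `|v - u| <= 1 ->
  `|F v - F u| <= mJ * (`|u| + 2) * `|v - u|.
Proof.
move=> mJ0 lipF gF vu.
have seg (s : R) : 0 <= s <= 1 -> `|u + s *: (v - u)| <= `|u| + 1.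
  move=> /andP[s0 s1]; rewrite (le_trans (ler_normD _ _))// lerD2l normrZ ger0_norm//.
  by rewrite mulr_ile1.
have bnd (s : R) th : 0 <= s <= 1 -> clarke_gradient F (u + s *: (v - u)) th ->
    `|th| <= mJ * (`|u| + 2).
  move=> /seg su /gF /le_trans; apply; rewrite ler_wpM2l//; lra.
rewrite ler_norml; apply/andP; split.
  have := @lipschitz_of_gradient_bound R Y F lipF u (v - u) (mJ * (`|u| + 2)).
  rewrite [u + _]addrC subrK => h; rewrite lerNl opprB lerBlDl; apply: h => s th /andP[s0 s1].
  by apply: bnd; rewrite (ltW s0).
have := @lipschitz_of_gradient_bound R Y F lipF v (u - v) (mJ * (`|u| + 2)).
rewrite [v + _]addrC subrK distrC => h; rewrite lerBlDl; apply: h => s th /andP[s0 s1].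
have -> : v + s *: (u - v) = u + (1 - s) *: (v - u).
  by rewrite scalerBl scale1r addrA (addrC u) subrK -scalerN opprB.
by apply: bnd; apply/andP; split; lra.
Qed.

(** The potentials converge only pointwise, but the uniform growth of their
    gradients makes this uniform on the compact set containing the images
    [N (y i)]; semiconvexity turns gradients into values of the potentials. *)
Lemma inclusion_cvg (I : Type) (Fi : set_system I) (FF : Filter Fi) (D : set I)
    (Aop : I -> X -> dual X) (J : I -> Y -> R) (w : I -> dual X) (y : I -> X)
    (Aop0 : X -> dual X) (J0 : Y -> R) (w0 : dual X) (y0 : X) : 0 <= mJ ->
  Fi D -> (forall i, D i -> strongly_monotone (Aop i) mA) ->
  (forall i, D i -> [/\ locally_lipschitz (J i), gradient_growth (J i) &
    relaxed_monotone (J i) c]) ->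
  [/\ locally_lipschitz J0, gradient_growth J0 & relaxed_monotone J0 c] ->
  (forall i, D i -> solves_inclusion N (Aop i) (J i) (w i) (y i)) ->
  solves_inclusion N Aop0 J0 w0 y0 ->
  Aop i y0 @[i --> Fi] --> Aop0 y0 ->
  (forall u, J i u @[i --> Fi] --> J0 u) -> w @ Fi --> w0 ->
  y @ Fi --> y0.
Proof.
move=> mJ0 FD monoF hJ [lip0 gr0 mon0] soli sol0 cvgF cvgJ cvgw.
pose mu := mA - c * `|N| ^+ 2.
have mu0 : 0 < mu by rewrite subr_gt0.
have near1 (V : normedModType R) (u : I -> V) v (e : R) : u @ Fi --> v -> 0 < e ->
    \forall i \near Fi, `|u i - v| <= e.
  by move=> /cvgrPdist_le h /h; apply: filterS => i; rewrite distrC.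
(* a priori bound, from the stability estimate with [y0] as approximate solution *)
pose C0 := `|Aop0 y0| + 1 + mJ * (`|N y0| + 1) * `|N| + (`|w0| + 1).
pose rho := C0 / mu.
have C00 : 0 <= C0.
  have ? : 0 <= mJ * (`|N y0| + 1) * `|N| by rewrite !mulr_ge0// addr_ge0.
  have := normr_ge0 (Aop0 y0); have := normr_ge0 w0; rewrite /C0; lra.
have rho0 : 0 <= rho by rewrite divr_ge0// ltW.
have bounded_y : \forall i \near Fi, `|y i - y0| <= rho.
  near=> i; have Di : D i by near: i.
  have [lipi gri moni] := hJ _ Di.
  have [th hth _] := clarke_gradient_max lipi (N y0) 0.
  have hz : (adjoint N @` clarke_gradient (J i) (N y0)) (adjoint N th) by exists th.
  have := inclusion_stability (monoF _ Di) c0 moni (erefl (Aop i y0 + adjoint N th))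
    hz (soli _ Di).
  rewrite subrr normr0 addr0 -/mu => h.
  rewrite distrC /rho ler_pdivlMr// mulrC (le_trans h)//.
  rewrite (le_trans (ler_normB _ _))// /C0 lerD//.
    rewrite (le_trans (ler_normD _ _))// lerD//.
      rewrite -lerBlDl (le_trans (lerB_dist _ _))//.
      by near: i; exact: near1.
    by rewrite (le_trans (adjoint_norm _ _))// ler_wpM2r// gri.
  rewrite -lerBlDl (le_trans (lerB_dist _ _))//.
  by near: i; exact: near1.
have [K NK [cptK _]] : precompact (N @` [set x | `|x - y0| <= rho]).
  apply: compactN; exists (`|y0| + rho); split; first exact: num_real.
  move=> M hM x /= xr; rewrite (le_trans _ (ltW hM))//.
  by rewrite -lerBlDl (le_trans (lerB_dist _ _)).
have unifJ (e : R) : 0 < e -> \forall i \near Fi, forall u, K u -> `|J i u - J0 u| <= e.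
  move=> e0; apply: (((compact_near_coveringP K).1 cptK) I Fi
    (fun i u => `|J i u - J0 u| <= e) FF) => u Ku.
  pose L := mJ * (`|u| + 2).
  have L0 : 0 <= L by rewrite mulr_ge0// addr_ge0.
  have e4 : 0 < e / 4 by rewrite divr_gt0.
  have hL : 0 < e / 4 / (L + 1) by rewrite divr_gt0// ltr_wpDl.
  near=> u' i.
  have Di : D i by near: i.
  have [lipi gri moni] := hJ _ Di.
  have u1 : `|u' - u| <= 1.
    by rewrite distrC; near: u'; exact: near_norm_le.
  have uL : L * `|u' - u| <= e / 4.
    have : `|u' - u| <= e / 4 / (L + 1).
      by rewrite distrC; near: u'; exact: near_norm_le.
    rewrite ler_pdivlMr ?ltr_wpDl// mulrDr mulr1.
    by have := normr_ge0 (u' - u); rewrite mulrC; lra.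
  have h1 := le_trans (growth_lipschitz mJ0 lipi gri u1) uL.
  have h2 := le_trans (growth_lipschitz mJ0 lip0 gr0 u1) uL.
  have h3 : `|J i u - J0 u| <= e / 4.
    by near: i; exact: (near1 R^o).
  move: h1 h2 h3; rewrite !ler_norml => /andP[? ?] /andP[? ?] /andP[? ?].
  by apply/andP; split; lra.
(* Both inclusions are tested with [y i - y0]. The two quadratic defects of
   convexity add up to [c * `|N| ^+ 2], which [mA] absorbs. *)
have energy i : D i ->
    mu * `|y i - y0| ^+ 2 <= (`|w i - w0| + `|Aop i y0 - Aop0 y0|) * `|y i - y0| +
      ((J0 (N (y i)) - J i (N (y i))) + (J i (N y0) - J0 (N y0))).
  move=> Di; have [lipi gri moni] := hJ _ Di; set d := y i - y0.
  have [_ [thi hthi <-] ei] := soli _ Di.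
  have [_ [th0 hth0 <-] e0] := sol0.
  have h1 : mA * `|d| ^+ 2 <= Aop i (y i) d - Aop i y0 d := monoF _ Di (y i) y0.
  have eid : w i d = Aop i (y i) d + thi (N d) :> R by rewrite -ei.
  have e0d : w0 d = Aop0 y0 d + th0 (N d) :> R by rewrite -e0.
  have h2 : w i d - w0 d <= `|w i - w0| * `|d| := dual_le (w i - w0) d.
  have h3 : Aop0 y0 d - Aop i y0 d <= `|Aop i y0 - Aop0 y0| * `|d|.
    by rewrite distrC; exact: dual_le (Aop0 y0 - Aop i y0) d.
  have h4 := @semiconvex_subgradient R Y _ lipi c _ (- N d) _ moni hthi.
  have h5 := @semiconvex_subgradient R Y _ lip0 c _ (N d) _ mon0 hth0.
  have E1 : N (y i) + - N d = N y0 by rewrite /d linearB/= opprB addrC subrK.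
  have E2 : N y0 + N d = N (y i) by rewrite /d linearB/= addrC subrK.
  rewrite E1 dualN normrN in h4; rewrite E2 in h5.
  have h6 : c * `|N d| ^+ 2 <= c * `|N| ^+ 2 * `|d| ^+ 2.
    rewrite -mulrA ler_wpM2l// -exprMn ler_pXn2r ?nnegrE ?mulr_ge0//.
    exact: bop_bound.
  by rewrite /mu mulrBl mulrDl; lra.
apply/cvgrPdist_le => e e0.
pose e' := mu * e ^+ 2 / (rho *+ 2 + 2).
have den0 : 0 < rho *+ 2 + 2 by rewrite ltr_wpDl// mulrn_wge0.
have e'0 : 0 < e' by rewrite divr_gt0// mulr_gt0// exprn_gt0.
near=> i; have Di : D i by near: i.
have dr : `|y i - y0| <= rho by near: i.
have h1 : `|w i - w0| <= e' by near: i; exact: near1.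
have h2 : `|Aop i y0 - Aop0 y0| <= e' by near: i; exact: near1.
have Ki x : `|x - y0| <= rho -> `|J i (N x) - J0 (N x)| <= e'.
  move=> xr; have : K (N x) by apply: NK; exists x.
  by move: (N x); near: i; exact: unifJ.
have h3 := Ki _ dr.
have h4 : `|J i (N y0) - J0 (N y0)| <= e' by apply: Ki; rewrite subrr normr0.
have := energy _ Di => h.
have h5 : (`|w i - w0| + `|Aop i y0 - Aop0 y0|) * `|y i - y0| <= (e' + e') * rho.
  by apply: ler_pM => //; exact: lerD.
rewrite distrC -(@ler_pXn2r _ 2)// ?nnegrE ?(ltW e0)//.
rewrite -(ler_pM2l mu0); apply: (le_trans h).
have -> : mu * e ^+ 2 = e' * (rho *+ 2 + 2) by rewrite divfK// gt_eqF.
move: h3 h4; rewrite !ler_norml => /andP[? ?] /andP[? ?].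
by lra.
Unshelve. all: by end_near. Qed.

End inclusion_convergence.

(** * Bochner integrals *)

Section bochner_integral.
Context d (S : measurableType d) {R : realType} (X : normedModType R).
Variables (mu : {measure set S -> \bar R}) (D : set S).
Hypotheses (mD : measurable D) (muD : (mu D < +oo)%E).
Implicit Types (s : S -> X) (u : S -> X).

(** Simple functions without the integrability requirement, which is automatic
    on the domains of finite measure considered here. *)
Definition finite_valued s :=
  finite_set (range s) /\ forall v, measurable (s @^-1` [set v]).

Lemma finite_valued_measurable d' (Z : measurableType d') s (h : X -> S -> Z) :
  finite_valued s -> (forall v, measurable_fun D (h v)) ->
  measurable_fun D (fun x => h (s x) x).
Proof.
move=> [fs ms] mh _ B mB.
have -> : D `&` (fun x => h (s x) x) @^-1` B =
    \bigcup_(v in range s) ((D `&` h v @^-1` B) `&` s @^-1` [set v]).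
  apply/seteqP; split => [x [Dx Bx]|x [v _ [[Dx Bx] /= xv]]]; last first.
    by split => //=; rewrite xv.
  by exists (s x) => //; exists x.
apply: fin_bigcup_measurable => // v _; apply: measurableI => //.
exact: mh.
Qed.

Lemma simple_measurable s (h : X -> R) : finite_valued s ->
  measurable_fun D (h \o s).
Proof.
move=> fs; apply: (@finite_valued_measurable _ _ s (fun v _ => h v) fs) => v.
exact: measurable_cst.
Qed.

Lemma simple_integrable s (h : X -> R) : finite_valued s ->
  mu.-integrable D (EFin \o (h \o s)).
Proof.
move=> fs; apply: measurable_bounded_integrable => //; first exact: simple_measurable.
pose r := finmap.enum_fset (fset_set (range s)).
exists (\sum_(v <- r) `|h v|); split=> [|M hM x _ /=]; first exact: num_real.
rewrite (le_trans _ (ltW hM))//.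
have sx : s x \in r.
  by rewrite in_fset_set; [apply/mem_set; exists x|exact: fs.1].
by rewrite (big_rem (s x) sx)/= lerDl sumr_ge0.
Qed.

(** A continuous functional commutes with the integral of simple functions; this
    reduces vector-valued estimates to scalar ones. *)
Lemma functional_simple_integral s (f : dual X) : finite_valued s ->
  (f (simple_vintegral mu D s))%:E = (\int[mu]_(x in D) (f (s x))%:E)%E.
Proof.
move=> [fs ms]; rewrite /simple_vintegral fsbig_finite//=.
set r := finmap.enum_fset (fset_set (range s)).
have rP v : v \in r = (v \in range s) by rewrite in_fset_set.
pose Fib v := D `&` s @^-1` [set v].
have mFib v : measurable (Fib v) by exact: measurableI.
have DE : D = \big[setU/set0]_(v <- r) Fib v.
  rewrite -bigcup_seq; apply/seteqP; split => [x Dx|x [v _ []]]//.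
  by exists (s x) => //=; rewrite rP; apply/mem_set; exists x.
rewrite [in RHS]DE integral_bigsetU_EFin//=.
- rewrite raddf_sum/= -sumEFin; apply: eq_bigr => v _.
  rewrite (eq_integral (cst (f v)%:E)); last first.
    by move=> x /set_mem[_ /= ->].
  rewrite integral_cst// dualZ mulrC EFinM fineK//.
  rewrite ge0_fin_numE//; apply: le_lt_trans muD.
  by apply: le_measure; rewrite ?inE; [exact: mFib|exact: mD|exact: subIsetl].
- exact: finmap.fset_uniq.
- by move=> v w _ _ [x [[_ /= <-] [_ /= <-]]].
- by rewrite -DE; apply/measurable_EFinP; exact: (simple_measurable f).
Qed.

(** Test the difference of the integrals with a functional that norms it. *)
Lemma simple_integral_le s s' (G : S -> \bar R) :
  finite_valued s -> finite_valued s' -> measurable_fun D G ->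
  (forall x, D x -> (`|s x - s' x|%:E <= G x)%E) ->
  (`|simple_vintegral mu D s - simple_vintegral mu D s'|%:E <=
    \int[mu]_(x in D) G x)%E.
Proof.
move=> fs fs' mG sG.
have [f f1 fv] := norming_functional (simple_vintegral mu D s - simple_vintegral mu D s').
rewrite -fv dualB EFinB !functional_simple_integral//.
have i1 := simple_integrable f fs; have i2 := simple_integrable f fs'.
rewrite -(integralB_EFin mD i1 i2).
apply: (le_trans (lee_abs _)); apply: (le_trans (le_abse_integral _ _ _)) => //.
  by apply/measurable_EFinP; apply: measurable_funB; exact: (simple_measurable f).
apply: ge0_le_integral => //.
- apply: measurableT_comp => //.
  by apply/measurable_EFinP; apply: measurable_funB; exact: (simple_measurable f).
- move=> x Dx; apply: (le_trans _ (sG x Dx)) => /=.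
  rewrite lee_fin -dualB (le_trans (bop_bound f _))//.
  by rewrite ler_piMl.
Qed.

(** All properties of the integral used below (uniqueness, monotone control,
    continuity in parameters) are instances of this comparison. *)
Lemma bochner_integral_le u u' I I' (G : S -> R) :
  is_bochner_integral mu D u I -> is_bochner_integral mu D u' I' ->
  measurable_fun D G -> (forall x, D x -> `|u x - u' x| <= G x) ->
  (`|I - I'|%:E <= \int[mu]_(x in D) (G x)%:E)%E.
Proof.
move=> [s [ss _ ms is_ sI]] [s' [ss' _ ms' is'_ s'I']] mG uG.
have fs n : finite_valued (s n) by have [] := ss n.
have fs' n : finite_valued (s' n) by have [] := ss' n.
have G0 x : D x -> 0 <= G x by move=> /uG; apply: le_trans.
pose e n := (\int[mu]_(x in D) `|u x - s n x|%:E)%E.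
pose e' n := (\int[mu]_(x in D) `|u' x - s' n x|%:E)%E.
have step n : (`|simple_vintegral mu D (s n) - simple_vintegral mu D (s' n)|%:E <=
    \int[mu]_(x in D) (G x)%:E + (e n + e' n))%E.
  rewrite -!ge0_integralD//=; first apply: simple_integral_le => //.
  - apply: emeasurable_funD; first exact/measurable_EFinP.
    by apply: emeasurable_funD; exact/measurable_EFinP.
  - move=> x Dx; rewrite -!EFinD lee_fin.
    have -> : s n x - s' n x = (u x - u' x) - (u x - s n x) + (u' x - s' n x).
      by rewrite opprB (addrC (u x - u' x)) !addrA !subrK.
    rewrite (le_trans (ler_normD _ _))// addrA lerD//.
    by rewrite (le_trans (ler_normB _ _))// lerD// uG.
  - exact/measurable_EFinP.
  - by move=> x Dx; rewrite adde_ge0.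
  - by apply: emeasurable_funD; exact/measurable_EFinP.
  - exact/measurable_EFinP.
  - exact/measurable_EFinP.
have lhs : `|simple_vintegral mu D (s n) - simple_vintegral mu D (s' n)|%:E @[n --> \oo] -->
    `|I - I'|%:E.
  by apply: cvg_EFin; [exact: nearW|apply: cvg_norm; exact: cvgB].
have i0 : (0 <= \int[mu]_(x in D) (G x)%:E)%E by apply: integral_ge0.
have rhs : (\int[mu]_(x in D) (G x)%:E + (e n + e' n))%E @[n --> \oo] -->
    (\int[mu]_(x in D) (G x)%:E)%E.
  rewrite -[X in _ --> X]adde0; apply: cvgeD.
  - by rewrite ge0_adde_def ?inE.
  - exact: cvg_cst.
  - by rewrite -[X in _ --> X]adde0; apply: cvgeD.
rewrite -(cvg_lim _ lhs)// -(cvg_lim _ rhs)//.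
apply: lee_lim; [by apply/cvg_ex; eexists; exact: lhs|by apply/cvg_ex; eexists; exact: rhs|].
exact: nearW.
Qed.

Lemma bochner_integral_unique u I I' :
  is_bochner_integral mu D u I -> is_bochner_integral mu D u I' -> I = I'.
Proof.
move=> hI hI'; apply/eqP; rewrite -subr_eq0 -normr_le0 -lee_fin.
apply: (le_trans (bochner_integral_le (G := fun=> 0) hI hI' _ _)) => //.
- by move=> x _; rewrite subrr normr0.
- by rewrite integral0.
Qed.

End bochner_integral.

Lemma separable_dense_sequence {R : realType} (X : normedModType R) :
  separable_space X -> exists c : nat -> X, forall x e, 0 < e -> exists n, `|x - c n| < e.
Proof.
move=> [Q /pfcard_geP[->|[c]] dQ].
  by exfalso; exact: dense0 dQ.
exists c => x e e0.
have [||y [xy Qy]] := dQ (ball x e).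
  - by exists x; exact: ballxx.
  - exact: ball_open.
have [n _ cn] := @surj _ _ _ _ c y Qy.
by exists n; rewrite cn; move: xy; rewrite -ball_normE.
Qed.

Section bochner_existence.
Context d (S : measurableType d) {R : realType} (X : completeNormedModType R).
Variables (mu : {measure set S -> \bar R}) (D : set S).
Hypotheses (mD : measurable D) (muD : (mu D < +oo)%E).
Variable (u : S -> X).
Hypothesis mu_dist : forall v, measurable_fun D (fun x => `|u x - v|).

Section nearest_point.
Variable c : nat -> X.

Fixpoint nearest n x : X := if n is n'.+1 then
  (if `|u x - c n'| < `|u x - nearest n' x| then c n' else nearest n' x) else 0.

Lemma nearestS_le n x : `|u x - nearest n.+1 x| <= `|u x - nearest n x|.
Proof. by rewrite /=; case: ifPn => // /ltW. Qed.

Lemma nearest_noninc n m x : (n <= m)%N -> `|u x - nearest m x| <= `|u x - nearest n x|.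
Proof.
move=> /subnK<-; elim: (m - n)%N => // k ih; rewrite addSn.
exact: le_trans (nearestS_le _ _) ih.
Qed.

Lemma nearest_le n x : `|u x - nearest n x| <= `|u x|.
Proof. by have := @nearest_noninc 0 n x (leq0n n); rewrite /= subr0. Qed.

Lemma nearest_le_term n x : `|u x - nearest n.+1 x| <= `|u x - c n|.
Proof. by rewrite /=; case: ifPn => //; rewrite -leNgt. Qed.

Lemma nearest_finite_valued n : finite_valued (patch (fun=> 0) D (nearest n)).
Proof.
elim: n => [|n [fn mn]].
  have E : patch (fun=> 0) D (nearest 0) = fun=> 0 :> X.
    by apply/funext => x; rewrite /patch; case: ifP.
  rewrite E; split; first by apply: sub_finite_set (finite_set1 0) => _ [x _ <-].
  move=> v; have [->|v0] := eqVneq v 0.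
    by rewrite (_ : _ @^-1` _ = setT)//; apply/seteqP; split.
  rewrite (_ : _ @^-1` _ = set0)//; apply/seteqP; split => // x /= h.
  by move: v0; rewrite -h eqxx.
set f := patch (fun=> 0) D (nearest n) in fn mn *.
pose P := D `&` [set x | `|u x - c n| < `|u x - f x| ].
have mP : measurable P.
  have h : measurable_fun D (fun x => `|u x - c n| < `|u x - f x|).
    apply: measurable_fun_ltr => //.
    exact: (finite_valued_measurable mD (h := fun v x => `|u x - v|)).
  have := h mD [set true]; rewrite /preimage/=; exact.
have E : patch (fun=> 0) D (nearest n.+1) = fun x => if x \in P then c n else f x.
  apply/funext => x; rewrite /patch /P in_setI /f /patch; case: ifPn => //= xD.
  rewrite (_ : (x \in [set x | _]) = (`|u x - c n| < `|u x - nearest n x|))//.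
  by apply/idP/idP => [/set_mem|h]; [|apply/mem_set]; rewrite /= /patch xD.
rewrite E; split.
  apply: (@sub_finite_set _ _ (range f `|` [set c n])).
    by move=> _ [x _ <-]; case: ifPn => _; [right|left; exists x].
  by rewrite finite_setU; split => //; exact: finite_set1.
move=> v; have -> : (fun x => if x \in P then c n else f x) @^-1` [set v] =
   (P `&` [set _ | c n = v]) `|` (~` P `&` f @^-1` [set v]).
  apply/seteqP; split => x /=.
    by case: ifPn => [/set_mem xP ->|/negP xP <-]; [left|right; split => // /mem_set].
  case=> [[/mem_set-> ->]//|[xP fv]].
  by case: ifPn => // /set_mem.
apply: measurableU; apply: measurableI => //; last exact: measurableC.
have [->|cv] := eqVneq (c n) v.
  by rewrite (_ : [set _ | _] = setT)//; apply/seteqP; split.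
rewrite (_ : [set _ | _] = set0)//; apply/seteqP; split => // x /= h.
by move: cv; rewrite h eqxx.
Qed.

End nearest_point.

(** Approximating by the nearest among the first [n] terms of a dense sequence,
    with the origin always available, gives errors dominated by [`|u|]. *)
Lemma bochner_integral_exists : separable_space X ->
  (\int[mu]_(x in D) `|u x|%:E < +oo)%E -> exists I, is_bochner_integral mu D u I.
Proof.
move=> /separable_dense_sequence[c hc] ufin.
pose s n := patch (fun=> 0) D (nearest c n).
have sD n x : D x -> s n x = nearest c n x by move=> Dx; rewrite /s /patch mem_set.
have fs n : finite_valued (s n) by exact: nearest_finite_valued.
have ms n : measurable_fun D (fun x => `|u x - s n x|).
  exact: (finite_valued_measurable mD (h := fun v x => `|u x - v|)).
have mu0 : measurable_fun D (fun x => `|u x|).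
  by have := mu_dist 0; under eq_fun do rewrite subr0.
have cvgs x : D x -> s n x @[n --> \oo] --> u x.
  move=> Dx; apply/cvgrPdist_le => e e0; have [k hk] := hc (u x) e e0.
  exists k.+1 => // n /= kn; rewrite sD//.
  apply: (le_trans (nearest_noninc c x kn)); apply: (le_trans (nearest_le_term _ _ _)).
  exact: ltW.
have iu : mu.-integrable D (fun x => `|u x|%:E).
  apply/integrableP; split; first exact/measurable_EFinP.
  by under eq_integral do rewrite abse_EFin normr_id.
have cvg0 : (\int[mu]_(x in D) `|u x - s n x|%:E)%E @[n --> \oo] --> 0%E.
  have m1 n : measurable_fun D (fun x => `|u x - s n x|%:E) by exact/measurable_EFinP.
  have ae1 : {ae mu, forall x, D x -> `|u x - s n x|%:E @[n --> \oo] --> 0%E}.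
    apply: aeW => x Dx; apply: cvg_EFin; first exact: nearW.
    rewrite /comp/= -[X in _ --> X](@normr0 _ X) -(subrr (u x)).
    by apply: cvg_norm; apply: cvgB; [exact: cvg_cst|exact: cvgs].
  have ae2 : {ae mu, forall x n, D x -> (`| `|u x - s n x|%:E | <= `|u x|%:E)%E}.
    by apply: aeW => x n Dx; rewrite abse_EFin normr_id lee_fin sD// nearest_le.
  have [_ + _] := dominated_convergence mD m1 (measurable_cst _) ae1 iu ae2.
  under eq_fun do under eq_integral do rewrite sube0 abse_EFin normr_id.
  exact.
have cI : cvg (simple_vintegral mu D (s n) @[n --> \oo]).
  apply/cauchy_cvgP/cauchy_exP => e e0.
  have e2 : (0 < (e / 2)%:E)%E by rewrite lte_fin divr_gt0.
  have [k _ hk] : \forall n \near \oo,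
      (\int[mu]_(x in D) `|u x - s n x|%:E < (e / 2)%:E)%E.
    exact: cvg0 _ (open_ereal_lt' e2).
  exists (simple_vintegral mu D (s k)); exists k => // n /= kn.
  rewrite -ball_normE/= -lte_fin.
  apply: (@le_lt_trans _ _
    (\int[mu]_(x in D) (`|u x - s k x|%:E + `|u x - s n x|%:E))%E).
    apply: simple_integral_le => //.
      by apply: emeasurable_funD; exact/measurable_EFinP.
    move=> x Dx; rewrite -EFinD lee_fin.
    have -> : s k x - s n x = (u x - s n x) - (u x - s k x).
      by rewrite opprB [RHS]addrC addrA subrK.
    by rewrite (le_trans (ler_normB _ _))// addrC.
  rewrite ge0_integralD//; [|exact/measurable_EFinP|exact/measurable_EFinP].
  have -> : e%:E = ((e / 2)%:E + (e / 2)%:E)%E by rewrite -EFinD -splitr.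
  by apply: lteD; apply: hk => /=.
exists (lim (simple_vintegral mu D (s n) @[n --> \oo])); exists s; split => //.
- move=> n; have [fsn msn] := fs n; split => // v _.
  apply: le_lt_trans muD; apply: le_measure; rewrite ?inE.
  - exact: measurableI.
  - exact: mD.
  - exact: subIsetl.
- exact: aeW.
Unshelve. all: by end_near. Qed.

End bochner_existence.

Section bochner_restriction.
Context d (S : measurableType d) {R : realType} (X : normedModType R).
Variables (mu : {measure set S -> \bar R}) (D E : set S).
Hypotheses (mD : measurable D) (mE : measurable E) (DE : D `<=` E).

(** Integrals over different domains become comparable after extension by zero. *)
Lemma bochner_integral_extend (u : S -> X) (I : X) :
  is_bochner_integral mu D u I -> is_bochner_integral mu E (patch (fun=> 0) D u) I.
Proof.
move=> [s [ss aes ms is_ sI]].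
pose s' n := patch (fun=> 0) D (s n).
have fib n v : s' n @^-1` [set v] =
    (D `&` s n @^-1` [set v]) `|` (~` D `&` [set _ | v = 0]).
  apply/seteqP; split => x; rewrite /s' /patch /=.
    case: ifPn => [/set_mem xD|/negP xD] h; first by left.
    by right; split => // /mem_set.
  case=> [[xD h]|[xD ->]]; first by rewrite mem_set.
  by case: ifPn => // /set_mem.
have fibI n v : v != 0 -> E `&` s' n @^-1` [set v] = D `&` s n @^-1` [set v].
  move=> v0; rewrite fib (_ : [set _ | _] = set0) ?setI0 ?setU0; last first.
    by apply/seteqP; split => // x /= h; move: v0; rewrite h eqxx.
  by rewrite setIA (setIidr DE).
have dist n x : `|patch (fun=> 0) D u x - s' n x| =
    patch (fun=> 0) D (fun x => `|u x - s n x|) x.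
  by rewrite /s' /patch; case: ifP => // _; rewrite subrr normr0.
exists s'; split.
- move=> n; have [fr mf ff] := ss n; split.
  + apply: (@sub_finite_set _ _ (range (s n) `|` [set 0])).
      by move=> _ [x _ <-]; rewrite /s' /patch; case: ifP => _; [left; exists x|right].
    by rewrite finite_setU; split => //; exact: finite_set1.
  + move=> v; rewrite fib; apply: measurableU; first exact: measurableI.
    apply: measurableI; first exact: measurableC.
    have [->|v0] := eqVneq v 0.
      by rewrite (_ : [set _ | _] = setT)//; apply/seteqP; split.
    rewrite (_ : [set _ | _] = set0)//; apply/seteqP; split => // x /= h.
    by move: v0; rewrite h eqxx.
  + by move=> v v0; rewrite fibI//; exact: ff.
- apply: filterS aes => x h Ex; rewrite /s' /patch.
  case: ifPn => [/set_mem Dx|_]; [exact: h|exact: cvg_cst].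
- move=> n; under eq_fun do rewrite dist.
  apply/measurable_restrict => //; rewrite (setIidr DE).
  exact: ms.
- suff -> : (fun n => (\int[mu]_(x in E) `|patch (fun=> 0) D u x - s' n x|%:E)%E) =
      (fun n => (\int[mu]_(x in D) `|u x - s n x|%:E)%E) by [].
  apply/funext => n; apply/esym.
  transitivity (\int[mu]_(x in E `&` D) `|u x - s n x|%:E)%E.
    by rewrite (setIidr DE).
  rewrite integral_mkcondr; apply: eq_integral => x _; rewrite dist.
  by rewrite /patch; case: ifP.
- have wid (C : set S) (r : S -> X) : simple_vintegral mu C r =
      \sum_(v \in [set: X]) fine (mu (C `&` r @^-1` [set v])) *: v.
    apply: fsbig_widen => // v [_ rv]; rewrite /= (_ : r @^-1` _ = set0).
      by rewrite setI0 measure0 scale0r.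
    by apply/seteqP; split => // x /= h; apply: rv; exists x.
  suff -> : (fun n => simple_vintegral mu E (s' n)) =
      (fun n => simple_vintegral mu D (s n)) by [].
  apply/funext => n; rewrite !wid.
  apply: eq_fsbigr => v _; have [->|v0] := eqVneq v 0; first by rewrite !scaler0.
  by rewrite fibI.
Qed.

End bochner_restriction.

(** * The singular kernel *)

Section kernel.
Context {R : realType}.
Variable kappa : R.
Hypotheses (kappa_gt0 : 0 < kappa) (kappa_lt1 : kappa < 1).
Implicit Types (a b s t : R).

Local Notation mu := (@lebesgue_measure R).

Definition kernel t s : R := (t - s) `^ (kappa - 1).

Lemma kernel_ge0 t s : 0 <= kernel t s.
Proof. exact: powR_ge0. Qed.

Lemma kernel_anti t t' s : s < t -> t <= t' -> kernel t' s <= kernel t s.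
Proof.
move=> st tt'; rewrite /kernel.
have -> : kappa - 1 = - (1 - kappa) by rewrite opprB.
have ts : 0 < t - s by rewrite subr_gt0.
have ts' : 0 < t' - s by rewrite subr_gt0 (lt_le_trans st).
rewrite !powRN lef_pV2 ?posrE ?powR_gt0//.
by apply: ge0_ler_powR; rewrite ?nnegrE ?(ltW ts) ?(ltW ts') ?lerD2r// subr_ge0 ltW.
Qed.

Lemma measurable_kernel t (D : set R) : measurable_fun D (kernel t).
Proof.
apply: (@measurable_funS _ _ _ _ setT) => //.
apply: (measurableT_comp (measurable_powR (kappa - 1))).
exact: measurable_funB.
Qed.

Lemma is_derive_kernel t s : s < t ->
  is_derive s 1 (fun s => - kappa^-1 * (t - s) `^ kappa) (kernel t s).
Proof.
move=> st; have ts : 0 < t - s by rewrite subr_gt0.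
have h1 := is_derive1_powR kappa ts.
have h2 : is_derive s 1 (fun s : R => t - s) (-1).
  have -> : -1 = 0 - 1 :> R by rewrite sub0r.
  exact: is_deriveB.
have h3 := @is_derive1_comp R (fun x => x `^ kappa) (fun s => t - s) s _ _ h1 h2.
have h4 := is_deriveZ (- kappa^-1) h3.
apply: (is_derive_eq h4); rewrite /kernel /GRing.scale/=.
by field; rewrite gt_eqF.
Qed.

Lemma kernel_continuous t s : s < t -> {for s, continuous (kernel t)}.
Proof.
move=> st; have ts : 0 < t - s by rewrite subr_gt0.
apply: (@continuous_comp _ _ _ (fun s => t - s) (fun x => x `^ (kappa - 1))).
  by apply: cvgB; [exact: cvg_cst|exact: cvg_id].
apply: differentiable_continuous; apply/derivable1_diffP.
by apply: derivable_powR; rewrite in_itv/= ts.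
Qed.

Lemma integral_kernel a b t : a < b -> b < t ->
  (\int[mu]_(s in `[a, b]) (kernel t s)%:E)%E =
  (((t - a) `^ kappa - (t - b) `^ kappa) / kappa)%:E.
Proof.
move=> ab bt.
pose F s := - kappa^-1 * (t - s) `^ kappa.
have cF s : s < t -> {for s, continuous F}.
  move=> st; apply: differentiable_continuous; apply/derivable1_diffP.
  by have [] := is_derive_kernel st.
rewrite (@continuous_FTC2 _ _ F)//.
- by rewrite -EFinB /F; congr EFin; field; rewrite gt_eqF.
- apply: continuous_in_subspaceT => s /set_mem/=; rewrite in_itv/= => /andP[_ sb].
  by apply: kernel_continuous; exact: le_lt_trans bt.
- split.
  + move=> s; rewrite in_itv/= => /andP[_ sb].
    by have [] := is_derive_kernel (lt_trans sb bt).
  + by apply: cvg_at_right_filter; apply: cF; exact: lt_trans bt.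
  + by apply: cvg_at_left_filter; apply: cF.
- move=> s; rewrite in_itv/= => /andP[_ sb]; rewrite derive1E.
  by have [_] := is_derive_kernel (lt_trans sb bt).
Qed.

(** The singularity at [t] is reached by monotone convergence on [[a, b n]] with
    [b n] increasing to [t]. *)
Lemma integral_kernel_co a t : a <= t ->
  (\int[mu]_(s in `[a, t[) (kernel t s)%:E <= ((t - a) `^ kappa / kappa)%:E)%E.
Proof.
rewrite le_eqVlt => /predU1P[->|at_].
  by rewrite set_itvco0 integral_set0 lee_fin divr_ge0 ?powR_ge0// ltW.
have d0 : 0 < t - a by rewrite subr_gt0.
pose b n := t - (t - a) / n.+2%:R.
have bt n : b n < t by rewrite /b ltrBlDr ltrDl divr_gt0.
have ab n : a < b n.
  rewrite /b ltrBrDl -ltrBrDr ltr_pdivrMr// ltr_pMr// ltr1n//.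
have E : `[a, t[%classic = \bigcup_n `[a, b n]%classic.
  apply/seteqP; split => [s /=|s [n _ /=]]; rewrite !in_itv/= => /andP[as_ st].
    have ts : 0 < t - s by rewrite subr_gt0.
    pose n := Num.trunc ((t - a) / (t - s)).
    exists n => //=; rewrite in_itv/= as_/= /b lerBrDl -lerBrDr ler_pdivrMr//.
    rewrite mulrC -ler_pdivrMr//.
    have := truncnS_gt ((t - a) / (t - s)); rewrite -/n => /ltW/le_trans; apply.
    by rewrite ler_nat.
  by rewrite as_/=; exact: le_lt_trans (bt n).
rewrite E.
have nd : nondecreasing_seq (fun n => `[a, b n]%classic).
  apply/nondecreasing_seqP => n; rewrite subsetEset => s /=; rewrite !in_itv/=.
  move=> /andP[-> /= sb]; apply: (le_trans sb); rewrite /b lerD2l lerN2.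
  by rewrite ler_pM2l// lef_pV2 ?posrE// ler_nat.
have mk n : measurable_fun `[a, b n]%classic (fun s => (kernel t s)%:E).
  by apply/measurable_EFinP; exact: measurable_kernel.
have k0 n x : `[a, b n]%classic x -> (0 <= (kernel t x)%:E)%E.
  by rewrite lee_fin kernel_ge0.
have := @ge0_nondecreasing_set_cvg_integral _ (measurableTypeR R) R
  (fun n => `[a, b n]%classic) (fun s => (kernel t s)%:E) lebesgue_measure nd
  (fun n => measurable_itv _) mk k0.
move=> h; apply: (cvge_to_le h); apply: nearW => n; rewrite integral_kernel//.
by rewrite lee_fin ler_pM2r ?invr_gt0// gerBl powR_ge0.
Qed.

Lemma integral_kernel_le a t : a <= t ->
  (\int[mu]_(s in `[a, t]) (kernel t s)%:E <= ((t - a) `^ kappa / kappa)%:E)%E.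
Proof.
move=> at_; rewrite -integral_itv_bndo_bndc; first exact: integral_kernel_co.
by apply/measurable_EFinP; exact: measurable_kernel.
Qed.

End kernel.

Section kernel_estimates.
Context {R : realType}.
Variable kappa : R.
Hypotheses (kappa_gt0 : 0 < kappa) (kappa_lt1 : kappa < 1).
Implicit Types (s t : R).

Local Notation mu := (@lebesgue_measure R).
Local Notation k := (kernel kappa).

(** Majorant of [k t s * w s / w t] for a weight [w] whose ratio is at most [1]
    on the last stretch of length [eta] and at most [theta] before it. *)
Definition window (eta theta t s : R) : R := k t s * (\1_(`[t - eta, t]) s + theta).

Lemma measurable_window eta theta t (D : set R) :
  measurable_fun D (window eta theta t).
Proof.
apply: measurable_funM; first exact: measurable_kernel.
apply: measurable_funD; last exact: measurable_cst.
exact: measurable_indic.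
Qed.

Lemma window_ge0 eta theta t s : 0 <= theta -> 0 <= window eta theta t s.
Proof. by move=> th0; rewrite mulr_ge0 ?kernel_ge0// addr_ge0// indicE. Qed.

Lemma integral_window_le eta theta t T (B : R) : 0 <= t <= T -> 0 < eta ->
  0 <= theta -> 0 <= B ->
  (\int[mu]_(s in `[0%R, t]) (B * window eta theta t s)%:E <=
    (B * (eta `^ kappa / kappa + theta * (T `^ kappa / kappa)))%:E)%E.
Proof.
move=> /andP[t0 tT] eta0 th0 B0.
have mk (D : set R) : measurable_fun D (fun s => (k t s)%:E).
  by apply/measurable_EFinP; exact: measurable_kernel.
have k0 s : (0 <= (k t s)%:E)%E by rewrite lee_fin kernel_ge0.
under eq_integral do rewrite EFinM.
rewrite ge0_integralZl_EFin//; last first.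
- by apply/measurable_EFinP; exact: measurable_window.
- by move=> s _; rewrite lee_fin window_ge0.
rewrite EFinM lee_wpmul2l ?lee_fin//.
have -> : (\int[mu]_(s in `[0%R, t]) (window eta theta t s)%:E =
    \int[mu]_(s in `[0%R, t])
      (((fun s => (k t s)%:E) \_ `[(t - eta)%R, t]) s + theta%:E * (k t s)%:E))%E.
  apply: eq_integral => s _; rewrite epatch_indic /window mulrDr EFinD !EFinM/=.
  by rewrite (muleC theta%:E).
rewrite ge0_integralD//; first last.
- apply/measurable_EFinP; apply: measurable_funM; first exact: measurable_cst.
  exact: measurable_kernel.
- by move=> s _; rewrite mule_ge0.
- by apply/measurable_restrict => //; exact: mk.
- by move=> s _; rewrite /patch; case: ifP.
rewrite EFinD leeD//.
  rewrite -integral_mkcondr.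
  apply: (@le_trans _ _ (\int[mu]_(s in `[(t - eta)%R, t]) (k t s)%:E)%E).
    by apply: ge0_subset_integral => //; [exact: measurableI|exact: mk].
  have := @integral_kernel_le R kappa kappa_gt0 (t - eta) t.
  by rewrite subKr; apply; rewrite gerBl ltW.
rewrite ge0_integralZl_EFin; [|by []|by move=> s _; exact: k0|exact: mk|by []].
rewrite EFinM lee_wpmul2l ?lee_fin//.
apply: (le_trans (integral_kernel_le kappa_gt0 t0)).
rewrite lee_fin subr0 ler_pM2r ?invr_gt0//.
by apply: ge0_ler_powR; rewrite ?nnegrE ?(ltW kappa_gt0)//; exact: le_trans tT.
Qed.

(** Majorant of the variation of the kernel, extended by zero beyond its
    singularity, when the latter moves from [t] to [t']. *)
Definition kernel_jump t t' s : R := if s < t then k t s - k t' s else k t' s.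

Lemma measurable_kernel_jump t t' (D : set R) : measurable_fun D (kernel_jump t t').
Proof.
apply: (@measurable_funS _ _ _ _ setT) => //.
apply: measurable_fun_ifT; last exact: measurable_kernel.
  by apply: measurable_fun_ltr; [exact: measurable_id|exact: measurable_cst].
by apply: measurable_funB; exact: measurable_kernel.
Qed.

Lemma kernel_jump_ge0 t t' s : t <= t' -> 0 <= kernel_jump t t' s.
Proof.
move=> tt'; rewrite /kernel_jump; case: ifPn => st; last exact: kernel_ge0.
by rewrite subr_ge0 kernel_anti.
Qed.

Lemma integral_kernel_jump_le t t' : 0 <= t -> t <= t' ->
  (\int[mu]_(s in `[0%R, t']) (kernel_jump t t' s)%:E <=
    (2 * (t' - t) `^ kappa / kappa)%:E)%E.
Proof.
move=> t0 tt'.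
have mJ (D : set R) : measurable_fun D (fun s => (kernel_jump t t' s)%:E).
  by apply/measurable_EFinP; exact: measurable_kernel_jump.
have mk r (D : set R) : measurable_fun D (fun s => (k r s)%:E).
  by apply/measurable_EFinP; exact: measurable_kernel.
have J0 s : (0 <= (kernel_jump t t' s)%:E)%E by rewrite lee_fin kernel_jump_ge0.
have k0 r s : (0 <= (k r s)%:E)%E by rewrite lee_fin kernel_ge0.
have -> : `[0, t']%classic = `[0, t[%classic `|` `[t, t']%classic.
  by rewrite -itv_bndbnd_setU// bnd_simp.
rewrite ge0_integral_setU; [|by []|by []|exact: mJ|by move=> s _; exact: J0|]; last first.
- apply/disj_set2P; rewrite -subset0 => s [/=]; rewrite !in_itv/= => /andP[_ st] /andP[ts _].
  by move: st; rewrite ltNge ts.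
have -> : 2 * (t' - t) `^ kappa / kappa =
    (t' - t) `^ kappa / kappa + (t' - t) `^ kappa / kappa by ring.
rewrite EFinD leeD//; last first.
  have -> : (\int[mu]_(s in `[t, t']) (kernel_jump t t' s)%:E =
      \int[mu]_(s in `[t, t']) (k t' s)%:E)%E.
    apply: eq_integral => s /set_mem/=; rewrite in_itv/= => /andP[ts _].
    by rewrite /kernel_jump ltNge ts.
  exact: integral_kernel_le.
have pw0 : (0 <= ((t' - t) `^ kappa / kappa)%:E)%E.
  by rewrite lee_fin divr_ge0 ?powR_ge0// ltW.
have [t00|t_gt0] := eqVneq t 0; first by rewrite t00 set_itvco0 integral_set0 -t00.
have {}t_gt0 : 0 < t by rewrite lt_neqAle eq_sym t_gt0.
have -> : (\int[mu]_(s in `[0%R, t[) (kernel_jump t t' s)%:E =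
    \int[mu]_(s in `[0%R, t[) (k t s - k t' s)%:E)%E.
  by apply: eq_integral => s /set_mem/=; rewrite in_itv/= /kernel_jump => /andP[_ ->].
have [ett|ntt] := eqVneq t t'.
  by under eq_integral do rewrite ett subrr; rewrite integral0.
have ltt : t < t' by rewrite lt_neqAle ntt.
pose Dk := (\int[mu]_(s in `[0%R, t[) (k t s - k t' s)%:E)%E.
pose Bk := (\int[mu]_(s in `[0%R, t[) (k t' s)%:E)%E.
have kt'E : Bk = ((t' `^ kappa - (t' - t) `^ kappa) / kappa)%:E.
  rewrite /Bk integral_itv_bndo_bndc; last exact: mk.
  by rewrite integral_kernel// subr0.
have : (Dk + Bk <= (t `^ kappa / kappa)%:E)%E.
  rewrite /Dk /Bk -ge0_integralD; last first.
  - exact: mk.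
  - by move=> s _; exact: k0.
  - by apply/measurable_EFinP; apply: measurable_funB; exact: measurable_kernel.
  - by move=> s; rewrite /= in_itv/= => /andP[_ st]; rewrite lee_fin subr_ge0 kernel_anti.
  - by [].
  have := integral_kernel_co kappa_gt0 t0; rewrite subr0.
  apply: le_trans; rewrite le_eqVlt; apply/orP; left; apply/eqP.
  by apply: eq_integral => s _; rewrite -EFinD subrK.
rewrite kt'E -/Dk -leeBrDr// -EFinB => /le_trans; apply.
rewrite lee_fin -mulrBl ler_pM2r ?invr_gt0//.
have : t `^ kappa <= t' `^ kappa.
  by apply: ge0_ler_powR; rewrite ?nnegrE ?(ltW kappa_gt0)//; exact: le_trans tt'.
by lra.
Qed.

End kernel_estimates.

(** * Functions with impulses *)

Section impulse_functions.
Context {R : realType}.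
Variables (T : R) (m : nat) (tau : nat -> R).
Hypothesis htau : impulse_times T m tau.
Implicit Types (j : nat) (s t : R).

Definition impulses : set R := [set tau j | j in [set j | (1 <= j <= m)%N]].

Let P : set R := `[0, T] `\` impulses.

Lemma tau_mono j j' : (j < j')%N -> (j' <= m.+1)%N -> tau j < tau j'.
Proof.
case: htau => _ _ h; elim: j' => // j' ih; rewrite ltnS leq_eqVlt => /predU1P[<-|jj'] jm.
  exact: h.
by apply: (lt_trans (ih jj' (ltnW jm))); exact: h.
Qed.

Lemma tau_le j j' : (j <= j')%N -> (j' <= m.+1)%N -> tau j <= tau j'.
Proof.
rewrite leq_eqVlt => /predU1P[->//|jj'] jm; apply/ltW; exact: tau_mono.
Qed.

Lemma tau_lt_iff j j' : (j <= m.+1)%N -> (j' <= m.+1)%N -> (tau j < tau j') = (j < j')%N.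
Proof.
move=> jm j'm; have [jj'|jj'] := ltnP j j'; first exact: tau_mono.
by apply/negbTE; rewrite -leNgt tau_le.
Qed.

Lemma tau_itv j : (1 <= j <= m)%N -> 0 < tau j < T.
Proof.
case: htau => t0 tT _ /andP[j1 jm]; rewrite -{1}t0 -tT.
by rewrite !tau_mono// ?ltnS// (leq_trans jm).
Qed.

Lemma T_gt0_of_impulses : 0 < T.
Proof. by case: htau => t0 tT _; rewrite -t0 -tT tau_mono. Qed.

Lemma finite_impulses : finite_set impulses.
Proof. by apply: finite_image; apply: (sub_finite_set (B := `I_m.+1)) => // j /= /andP[]. Qed.

Lemma near_left_itv j : (1 <= j <= m)%N -> \forall s \near (tau j)^'-, `[0, T]%classic s.
Proof.
move=> /tau_itv/andP[t0 tT]; near=> s; rewrite /= in_itv/=; apply/andP; split.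
  by near: s; exact: nbhs_left_ge.
by apply/ltW/(lt_trans _ tT); near: s; exact: nbhs_left_lt.
Unshelve. all: by end_near. Qed.

Lemma near_right_itv j : (1 <= j <= m)%N -> \forall s \near (tau j)^'+, `[0, T]%classic s.
Proof.
move=> /tau_itv/andP[t0 tT]; near=> s; rewrite /= in_itv/=; apply/andP; split.
  by apply/ltW/(lt_trans t0); near: s; exact: nbhs_right_gt.
by near: s; exact: nbhs_right_le.
Unshelve. all: by end_near. Qed.

Lemma impulse_continuousP (X : normedModType R) (x : R -> X) :
  impulse_continuous T m tau x <->
  [/\ forall t, P t -> x @ within P (nbhs t) --> x t,
      forall j, (1 <= j <= m)%N -> x @ (tau j)^'- --> x (tau j) &
      forall j, (1 <= j <= m)%N -> cvg (x @ (tau j)^'+)].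
Proof.
split=> [[/subspace_continuousP h1 h2]|[h1 h2 h3]].
  by split => // j /h2[].
split; first exact/subspace_continuousP.
by move=> j jm; split; [exact: h2|exact: h3].
Qed.

(** The hypothesis on [Phi] is stated for an arbitrary filter converging inside
    [[0, T]], so that it covers at once the limits inside the pieces, from the
    left and from the right of an impulse. *)
Lemma impulse_continuous_comp (X W : normedModType R) (Phi : R -> X -> W) (z : R -> X) :
  (forall (F : set_system R) t0 v0, Filter F -> t0 \in `[0, T] -> F --> t0 ->
    F `[0, T]%classic -> z @ F --> v0 -> Phi s (z s) @[s --> F] --> Phi t0 v0) ->
  impulse_continuous T m tau z -> impulse_continuous T m tau (fun s => Phi s (z s)).
Proof.
move=> hPhi /impulse_continuousP[h1 h2 h3]; apply/impulse_continuousP; split.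
- move=> t [tT tP]; apply: hPhi => //; last exact: h1.
    exact: cvg_within.
  by apply: nearW => s [].
- move=> j jm; have /andP[t0 tT] := tau_itv jm.
  apply: hPhi => //; last exact: h2.
  + by rewrite in_itv/= !ltW.
  + exact: cvg_within.
  + exact: near_left_itv.
- move=> j jm; have /andP[t0 tT] := tau_itv jm.
  have /cvg_ex[l hl] := h3 _ jm.
  apply/cvg_ex; exists (Phi (tau j) l); apply: hPhi => //.
  + by rewrite in_itv/= !ltW.
  + exact: cvg_within.
  + exact: near_right_itv.
Qed.

Lemma impulse_continuousD (X : normedModType R) (x y : R -> X) :
  impulse_continuous T m tau x -> impulse_continuous T m tau y ->
  impulse_continuous T m tau (x \+ y).
Proof.
move=> /impulse_continuousP[h1 h2 h3] /impulse_continuousP[k1 k2 k3].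
apply/impulse_continuousP; split.
- by move=> t Pt; apply: cvgD; [exact: h1|exact: k1].
- by move=> j jm; apply: cvgD; [exact: h2|exact: k2].
- by move=> j jm; apply: is_cvgD; [exact: h3|exact: k3].
Qed.

Lemma continuous_impulse_continuous (X : normedModType R) (x : R -> X) :
  {within `[0, T], continuous x} -> impulse_continuous T m tau x.
Proof.
move=> cx; have hx := (subspace_continuousP _ _).1 cx.
have sub F t : Filter F -> t \in `[0, T] -> F --> t -> F `[0, T]%classic -> x @ F --> x t.
  move=> FF tT Ft FT B /(hx t tT) h; rewrite /nbhs/=.
  by apply: filterS2 FT (Ft _ h) => s sT; apply.
apply/impulse_continuousP; split.
- move=> t [tT _]; apply: sub => //; first exact: cvg_within.
  by apply: nearW => s [].
- move=> j jm; have /andP[t0 tT] := tau_itv jm.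
  apply: sub; [by rewrite in_itv/= !ltW|exact: cvg_within|exact: near_left_itv].
- move=> j jm; have /andP[t0 tT] := tau_itv jm.
  apply/cvg_ex; exists (x (tau j)).
  apply: sub; [by rewrite in_itv/= !ltW|exact: cvg_within|exact: near_right_itv].
Qed.

Lemma eventually_cst_cvg (X : normedModType R) (F : set_system R) (x : R -> X) l :
  Filter F -> (\forall s \near F, x s = l) -> x @ F --> l.
Proof.
move=> FF h B /nbhs_singleton Bl.
by apply: filterS h => s xs /=; rewrite xs.
Qed.

Lemma jump_impulse_continuous (X : normedModType R) i (v : X) : (1 <= i <= m)%N ->
  impulse_continuous T m tau (fun t => if tau i < t then v else 0).
Proof.
move=> im; apply/impulse_continuousP; split.
- move=> t [tT tP]; apply: eventually_cst_cvg.
  have [it|ti] := ltP (tau i) t.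
    have near_it : \forall s \near within P (nbhs t), tau i < s.
      by apply: filterS (lt_nbhsr it) => s its _.
    by apply: filterS near_it => s ->.
  have {}ti : t < tau i.
    by rewrite lt_neqAle ti andbT; apply/eqP => e; apply: tP; exists i.
  have near_ti : \forall s \near within P (nbhs t), s < tau i.
    by apply: filterS (lt_nbhsl ti) => s its _.
  by apply: filterS near_ti => s /ltW; rewrite leNgt => /negbTE ->.
- move=> j jm; apply: eventually_cst_cvg.
  have [ij|ji] := ltP (tau i) (tau j).
    near=> s; have its : tau i < s by near: s; exact: nbhs_left_gt.
    by rewrite its.
  near=> s; have /ltW : s < tau i.
    by apply: lt_le_trans ji; near: s; exact: nbhs_left_lt.
  by rewrite leNgt => /negbTE ->.
- move=> j jm; apply/cvg_ex.
  have [ij|ji] := leP (tau i) (tau j).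
    exists v; apply: eventually_cst_cvg.
    near=> s; have its : tau i < s.
      by apply: (le_lt_trans ij); near: s; exact: nbhs_right_gt.
    by rewrite its.
  exists 0; apply: eventually_cst_cvg.
  near=> s; have : s <= tau i by near: s; exact: nbhs_right_le.
  by rewrite leNgt => /negbTE ->.
Unshelve. all: by end_near. Qed.

Lemma step_impulse_continuous (X : normedModType R) (v : nat -> X) :
  impulse_continuous T m tau (fun t => \sum_(1 <= i < m.+1 | tau i < t) v i).
Proof.
have -> : (fun t => \sum_(1 <= i < m.+1 | tau i < t) v i) =
    (fun t => \sum_(1 <= i < m.+1) (if tau i < t then v i else 0)).
  by apply/funext => t; rewrite big_mkcond.
have : forall n, (n <= m)%N ->
  impulse_continuous T m tau (fun t => \sum_(1 <= i < n.+1) (if tau i < t then v i else 0)).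
  elim=> [_|n ih nm].
    under eq_fun do rewrite big_geq//.
    apply: continuous_impulse_continuous; apply: continuous_subspaceT => t.
    exact: cvg_cst.
  under eq_fun do rewrite big_nat_recr//=.
  apply: impulse_continuousD; first exact: ih (ltnW nm).
  by apply: jump_impulse_continuous.
exact.
Qed.

(** Each time has a neighbourhood on which the function is bounded; compactness
    of [[0, T]] makes the bound global. *)
Lemma impulse_continuous_bounded (X : normedModType R) (x : R -> X) :
  impulse_continuous T m tau x ->
  exists2 M, 0 <= M & forall t, t \in `[0, T] -> `|x t| <= M.
Proof.
move=> /impulse_continuousP[h1 h2 h3].
pose C := \sum_(i < m.+1) `|x (tau i)|.
have C0 : 0 <= C by apply: sumr_ge0.
have Cj j : (1 <= j <= m)%N -> `|x (tau j)| <= C.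
  move=> /andP[_ jm]; rewrite /C (bigD1 (Ordinal (jm : (j < m.+1)%N)))//= lerDl.
  exact: sumr_ge0.
have near_bnd (F : set_system R) l : Filter F -> x @ F --> l ->
    \forall s \near F, `|x s| <= `|l| + 1.
  move=> FF /cvgrPdist_le/(_ 1 ltr01); apply: filterS => s.
  have -> : x s = l - (l - x s) by rewrite opprB addrC subrK.
  by rewrite opprB addrC subrK => h; rewrite (le_trans (ler_normB _ _))// lerD2l.
have loc t : t \in `[0, T] -> exists B, \forall s \near t, `[0, T]%classic s -> `|x s| <= B.
  move=> tT; have [[j jm jt]|tI] := pselect (impulses t).
    have /cvg_ex[l hr] := h3 _ jm.
    exists (`|x (tau j)| + `|l| + 1); rewrite -jt.
    have hl' : \forall s \near tau j, s < tau j -> `|x s| <= `|x (tau j)| + 1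
      by exact: (near_bnd _ _ _ (h2 _ jm)).
    have hr' : \forall s \near tau j, tau j < s -> `|x s| <= `|l| + 1
      by exact: (near_bnd _ _ _ hr).
    near=> s => _; have [st|ts|->] := ltgtP s (tau j).
    - have : `|x s| <= `|x (tau j)| + 1 by move: st; near: s.
      by move=> /le_trans; apply; rewrite lerD2r lerDl.
    - have : `|x s| <= `|l| + 1 by move: ts; near: s.
      by move=> /le_trans; apply; rewrite lerD2r lerDr.
    - by rewrite -addrA lerDl addr_ge0.
  exists (`|x t| + 1 + C).
  have nt : \forall s \near t, P s -> `|x s| <= `|x t| + 1
    by exact: (near_bnd _ _ _ (h1 t (conj tT tI))).
  apply: filterS nt => s hs sT.
  have [[j jm <-]|sI] := pselect (impulses s).
    by apply: (le_trans (Cj _ jm)); rewrite lerDr addr_ge0.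
  by apply: (le_trans (hs (conj sT sI))); rewrite lerDl.
have cover : near_covering `[0, T]%classic.
  by apply/compact_near_coveringP; exact: segment_compact.
suff /pinfty_ex_gt0[M M0 hM] : \forall M \near (+oo : set_system R),
    `[0, T] `<=` (fun t => `|x t| <= M).
  by exists M; [exact: ltW|move=> t tT; exact: hM].
apply: ((near_covering_withinP _).2 cover R +oo%R (fun M t => `|x t| <= M)) => t tT.
have [B hB] := loc t tT.
exists ([set s | `[0, T]%classic s -> `|x s| <= B], [set M | B <= M]) => /=.
  by split; [exact: hB|apply: nbhs_pinfty_ge; exact: num_real].
by move=> [s M] /= [hs BM] sT; exact: le_trans (hs sT) BM.
Unshelve. all: by end_near. Qed.

Lemma impulse_continuous_at (X : normedModType R) (x : R -> X) s :
  impulse_continuous T m tau x -> 0 < s < T -> ~ impulses s -> {for s, continuous x}.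
Proof.
move=> /impulse_continuousP[h1 _ _] /andP[s0 sT] sI.
have Ps : P s by split => //=; rewrite in_itv/= !ltW.
have cI : closed impulses.
  apply: accessible_finite_set_closed.1 finite_impulses.
  exact/hausdorff_accessible/Rhausdorff.
have nP : \forall r \near s, P r.
  have n1 : \forall r \near s, ~ impulses r.
    by apply: open_nbhs_nbhs; split => //; exact: closed_openC.
  near=> r; split; last by near: r.
  rewrite /= in_itv/=; apply/andP; split; apply/ltW; near: r.
    exact: lt_nbhsr.
  exact: lt_nbhsl.
move=> B /(h1 _ Ps) h; rewrite /nbhs/=.
by apply: filterS2 nP h => r Pr; apply.
Unshelve. all: by end_near. Qed.

(** Away from the finite set of impulses and endpoints the function is continuous
    on an open set. *)
Lemma impulse_measurable (phi : R -> R) t :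
  (forall s, 0 < s < t -> ~ impulses s -> {for s, continuous phi}) ->
  measurable_fun `[0, t] phi.
Proof.
move=> cphi.
pose O : set R := `]0, t[ `\` impulses.
have cI : closed impulses.
  apply: accessible_finite_set_closed.1 finite_impulses.
  exact/hausdorff_accessible/Rhausdorff.
have oO : open O by apply: openI; [exact: interval_open|exact: closed_openC].
have mO : measurable O by exact: open_measurable.
have -> : `[0, t]%classic = O `|` (`[0, t] `\` O).
  by rewrite setDUK// => s [/=]; rewrite !in_itv/= => /andP[/ltW-> /ltW->].
have mD : measurable (`[0, t] `\` O) by exact: measurableD.
apply/measurable_funU => //; split.
  apply: open_continuous_measurable_fun => // s /set_mem[]/=.
  by rewrite in_itv/=; exact: cphi.
move=> _ B _; apply: countable_measurable => //.
apply/finite_set_countable; apply: (@sub_finite_set _ _ ([set 0; t] `|` impulses)).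
  move=> s [[/= + sO] _]; rewrite in_itv/= => /andP[s0 st].
  have [sI|sI] := pselect (impulses s); first by right.
  left; apply: contrapT => h; apply: sO; split => //=; rewrite in_itv/=.
  apply/andP; split; rewrite lt_neqAle ?s0 ?st andbT; apply/eqP => e; apply: h.
    by left.
  by right.
by rewrite finite_setU; split; [exact: finite_set2|exact: finite_impulses].
Qed.

Lemma uniform_limit_cvg (X : completeNormedModType R) (F : set_system R)
    (zn : nat -> R -> X) (z : R -> X) (e : nat -> R) :
  ProperFilter F -> F `[0, T]%classic -> e n @[n --> \oo] --> 0 ->
  (forall n s, s \in `[0, T] -> `|zn n s - z s| <= e n) ->
  (forall n, cvg (zn n @ F)) -> cvg (z @ F).
Proof.
move=> PF FT e0 hz hc; apply/cauchy_cvgP/cauchy_exP => eps eps0.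
have eps2 : 0 < eps / 2 by rewrite divr_gt0.
have [n hn] : exists n, e n < eps / 2.
  have [n _ hn] := cvgr_lt 0 e0 _ eps2; exists n; exact: (hn n (leqnn n)).
have /cvg_ex[l hl] := hc n.
have {}hl : \forall s \near F, `|l - zn n s| < eps / 2.
  by move/cvgrPdist_lt : hl; exact.
exists l; suff : \forall s \near F, ball l eps (z s) by [].
apply: filterS2 FT hl => s sT hs; rewrite /= -ball_normE/=.
have -> : l - z s = (l - zn n s) + (zn n s - z s) by rewrite addrA subrK.
rewrite (le_lt_trans (ler_normD _ _))// (splitr eps) ltrD//.
exact: le_lt_trans (hz _ _ sT) hn.
Qed.

Lemma impulse_continuous_uniform_limit (X : completeNormedModType R)
    (zn : nat -> R -> X) (z : R -> X) (e : nat -> R) :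
  (forall n, impulse_continuous T m tau (zn n)) -> e n @[n --> \oo] --> 0 ->
  (forall n s, s \in `[0, T] -> `|zn n s - z s| <= e n) ->
  impulse_continuous T m tau z.
Proof.
move=> icn e0 hz.
have ptw (F : set_system R) t : Filter F -> F `[0, T]%classic -> t \in `[0, T] ->
    (forall n, zn n @ F --> zn n t) -> z @ F --> z t.
  move=> FF FT tT hc; apply/cvgrPdist_le => eps eps0.
  have eps3 : 0 < eps / 3 by rewrite divr_gt0.
  have [n hn] : exists n, e n < eps / 3.
    have [n _ hn] := cvgr_lt 0 e0 _ eps3; exists n; exact: (hn n (leqnn n)).
  have hcn : \forall s \near F, `|zn n t - zn n s| <= eps / 3.
    by move/cvgrPdist_le : (hc n); exact.
  apply: filterS2 FT hcn => s sT hs.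
  have -> : z t - z s = (zn n s - z s) - (zn n t - z t) + (zn n t - zn n s).
    by rewrite opprB -[RHS]addrA [X in _ = _ + X]addrA subrK [RHS]addrC [RHS]addrA subrK.
  rewrite (le_trans (ler_normD _ _))//.
  have h1 := le_trans (ler_normB (zn n s - z s) (zn n t - z t))
    (lerD (hz n s sT) (hz n t tT)).
  by lra.
apply/impulse_continuousP; split.
- move=> t [tT tI]; apply: ptw => //; first by apply: nearW => s [].
  by move=> n; have /impulse_continuousP[h _ _] := icn n; apply: h.
- move=> j jm; have /andP[t0 tT] := tau_itv jm.
  apply: ptw; [exact: near_left_itv|by rewrite in_itv/= !ltW|].
  by move=> n; have /impulse_continuousP[_ h _] := icn n; apply: h.
- move=> j jm; have PF : ProperFilter (tau j)^'+ by exact: at_right_proper_filter.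
  apply: (uniform_limit_cvg PF (near_right_itv jm) e0 hz).
  by move=> n; have /impulse_continuousP[_ _ h] := icn n; apply: h.
Qed.

End impulse_functions.

(** * A weight adapted to impulses and memory *)

Lemma expRN_le {R : realType} (x : R) : x * expR (- x) <= 1.
Proof.
rewrite expRN -[leRHS](@mulfV _ (expR x)) ?gt_eqF ?expR_gt0//.
rewrite ler_pM2r ?invr_gt0 ?expR_gt0//.
by apply: le_trans (expR_ge1Dx x); rewrite lerDr.
Qed.

Lemma le_of_halving {R : realType} (x y r : R) : 0 <= y ->
  (forall n, x <= y / 2 ^+ n + r) -> x <= r.
Proof.
move=> y0 h; apply/ler_addgt0Pr => e e0.
have [n hn] : exists n, y / 2 ^+ n <= e.
  exists (Num.truncn (y / e)).+1; set n := (_.+1)%N.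
  rewrite ler_pdivrMr ?exprn_gt0// mulrC -ler_pdivrMr//.
  apply: (le_trans (ltW (truncnS_gt _))); rewrite -natrX ler_nat.
  by apply/ltnW/ltn_expl.
by apply: (le_trans (h n)); rewrite addrC lerD2l.
Qed.

Section weights.
Context {R : realType}.
Variables (T : R) (m : nat) (tau : nat -> R) (kappa : R).
Hypothesis htau : impulse_times T m tau.
Hypotheses (kappa_gt0 : 0 < kappa).

(** A clock that advances by one unit at each impulse, so that an exponential
    weight in this clock contracts the jumps as well as the integral term. *)
Definition clock (t : R) : R :=
  t + (\sum_(1 <= i < m.+1) (tau i < t)%R)%N%:R.

Lemma clock_le (s t : R) : s <= t -> t - s <= clock t - clock s.
Proof.
move=> st; rewrite /clock opprD addrACA lerDl subr_ge0 ler_nat.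
apply: leq_sum => i _; case: ltP => // is_.
by rewrite (lt_le_trans is_ st).
Qed.

Lemma clock_jump i (t : R) : (1 <= i <= m)%N -> tau i < t ->
  clock (tau i) + 1 <= clock t.
Proof.
move=> im it; rewrite /clock -addrA lerD ?(ltW it)// natr1 ler_nat.
have ir : i \in index_iota 1 m.+1 by rewrite mem_index_iota.
rewrite (bigD1_seq i)//= ?iota_uniq// ltxx add0n.
rewrite [X in (_ <= X)%N](bigD1_seq i)//= ?iota_uniq// it add1n ltnS.
apply: leq_sum => k _; case: (ltP (tau k) (tau i)) => // ki.
by rewrite (lt_trans ki it).
Qed.

(** The constants are chosen in this order: [eta] makes the recent part of the
    memory small, then the growth rate of the exponential makes both [theta],
    which controls the remote part, and the contribution of the past jumps
    small. *)
Lemma exists_weight (d : nat -> R) (a : R) : 0 <= a ->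
  (forall i, (1 <= i <= m)%N -> 0 <= d i) ->
  exists (w : R -> R) (eta theta : R), [/\ 0 < eta, 0 <= theta,
    a * (eta `^ kappa / kappa + theta * (T `^ kappa / kappa)) <= 1 / 4 &
    [/\ forall t, 0 <= t -> 1 <= w t, forall s t, s <= t -> w s <= w t,
     forall s t, s <= t -> w s <= w t * (\1_(`[t - eta, t]%classic) s + theta) &
     forall t, \sum_(1 <= i < m.+1 | tau i < t) d i * w (tau i) <= w t / 4]].
Proof.
move=> a0 d0.
pose D := \sum_(1 <= i < m.+1) d i.
have D0 : 0 <= D by rewrite /D big_nat_cond; apply: sumr_ge0 => i /andP[im _]; exact: d0.
have [eta eta0 heta] : exists2 eta, 0 < eta & a * (eta `^ kappa / kappa) <= 1 / 8.
  have e0 : 0 < kappa / (8 * (a + 1)) by rewrite divr_gt0// mulr_gt0// ltr_wpDl.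
  have /cvgrPdist_le/(_ _ e0) h := powR_cvg0 kappa_gt0.
  have [x [x0 hx]] : exists x : R, 0 < x /\ `|0 - x `^ kappa| <= kappa / (8 * (a + 1)).
    apply: (@filter_ex _ (0 : R)^'+); near=> x; split; last by near: x.
    by near: x; exact: nbhs_right_gt.
  exists x => //; move: hx; rewrite sub0r normrN ger0_norm ?powR_ge0//.
  rewrite ler_pdivlMr ?mulr_gt0 ?ltr_wpDl// => hx.
  rewrite mulrA ler_pdivrMr//.
  have := powR_ge0 x kappa; nra.
pose b := a * (T `^ kappa / kappa).
have b0 : 0 <= b by rewrite mulr_ge0// divr_ge0 ?powR_ge0// ltW.
pose lam := 1 + 4 * D + 8 * b / eta.
have be0 : 0 <= 8 * b / eta by apply: divr_ge0; [exact: mulr_ge0|exact: ltW].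
have lam0 : 0 < lam by rewrite /lam; lra.
exists (fun t => expR (lam * clock t)), eta, (expR (- (lam * eta))); split => //.
- have h := expRN_le (lam * eta).
  have h2 : 8 * b <= lam * eta.
    have -> : lam * eta = (1 + 4 * D) * eta + 8 * b.
      by rewrite /lam mulrDl divfK ?gt_eqF.
    by rewrite lerDr mulr_ge0 ?(ltW eta0)//; lra.
  have h3 := expR_ge0 (- (lam * eta)).
  have : 8 * b * expR (- (lam * eta)) <= 1 by apply: le_trans h; rewrite ler_wpM2r.
  by rewrite mulrDr mulrCA -/b; lra.
- have mono s t : s <= t -> expR (lam * clock s) <= expR (lam * clock t) * expR (- (lam * (t - s))).
    move=> st; rewrite -expRD ler_expR -mulrBr ler_pM2l//.
    by have := clock_le st; lra.
  have le1 s t : s <= t -> expR (lam * clock s) <= expR (lam * clock t).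
    move=> st; apply: (le_trans (mono _ _ st)); rewrite ger_pMr ?expR_gt0//.
    by rewrite expR_le1 oppr_le0 mulr_ge0 ?(ltW lam0)// subr_ge0.
  split => //.
  + move=> t t0; apply: (le_trans _ (expR_ge1Dx _)); rewrite lerDl.
    by rewrite mulr_ge0 ?(ltW lam0)// addr_ge0.
  + move=> s t st; rewrite indicE.
    have [_|] := boolP (s \in `[t - eta, t]%classic).
      apply: (le_trans (le1 _ _ st)).
      by rewrite ler_peMr ?expR_ge0// lerDl expR_ge0.
    rewrite notin_setE/= in_itv/= st andbT => /negP; rewrite -ltNge => h.
    rewrite add0r; apply: (le_trans (mono _ _ st)).
    by rewrite ler_pM2l ?expR_gt0// ler_expR lerN2 ler_pM2l//; lra.
  + move=> t.
    have h4 : D * expR (- lam) <= 1 / 4.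
      have h := expRN_le lam.
      have : 4 * D * expR (- lam) <= lam * expR (- lam).
        by rewrite ler_wpM2r ?expR_ge0// /lam; lra.
      by lra.
    apply: (@le_trans _ _ (\sum_(1 <= i < m.+1) d i * (expR (lam * clock t) * expR (- lam)))).
      rewrite big_mkcond/= [leLHS]big_nat_cond [leRHS]big_nat_cond.
      apply: ler_sum => i /andP[im _]; case: ltP => [it|_]; last first.
        by rewrite mulr_ge0 ?d0// mulr_ge0 ?expR_ge0.
      rewrite ler_wpM2l ?d0// -expRD ler_expR.
      have hl : lam * (clock (tau i) + 1) <= lam * clock t.
        by rewrite ler_pM2l//; exact: clock_jump.
      by lra.
    by rewrite -mulr_suml -/D mulrCA ler_pM2l ?expR_gt0//; lra.
Unshelve. all: by end_near. Qed.

End weights.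

(** * The integral equation *)

Section mild.
Context {R : realType} (X : completeNormedModType R).
Variables (T : R) (m : nat) (tau : nat -> R) (kappa : R).
Hypothesis htau : impulse_times T m tau.
Hypotheses (kappa_gt0 : 0 < kappa) (kappa_lt1 : kappa < 1).
Variables (z0 : X) (c : R) (Theta : nat -> X -> X) (d : nat -> R).
Hypothesis d_ge0 : forall j, (1 <= j <= m)%N -> 0 <= d j.
Hypothesis Theta_lip : forall j z1 z2, (1 <= j <= m)%N ->
  `|Theta j z1 - Theta j z2| <= d j * `|z1 - z2|.

Local Notation mu := (@lebesgue_measure R).
Local Notation IC := (impulse_continuous T m tau).
Local Notation k := (kernel kappa).

(** One step of the Picard iteration: [z'] is the image of [z] when the forcing
    [h] is frozen. The sum collects the impulses already met. *)
Definition mild_step (h z z' : R -> X) := forall t, t \in `[0, T] ->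
  exists2 I : X, is_bochner_integral mu `[0, t] (fun s => k t s *: h s) I &
    z' t = z0 + \sum_(1 <= i < m.+1 | tau i < t) Theta i (z (tau i)) + c *: I.

Lemma bochner_of_impulse (h : R -> X) t : separable_space X -> IC h -> t \in `[0, T] ->
  exists I, is_bochner_integral mu `[0, t] (fun s => k t s *: h s) I.
Proof.
move=> sepX ich /[dup] tT; rewrite in_itv/= => /andP[t0 tT'].
have [M M0 hM] := impulse_continuous_bounded ich.
have sT s : s \in `[0, t] -> s \in `[0, T].
  by rewrite !in_itv/= => /andP[-> /le_trans]; apply.
have fin : (mu `[0%R, t]%classic < +oo)%E.
  by rewrite lebesgue_measure_itv/=; case: ifP => // _; rewrite ltry.
apply: bochner_integral_exists => //.
  move=> v; apply: (@impulse_measurable R m tau (fun s => `|k t s *: h s - v|) t).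
  move=> s /andP[s0 st] sI.
  apply: (@continuous_comp _ _ _ (fun s => k t s *: h s - v) (fun x : X => `|x|)); last first.
    exact: norm_continuous.
  apply: cvgB; last exact: cvg_cst.
  apply: cvgZ; first exact: kernel_continuous.
  by apply: (impulse_continuous_at ich _ sI); rewrite s0 (lt_le_trans st).
apply: (@le_lt_trans _ _ (\int[mu]_(s in `[0%R, t]) (M * k t s)%:E)%E).
  apply: ge0_le_integral => //.
  - apply/measurable_EFinP; apply: (@impulse_measurable R m tau (fun s => `|k t s *: h s|) t).
    move=> s /andP[s0 st] sI.
    apply: (@continuous_comp _ _ _ (fun s => k t s *: h s) (fun x : X => `|x|)); last first.
      exact: norm_continuous.
    apply: cvgZ; first exact: kernel_continuous.
    by apply: (impulse_continuous_at ich _ sI); rewrite s0 (lt_le_trans st).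
  - apply/measurable_EFinP; apply: measurable_funM; first exact: measurable_cst.
    exact: measurable_kernel.
  - move=> s /sT sT'; rewrite lee_fin normrZ ger0_norm ?kernel_ge0// mulrC.
    by rewrite ler_wpM2r ?kernel_ge0// hM.
under eq_integral do rewrite EFinM.
rewrite ge0_integralZl_EFin//; last first.
- by apply/measurable_EFinP; exact: measurable_kernel.
- by move=> s _; rewrite lee_fin kernel_ge0.
apply: (@le_lt_trans _ _ (M%:E * ((t - 0) `^ kappa / kappa)%:E)%E).
  by rewrite lee_wpmul2l ?lee_fin// integral_kernel_le.
by rewrite -EFinM ltry.
Qed.

(** Hoelder continuity in time of the fractional integral of a bounded function;
    the integral on [[0, t]] is extended by zero and the kernels are compared
    through [kernel_jump]. *)
Lemma mild_increment (h : R -> X) M t t' I I' :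
  (forall s, s \in `[0, T] -> `|h s| <= M) -> 0 <= t -> t <= t' -> t' <= T ->
  is_bochner_integral mu `[0, t] (fun s => k t s *: h s) I ->
  is_bochner_integral mu `[0, t'] (fun s => k t' s *: h s) I' ->
  `|I - I'| <= M * (2 * (t' - t) `^ kappa / kappa).
Proof.
move=> hM t0 tt' t'T hI hI'.
have t'0 : 0 <= t' by exact: le_trans tt'.
have M0 : 0 <= M by apply: le_trans (hM 0 _); rewrite // in_itv/= lexx (le_trans t'0).
have fin : (mu `[0%R, t']%classic < +oo)%E.
  by rewrite lebesgue_measure_itv/=; case: ifP => // _; rewrite ltry.
have sub : `[0, t]%classic `<=` `[0, t']%classic.
  by move=> s /=; rewrite !in_itv/= => /andP[-> /le_trans]; apply.
have hIe : is_bochner_integral mu `[0, t']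
    (patch (fun=> 0) `[0, t] (fun s => k t s *: h s)) I.
  exact: bochner_integral_extend hI.
have mG : measurable_fun `[0, t'] (fun s => M * kernel_jump kappa t t' s).
  by apply: measurable_funM; [exact: measurable_cst|exact: measurable_kernel_jump].
have ptw s : `[0, t']%classic s ->
    `|patch (fun=> 0) `[0, t] (fun s => k t s *: h s) s - k t' s *: h s| <=
    M * kernel_jump kappa t t' s.
  rewrite /= in_itv/= => /andP[s0 st'].
  have hs : `|h s| <= M by apply: hM; rewrite in_itv/= s0 (le_trans st').
  rewrite /kernel_jump /patch; have [st|ts] := ltP s t.
    have st_ : s \in `[0, t]%classic by apply/mem_set; rewrite /= in_itv/= s0 ltW.
    rewrite st_ -scalerBl normrZ.
    have kk : 0 <= k t s - k t' s by rewrite subr_ge0 kernel_anti.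
    by rewrite [`|k t s - _|]ger0_norm// [leLHS]mulrC ler_wpM2r.
  have -> : (if s \in `[0, t]%classic then k t s *: h s else 0) = 0.
    case: ifPn => // /set_mem/=; rewrite in_itv/= => /andP[_ st].
    (* at the singularity the kernel is [0 `^ (kappa - 1) = 0] by convention *)
    have -> : s = t by apply/eqP; rewrite eq_le st ts.
    by rewrite /kernel subrr powR0 ?scale0r// subr_eq0 lt_eqF.
  rewrite sub0r normrN normrZ [leLHS]mulrC [`|k t' s|]ger0_norm ?kernel_ge0//.
  by rewrite ler_wpM2r ?kernel_ge0.
have : (`|I - I'|%:E <= \int[mu]_(s in `[0%R, t']) (M * kernel_jump kappa t t' s)%:E)%E.
  exact: bochner_integral_le hIe hI' mG ptw.
under eq_integral do rewrite EFinM.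
rewrite ge0_integralZl_EFin//; last first.
- by apply/measurable_EFinP; exact: measurable_kernel_jump.
- by move=> s _; rewrite lee_fin kernel_jump_ge0.
rewrite -lee_fin => /le_trans; apply; rewrite [leRHS]EFinM lee_wpmul2l ?lee_fin//.
exact: integral_kernel_jump_le.
Qed.

Lemma mild_exists (h z : R -> X) : separable_space X -> IC h ->
  exists2 z', IC z' & mild_step h z z'.
Proof.
move=> sepX ich; have [M M0 hM] := impulse_continuous_bounded ich.
have hI t : exists I, t \in `[0, T] -> is_bochner_integral mu `[0, t] (fun s => k t s *: h s) I.
  have [tT|tT] := pselect (t \in `[0, T]); last by exists 0.
  by have [I hI] := bochner_of_impulse sepX ich tT; exists I.
have [I IP] := choice hI.
exists ((fun t => z0 + \sum_(1 <= i < m.+1 | tau i < t) Theta i (z (tau i))) \+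
  (fun t => c *: I t)); last first.
  by move=> t tT; exists (I t) => //; exact: IP.
apply: impulse_continuousD.
  apply: (@impulse_continuousD _ _ _ _ _ (fun=> z0)); last first.
    exact: (step_impulse_continuous htau).
  by apply: (continuous_impulse_continuous htau); apply: continuous_subspaceT => t; exact: cvg_cst.
apply: (continuous_impulse_continuous htau).
have holder t t' : t \in `[0, T] -> t' \in `[0, T] ->
    `|I t - I t'| <= M * (2 * `|t' - t| `^ kappa / kappa).
  move=> /[dup] tT; rewrite in_itv/= => /andP[t0 tT'].
  move=> /[dup] t'T; rewrite in_itv/= => /andP[t'0 t'T'].
  have [tt'|t't] := leP t t'.
    rewrite [`|t' - t|]ger0_norm ?subr_ge0//.
    exact: (mild_increment hM t0 tt' t'T' (IP _ tT) (IP _ t'T)).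
  rewrite distrC [`|t' - t|]distrC [`|t - t'|]ger0_norm ?subr_ge0 ?(ltW t't)//.
  exact: (mild_increment hM t'0 (ltW t't) tT' (IP _ t'T) (IP _ tT)).
apply/subspace_continuousP => t tT; apply: cvgZl_tmp.
apply/cvgrPdist_le => e e0.
pose B := M * 2 / kappa + 1.
have B0 : 0 < B by rewrite ltr_wpDl// divr_ge0 ?mulr_ge0// ltW.
have eB : 0 < e / B by rewrite divr_gt0.
have [x [x0 hx]] : exists x : R, 0 < x /\ `|0 - x `^ kappa| <= e / B.
  have /cvgrPdist_le/(_ _ eB) h0 := powR_cvg0 kappa_gt0.
  apply: (@filter_ex _ (0 : R)^'+); near=> x; split; last by near: x.
  by near: x; exact: nbhs_right_gt.
rewrite sub0r normrN ger0_norm ?powR_ge0// in hx.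
have : \forall s \near t, `|t - s| <= x by exact: (@near_norm_le R R^o).
apply: filterS => s ts sT; rewrite /= (le_trans (holder t s tT sT))//.
have h1 : `|s - t| `^ kappa <= e / B.
  apply: le_trans hx; rewrite distrC.
  by apply: ge0_ler_powR; rewrite ?nnegrE ?(ltW kappa_gt0) ?(ltW x0).
rewrite ler_pdivlMr// in h1; apply: le_trans h1.
have -> : M * (2 * `|s - t| `^ kappa / kappa) = `|s - t| `^ kappa * (M * 2 / kappa) by ring.
by rewrite ler_wpM2l ?powR_ge0// /B lerDl.
Unshelve. all: by end_near. Qed.

End mild.

Section mild_solutions.
Context {R : realType} (X : completeNormedModType R).
Variables (T : R) (m : nat) (tau : nat -> R) (kappa : R).
Hypothesis htau : impulse_times T m tau.
Hypotheses (kappa_gt0 : 0 < kappa) (kappa_lt1 : kappa < 1).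
Variables (z0 : X) (c : R) (Theta : nat -> X -> X) (d : nat -> R).
Hypothesis d_ge0 : forall j, (1 <= j <= m)%N -> 0 <= d j.
Hypothesis Theta_lip : forall j z1 z2, (1 <= j <= m)%N ->
  `|Theta j z1 - Theta j z2| <= d j * `|z1 - z2|.

Local Notation mu := (@lebesgue_measure R).
Local Notation IC := (impulse_continuous T m tau).
Local Notation k := (kernel kappa).
Local Notation step := (mild_step T m tau kappa z0 c Theta).

Let T0 : 0 < T := T_gt0_of_impulses htau.

Let tau_in i : (1 <= i <= m)%N -> tau i \in `[0, T].
Proof. by move=> /(tau_itv htau)/andP[t0 tT]; rewrite in_itv/= !ltW. Qed.

(** In the weighted distance a step contracts by one half: a quarter comes from
    the past jumps, a quarter from the memory term. The term in [b] accounts for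
    a perturbation of the forcing. *)
Lemma mild_difference (h1 h2 z1 z2 z1' z2' : R -> X) (w : R -> R) (eta theta L C b : R) :
  0 < eta -> 0 <= theta -> 0 <= L -> 0 <= C -> 0 <= b ->
  `|c| * L * (eta `^ kappa / kappa + theta * (T `^ kappa / kappa)) <= 1 / 4 ->
  (forall t, 0 <= t -> 1 <= w t) ->
  (forall s t, s <= t -> w s <= w t * (\1_(`[t - eta, t]%classic) s + theta)) ->
  (forall t, \sum_(1 <= i < m.+1 | tau i < t) d i * w (tau i) <= w t / 4) ->
  step h1 z1 z1' -> step h2 z2 z2' ->
  (forall s, s \in `[0, T] -> `|z1 s - z2 s| <= C * w s) ->
  (forall s, s \in `[0, T] -> `|h1 s - h2 s| <= L * (C * w s) + b) ->
  forall t, t \in `[0, T] ->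
    `|z1' t - z2' t| <= C / 2 * w t + `|c| * (T `^ kappa / kappa) * b.
Proof.
move=> eta0 th0 L0 C0 b0 small w1 wwin wjump s1 s2 hz hh t /[dup] tT.
rewrite in_itv/= => /andP[t0 tT'].
have [I1 hI1 ->] := s1 t tT; have [I2 hI2 ->] := s2 t tT.
have w0 : 0 <= w t by apply: le_trans (w1 t t0).
set S1 := \sum_(_ <= _ < _ | _) _; set S2 := \sum_(_ <= _ < _ | _) _.
have -> : z0 + S1 + c *: I1 - (z0 + S2 + c *: I2) = (S1 - S2) + c *: (I1 - I2).
  by rewrite scalerBr opprD addrACA; congr (_ + _); rewrite opprD addrACA subrr add0r.
have jumps : `|S1 - S2| <= C * w t / 4.
  rewrite /S1 /S2 -sumrB (le_trans (ler_norm_sum _ _ _))//.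
  apply: (@le_trans _ _ (C * \sum_(1 <= i < m.+1 | tau i < t) d i * w (tau i))).
    rewrite mulr_sumr big_nat_cond [leRHS]big_nat_cond; apply: ler_sum => i /andP[im it].
    rewrite (le_trans (Theta_lip _ _ im))// mulrCA ler_wpM2l ?d_ge0// hz//.
    exact: tau_in.
  by rewrite -mulrA ler_wpM2l.
pose B := L * C * w t.
have B0 : 0 <= B by rewrite !mulr_ge0.
have fin : (mu `[0%R, t]%classic < +oo)%E.
  by rewrite lebesgue_measure_itv/=; case: ifP => // _; rewrite ltry.
have mw (D : set R) : measurable_fun D (fun s => B * window kappa eta theta t s).
  by apply: measurable_funM; [exact: measurable_cst|exact: measurable_window].
have mk (D : set R) : measurable_fun D (fun s => b * k t s).
  by apply: measurable_funM; [exact: measurable_cst|exact: measurable_kernel].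
have integ : `|I1 - I2| <=
    B * (eta `^ kappa / kappa + theta * (T `^ kappa / kappa)) + b * (T `^ kappa / kappa).
  rewrite -lee_fin; apply: (@le_trans _ _
    (\int[mu]_(s in `[0%R, t]) (B * window kappa eta theta t s + b * k t s)%:E)%E).
    have mG : measurable_fun `[0, t] (fun s => B * window kappa eta theta t s + b * k t s).
      by apply: measurable_funD; [exact: mw|exact: mk].
    apply: (bochner_integral_le _ _ hI1 hI2 mG) => //.
    move=> s; rewrite /= in_itv/= => /andP[s0 st'].
    have sT : s \in `[0, T] by rewrite in_itv/= s0 (le_trans st').
    rewrite -scalerBr normrZ ger0_norm ?kernel_ge0//.
    apply: (@le_trans _ _ (k t s * (L * (C * (w t * (\1_(`[t - eta, t]%classic) s + theta))) + b))).
      rewrite ler_wpM2l ?kernel_ge0// (le_trans (hh s sT))// lerD2r.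
      by rewrite ler_wpM2l// ler_wpM2l// wwin.
    by rewrite /window /B le_eqVlt; apply/orP; left; apply/eqP; ring.
  under eq_integral do rewrite EFinD.
  rewrite ge0_integralD//; last first.
  - by apply/measurable_EFinP; exact: mk.
  - by move=> s _; rewrite lee_fin mulr_ge0 ?kernel_ge0.
  - by apply/measurable_EFinP; exact: mw.
  - by move=> s _; rewrite lee_fin mulr_ge0 ?window_ge0.
  rewrite EFinD leeD//.
    by apply: integral_window_le => //; rewrite t0.
  under eq_integral do rewrite EFinM.
  rewrite ge0_integralZl_EFin//; last first.
  - by apply/measurable_EFinP; exact: measurable_kernel.
  - by move=> s _; rewrite lee_fin kernel_ge0.
  rewrite EFinM lee_wpmul2l ?lee_fin//.
  apply: (le_trans (integral_kernel_le kappa_gt0 t0)); rewrite lee_fin subr0.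
  rewrite ler_pM2r ?invr_gt0//; apply: ge0_ler_powR; rewrite ?nnegrE ?(ltW kappa_gt0)//.
  exact: ltW.
rewrite (le_trans (ler_normD _ _))// normrZ.
have : `|c| * `|I1 - I2| <= `|c| *
    (B * (eta `^ kappa / kappa + theta * (T `^ kappa / kappa)) + b * (T `^ kappa / kappa)).
  by rewrite ler_wpM2l.
set Q := _ + theta * _ in small *; set r := T `^ kappa / kappa.
have : (`|c| * L * Q) * (C * w t) <= 1 / 4 * (C * w t).
  by rewrite ler_wpM2r// mulr_ge0.
have -> : `|c| * L * Q * (C * w t) = `|c| * (B * Q) by rewrite /B; ring.
have -> : `|c| * (B * Q + b * r) = `|c| * (B * Q) + `|c| * r * b by ring.
by lra.
Qed.

(** Picard iteration in the weighted supremum distance. The iterates converge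
    uniformly, so their limit again has one-sided limits at the impulses. *)
Lemma mild_fixed_point (H : (R -> X) -> R -> X) (L : R) : separable_space X -> 0 <= L ->
  (forall z, IC z -> IC (H z)) ->
  (forall z1 z2 s, s \in `[0, T] -> `|H z1 s - H z2 s| <= L * `|z1 s - z2 s|) ->
  exists2 z, IC z & step (H z) z z.
Proof.
move=> sepX L0 HIC Hlip.
have a0 : 0 <= `|c| * L by rewrite mulr_ge0.
have [w [eta [theta [eta0 th0 small [w1 wmono wwin wjump]]]]] :=
  @exists_weight R T m tau kappa kappa_gt0 d _ a0 d_ge0.
have wT s : s \in `[0, T] -> 1 <= w s <= w T.
  by rewrite in_itv/= => /andP[s0 sT]; rewrite w1// wmono.
have w0 s : s \in `[0, T] -> 0 <= w s by move=> /wT/andP[/(le_trans ler01)].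
have wT0 : 0 <= w T by apply: w0; rewrite in_itv/= lexx ltW.
have contr h1 h2 z1' z2' C : 0 <= C -> step (H h1) h1 z1' -> step (H h2) h2 z2' ->
    (forall s, s \in `[0, T] -> `|h1 s - h2 s| <= C * w s) ->
    forall s, s \in `[0, T] -> `|z1' s - z2' s| <= C / 2 * w s.
  move=> C0 s1 s2 hC s sT.
  have := @mild_difference (H h1) (H h2) h1 h2 z1' z2' w eta theta L C 0 eta0 th0
    L0 C0 (lexx _) small w1 wwin wjump s1 s2 hC _ s sT.
  rewrite mulr0 addr0; apply => r rT; rewrite addr0.
  by apply: (le_trans (Hlip _ _ _ rT)); rewrite ler_wpM2l// hC.
have ic0 : IC (fun=> 0 : X).
  by apply: (continuous_impulse_continuous htau); apply: continuous_subspaceT => t; exact: cvg_cst.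
pose U := {z : R -> X | IC z}.
have nxtP (z : U) : exists z' : U, step (H (sval z)) (sval z) (sval z').
  have [z' icz' hz'] := mild_exists htau kappa_gt0 kappa_lt1 z0 c Theta (sval z) sepX
    (HIC _ (svalP z)).
  by exists (exist _ z' icz').
have [nxt nxtE] := choice nxtP.
pose zn n := sval (iter n nxt (exist _ (fun=> 0 : X) ic0)).
have icn n : IC (zn n) by exact: svalP.
have stepn n : step (H (zn n)) (zn n) (zn n.+1) by exact: nxtE.
have [M0 M00 hM0] := impulse_continuous_bounded (icn 0).
have [M1 M10 hM1] := impulse_continuous_bounded (icn 1).
pose C := M1 + M0.
have C0 : 0 <= C by rewrite addr_ge0.
have dist1 n s : s \in `[0, T] -> `|zn n.+1 s - zn n s| <= C / 2 ^+ n * w s.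
  elim: n s => [|n ih] s sT.
    rewrite expr0 divr1 (le_trans (ler_normB _ _))//.
    apply: (@le_trans _ _ C); first by rewrite lerD ?hM0 ?hM1.
    by rewrite ler_peMr//; have /andP[] := wT s sT.
  rewrite exprSr invfM mulrA; apply: contr ih _ sT => //.
  by rewrite divr_ge0// exprn_ge0.
have distk n p s : s \in `[0, T] ->
    `|zn n s - zn (n + p)%N s| <= (2 * C / 2 ^+ n - 2 * C / 2 ^+ (n + p)) * w s.
  move=> sT; elim: p => [|p ih]; first by rewrite addn0 !subrr normr0 mul0r.
  have -> : zn n s - zn (n + p.+1)%N s =
      (zn n s - zn (n + p)%N s) + (zn (n + p)%N s - zn (n + p).+1 s).
    by rewrite addrA subrK addnS.
  rewrite (le_trans (ler_normD _ _))//.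
  have := dist1 (n + p)%N s sT; rewrite distrC => h.
  have -> : 2 * C / 2 ^+ (n + p.+1) = C / 2 ^+ (n + p).
    by rewrite addnS exprS -mulf_div divff ?mul1r// pnatr_eq0.
  by apply: le_trans (lerD ih h) _; lra.
pose e n := 2 * C / 2 ^+ n * w T.
have e_cvg : e n @[n --> \oo] --> 0.
  have -> : e = geometric (2 * C * w T) 2^-1.
    by apply/funext => n; rewrite /e /geometric/= exprVn mulrAC.
  by apply: cvg_geometric; rewrite ger0_norm// invf_lt1// ltr1n.
have distk' n p s : s \in `[0, T] -> `|zn n s - zn (n + p)%N s| <= e n.
  move=> sT; apply: (le_trans (distk n p s sT)); rewrite /e.
  have /andP[_ ws] := wT s sT.
  have q0 q : 0 <= 2 * C / 2 ^+ q by rewrite divr_ge0 ?exprn_ge0// mulr_ge0.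
  apply: (@le_trans _ _ (2 * C / 2 ^+ n * w s)); last by rewrite ler_wpM2l.
  by rewrite ler_wpM2r ?w0// gerBl.
have zcvg s : s \in `[0, T] -> cvg (zn n s @[n --> \oo]).
  move=> sT; apply/cauchy_cvgP/cauchy_exP => eps eps0.
  have [n _ hn] := cvgr_lt 0 e_cvg _ eps0.
  exists (zn n s); exists n => // p /= np; rewrite -ball_normE/=.
  have -> : p = (n + (p - n))%N by rewrite subnKC.
  by apply: le_lt_trans (distk' n _ s sT) (hn n (leqnn n)).
pose z s := lim (zn n s @[n --> \oo]).
have dz n s : s \in `[0, T] -> `|zn n s - z s| <= e n.
  move=> sT; have h : `|zn n s - zn p s| @[p --> \oo] --> `|zn n s - z s|.
    by apply: cvg_norm; apply: cvgB; [exact: cvg_cst|exact: zcvg].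
  rewrite -(cvg_lim _ h)//; apply: limr_le; first by apply/cvg_ex; eexists; exact: h.
  exists n => // p /= np.
  have -> : p = (n + (p - n))%N by rewrite subnKC.
  exact: distk'.
have icz : IC z := impulse_continuous_uniform_limit htau icn e_cvg dz.
have [z' icz' hz'] := mild_exists htau kappa_gt0 kappa_lt1 z0 c Theta z sepX (HIC _ icz).
have zz' s : s \in `[0, T] -> z' s = z s.
  move=> sT; apply/eqP; rewrite -subr_eq0 -normr_le0; apply/ler_addgt0Pr => eps eps0.
  have eps2 : 0 < eps / (2 * (w T + 1)) by rewrite divr_gt0// mulr_gt0// ltr_wpDl.
  have [n _ hn] := cvgr_lt 0 e_cvg _ eps2.
  have e0 q : 0 <= e q by rewrite /e mulr_ge0// divr_ge0 ?exprn_ge0// mulr_ge0.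
  have h1 : `|z' s - zn n.+1 s| <= e n / 2 * w s.
    apply: (contr z (zn n) z' (zn n.+1) (e n) (e0 n) hz' (stepn n)) => // r rT.
    rewrite distrC; apply: (le_trans (dz n r rT)); rewrite ler_peMr//.
    by have /andP[] := wT r rT.
  have h2 := dz n.+1 s sT.
  have -> : z' s - z s = (z' s - zn n.+1 s) + (zn n.+1 s - z s) by rewrite addrA subrK.
  rewrite (le_trans (ler_normD _ _))// add0r.
  have h3 := hn n (leqnn n); have h4 := hn n.+1 (leqnSn n).
  have /andP[ws1 wsT] := wT s sT.
  have h5 : e n / 2 * w s <= e n / 2 * w T by rewrite ler_wpM2l// divr_ge0.
  rewrite ltr_pdivlMr ?mulr_gt0 ?ltr_wpDl// in h3.
  rewrite ltr_pdivlMr ?mulr_gt0 ?ltr_wpDl// in h4.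
  have h6 : 0 <= e n.+1 * w T by rewrite mulr_ge0.
  have h7 := e0 n.+1; have h8 := e0 n.
  by lra.
exists z => // t tT; have [I hI zI] := hz' t tT.
by exists I => //; rewrite -(zz' t tT).
Qed.

(** Each application of [mild_difference] halves the weighted distance, finite
    at first because both functions are bounded; in the limit only the
    contribution of [b] remains. *)
Lemma mild_stability (L : R) : 0 <= L -> exists2 K, 0 <= K &
  forall (h1 h2 z1 z2 : R -> X) (b : R), 0 <= b -> IC z1 -> IC z2 ->
    step h1 z1 z1 -> step h2 z2 z2 ->
    (forall s, s \in `[0, T] -> `|h1 s - h2 s| <= L * `|z1 s - z2 s| + b) ->
    forall t, t \in `[0, T] -> `|z1 t - z2 t| <= K * b.
Proof.
move=> L0; have a0 : 0 <= `|c| * L by rewrite mulr_ge0.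
have [w [eta [theta [eta0 th0 small [w1 wmono wwin wjump]]]]] :=
  @exists_weight R T m tau kappa kappa_gt0 d _ a0 d_ge0.
have wT s : s \in `[0, T] -> 1 <= w s <= w T.
  by rewrite in_itv/= => /andP[s0 sT]; rewrite w1// wmono.
have wT1 : 1 <= w T by apply: w1; exact: ltW.
have wT0 : 0 <= w T by exact: le_trans wT1.
pose K0 := `|c| * (T `^ kappa / kappa).
have K00 : 0 <= K0 by rewrite mulr_ge0// divr_ge0 ?powR_ge0// ltW.
have K20 : 0 <= 2 * K0 by apply: mulr_ge0.
exists (2 * K0 * w T); first by apply: mulr_ge0.
move=> h1 h2 z1 z2 b b0 ic1 ic2 s1 s2 hh t tT.
have [M1 M10 hM1] := impulse_continuous_bounded ic1.
have [M2 M20 hM2] := impulse_continuous_bounded ic2.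
have Kb0 : 0 <= 2 * K0 * b by apply: mulr_ge0.
have iter n s : s \in `[0, T] ->
    `|z1 s - z2 s| <= ((M1 + M2) / 2 ^+ n + 2 * K0 * b) * w s.
  elim: n s => [|n ih] s sT; have /andP[ws1 _] := wT s sT; have ws0 := le_trans ler01 ws1.
    rewrite expr0 divr1 (le_trans (ler_normB _ _))//.
    apply: (@le_trans _ _ (M1 + M2 + 2 * K0 * b)).
      by have := hM1 s sT; have := hM2 s sT; lra.
    by rewrite ler_peMr//; lra.
  set C := (M1 + M2) / 2 ^+ n + 2 * K0 * b in ih.
  have C0 : 0 <= C by rewrite addr_ge0// divr_ge0 ?addr_ge0// exprn_ge0.
  have hC : `|z1 s - z2 s| <= C / 2 * w s + K0 * b.
    apply: (@mild_difference h1 h2 z1 z2 z1 z2 w eta theta L C b eta0 th0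
      L0 C0 b0 small w1 wwin wjump s1 s2 ih _ s sT) => r rT.
    by apply: (le_trans (hh r rT)); rewrite lerD2r ler_wpM2l// ih.
  apply: (le_trans hC).
  have -> : (M1 + M2) / 2 ^+ n.+1 = (M1 + M2) / 2 ^+ n / 2 by rewrite exprSr invfM mulrA.
  have : K0 * b <= K0 * b * w s by rewrite ler_peMr//; apply: mulr_ge0.
  by rewrite /C; lra.
have /andP[wt1 wtT] := wT t tT; have wt0 := le_trans ler01 wt1.
apply: (@le_trans _ _ (2 * K0 * b * w t)).
  apply: (@le_of_halving _ _ ((M1 + M2) * w t)); first by rewrite mulr_ge0// addr_ge0.
  by move=> n; have := iter n t tT; rewrite mulrDl mulrAC.
by rewrite [leRHS]mulrAC ler_wpM2l.
Qed.

End mild_solutions.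

(** * Solutions and the integral equation *)

Lemma bochner_integral0 d (S : measurableType d) {R : realType} (X : normedModType R)
    (mu : {measure set S -> \bar R}) (D : set S) (u : S -> X) :
  (forall x, D x -> u x = 0) -> is_bochner_integral mu D u 0.
Proof.
move=> u0; exists (fun _ _ => 0).
have simple0 : simple_vfun mu D (fun _ => 0 : X).
  split; first by apply: sub_finite_set (finite_set1 0) => _ [x _ <-].
    move=> v; have [->|v0] := eqVneq v 0.
      by rewrite (_ : _ @^-1` _ = setT)//; apply/seteqP; split.
    rewrite (_ : _ @^-1` _ = set0)//; apply/seteqP; split => // x /= h.
    by move: v0; rewrite -h eqxx.
  move=> v v0; rewrite (_ : _ @^-1` _ = set0) ?setI0 ?measure0//.
  by apply/seteqP; split => // x /= h; move: v0; rewrite -h eqxx.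
split => //.
- by apply: aeW => x /u0->; exact: cvg_cst.
- move=> _; apply: (@eq_measurable_fun _ _ _ _ D (fun=> 0 : R)); last exact: measurable_cst.
  by move=> x /set_mem/u0->; rewrite subr0 normr0.
- rewrite (_ : (fun _ => _) = fun=> 0%E); first exact: cvg_cst.
  apply/funext => _; rewrite (eq_integral (fun=> 0%E)) ?integral0//.
  by move=> x /set_mem/u0->; rewrite subr0 normr0.
- rewrite (_ : (fun _ => _) = fun=> 0); first exact: cvg_cst.
  apply/funext => _; rewrite /simple_vintegral; apply: fsbig1 => v [x _ <-].
  by rewrite scaler0.
Qed.

Section solutions_are_mild.
Context {R : realType} (X : completeNormedModType R).
Variables (T : R) (m : nat) (tau : nat -> R) (kappa : R).
Hypothesis htau : impulse_times T m tau.
Hypotheses (kappa_lt1 : kappa < 1).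
Variables (z0 : X) (c : R) (Theta : nat -> X -> X).

Local Notation mu := (@lebesgue_measure R).
Local Notation IC := (impulse_continuous T m tau).
Local Notation step := (mild_step T m tau kappa z0 c Theta).

Definition piecewise_equation (h z : R -> X) := forall j t, (j <= m)%N ->
  tau j < t <= tau j.+1 ->
  exists2 I : X, is_bochner_integral mu `[0, t]
      (fun s => (t - s) `^ (kappa - 1) *: h s) I &
    z t = z0 + \sum_(1 <= i < j.+1) Theta i (lim (z s @[s --> (tau i)^'-])) + c *: I.

Lemma past_impulses (v : nat -> X) j t : (j <= m)%N -> tau j < t <= tau j.+1 ->
  \sum_(1 <= i < m.+1 | tau i < t) v i = \sum_(1 <= i < j.+1) v i.
Proof.
move=> jm /andP[jt tj]; rewrite [RHS](big_nat_widen 1 j.+1 m.+1)//.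
rewrite [LHS]big_nat_cond [RHS]big_nat_cond; apply: eq_bigl => i.
apply: andb_id2l => /andP[i1 im]; rewrite ltnS; apply/idP/idP => [it|ij].
  have := lt_le_trans it tj; rewrite (tau_lt_iff htau) ?ltnS//.
  exact: ltnW.
by apply: le_lt_trans jt; apply: (tau_le htau) => //; exact: leqW.
Qed.

Lemma piece_of t : 0 < t -> t <= T -> exists2 j, (j <= m)%N & tau j < t <= tau j.+1.
Proof.
case: htau => t00 tT _ t0 tT'.
have : forall n, (n <= m.+1)%N -> t <= tau n -> exists2 j, (j < n)%N & tau j < t <= tau j.+1.
  elim=> [|n ih] nm tn; first by move: t0; rewrite ltNge -t00 tn.
  have [tn'|nt] := leP t (tau n); last by exists n => //; rewrite nt.
  by have [j jn hj] := ih (ltnW nm) tn'; exists j => //; exact: ltnW.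
move=> /(_ m.+1 (leqnn _)); rewrite tT => /(_ tT')[j jm hj]; by exists j.
Qed.

Lemma kernel0 (h : R -> X) s : `[0, 0]%classic s -> kernel kappa 0 s *: h s = 0.
Proof.
rewrite /= in_itv/= => s0; have -> : s = 0 by apply/eqP; rewrite eq_le andbC.
by rewrite /kernel subrr powR0 ?scale0r// subr_eq0 lt_eqF.
Qed.

Lemma no_past_impulse (v : nat -> X) : \sum_(1 <= i < m.+1 | tau i < 0) v i = 0.
Proof.
rewrite big_nat_cond big_pred0// => i; apply/negP => /andP[/andP[i1 im]].
have /andP[ti _] : 0 < tau i < T by apply: (tau_itv htau); rewrite i1.
by rewrite ltNge (ltW ti).
Qed.

Lemma left_limit (z : R -> X) i : IC z -> (1 <= i <= m)%N ->
  lim (z s @[s --> (tau i)^'-]) = z (tau i).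
Proof.
move=> /impulse_continuousP[_ h _] im; apply: cvg_lim; last exact: h.
exact: norm_hausdorff.
Qed.

Lemma past_impulses_lim (z : R -> X) j : IC z -> (j <= m)%N ->
  \sum_(1 <= i < j.+1) Theta i (lim (z s @[s --> (tau i)^'-])) =
  \sum_(1 <= i < j.+1) Theta i (z (tau i)).
Proof.
move=> icz jm; rewrite big_nat_cond [RHS]big_nat_cond.
apply: eq_bigr => i /andP[/andP[i1 ij] _]; rewrite left_limit// i1/=.
by rewrite ltnS in ij; exact: leq_trans ij jm.
Qed.

Lemma piecewise_equation_mild h z : IC z -> z 0 = z0 -> piecewise_equation h z -> step h z z.
Proof.
move=> icz z00 eqz t; rewrite in_itv/= => /andP[]; rewrite le_eqVlt => /predU1P[<- _|t0 tT].
  exists 0; first by apply: bochner_integral0 => s; exact: kernel0.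
  by rewrite no_past_impulse scaler0 !addr0.
have [j jm jt] := piece_of t0 tT; have [I hI ->] := eqz j t jm jt.
by exists I => //; rewrite past_impulses_lim// (past_impulses _ jm jt).
Qed.

Lemma mild_piecewise_equation h z : IC z -> step h z z -> z 0 = z0 /\ piecewise_equation h z.
Proof.
move=> icz hz; split.
  have T0 : 0 <= T by apply/ltW/(T_gt0_of_impulses htau).
  have [|I hI ->] := hz 0; first by rewrite in_itv/= lexx.
  have fin : (mu `[0%R, 0%R]%classic < +oo)%E.
    by rewrite lebesgue_measure_itv/=; case: ifP => // _; rewrite ltry.
  have hI0 : is_bochner_integral mu `[0, 0] (fun s => kernel kappa 0 s *: h s) 0.
    by apply: bochner_integral0 => s; exact: kernel0.
  have -> : I = 0 by apply: bochner_integral_unique hI hI0.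
  by rewrite no_past_impulse scaler0 !addr0.
move=> j t jm jt; have [|I hI ->] := hz t.
  case: htau => t00 tT _; case/andP: jt => jt tj; rewrite in_itv/=.
  rewrite -{1}t00 -tT (le_trans tj) ?andbT; last exact: (tau_le htau).
  by apply: ltW; apply: le_lt_trans jt; apply: (tau_le htau) => //; exact: leqW.
by exists I => //; rewrite past_impulses_lim// (past_impulses _ jm jt).
Qed.

End solutions_are_mild.

(** * The coupled problem *)

Section coupled_problem.
Context {R : realType} {Y Z1 Z2 : completeNormedModType R}.
Variables (T : R) (m : nat) (tau : nat -> R) (kappa : R).
Hypothesis htau : impulse_times T m tau.
Hypotheses (kappa_gt0 : 0 < kappa) (kappa_lt1 : kappa < 1).
Hypotheses (reflZ2 : reflexive_space Z2) (sepZ1 : separable_space Z1).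
Variables (z0 : Z1) (f : R -> Z1 -> Z2 -> Z1) (Theta : nat -> Z1 -> Z1) (d : nat -> R).
Variables (Aop : R -> Z2 -> dual Z2) (N : bop Z2 Y) (g : R -> Z1 -> dual Z2).
Variables (M1 mg mA : R).
Hypotheses (M1_ge0 : 0 <= M1) (mg_ge0 : 0 <= mg).
Hypothesis f_cont : forall z y, {within `[0, T], continuous (fun t : R => f t z y)}.
Hypothesis f_lip : forall (t : R) z1 z2 y1 y2, t \in `[0, T] ->
  `|f t z1 y1 - f t z2 y2| <= M1 * (`|z1 - z2| + `|y1 - y2|).
Hypothesis d_ge0 : forall j, (1 <= j <= m)%N -> 0 <= d j.
Hypothesis Theta_lip : forall j z1 z2, (1 <= j <= m)%N ->
  `|Theta j z1 - Theta j z2| <= d j * `|z1 - z2|.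
Hypothesis Aop_cont : forall y, {within `[0, T], continuous (fun t : R => Aop t y)}.
Hypothesis Aop_demi : forall t : R, t \in `[0, T] -> demicontinuous (Aop t).
Hypothesis Aop_mono : forall t : R, t \in `[0, T] -> strongly_monotone (Aop t) mA.
Hypothesis N_compact : compact_operator N.
Hypothesis N_surj : forall x : Y, exists v : Z2, N v = x.
Hypothesis g_cont : forall z, {within `[0, T], continuous (fun t : R => g t z)}.
Hypothesis g_lip : forall (t : R) z1 z2, t \in `[0, T] ->
  `|g t z1 - g t z2| <= mg * `|z1 - z2|.

Local Notation IC := (impulse_continuous T m tau).
Local Notation step := (mild_step T m tau kappa z0 (Gamma kappa)^-1 Theta).
Local Notation solution J := (is_solution kappa T m tau z0 f Theta Aop N J g).

Lemma within_cvg (W : normedModType R) (x : R -> W) (F : set_system R) t0 :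
  Filter F -> {within `[0, T], continuous x} -> t0 \in `[0, T] -> F --> t0 ->
  F `[0, T]%classic -> x @ F --> x t0.
Proof.
move=> FF /subspace_continuousP cx t0T Ft0 FT B /(cx t0 t0T) h.
by apply: filterS2 FT (Ft0 _ h) => s sT; apply.
Qed.

Lemma is_solutionP J z y : solution J z y <->
  [/\ IC z, IC y, step (fun s => f s (z s) (y s)) z z &
    forall t : R, t \in `[0, T] -> solves_inclusion N (Aop t) (J t) (g t (z t)) (y t)].
Proof.
split=> [[icz icy z00 eqz inc]|[icz icy hz inc]].
  by split => //; apply: piecewise_equation_mild.
by have [z00 eqz] := mild_piecewise_equation htau kappa_lt1 icz hz; split.
Qed.

Section one_potential.
Variables (J : R -> Y -> R) (mJ cJ : R).
Hypotheses (mJ_ge0 : 0 <= mJ) (cJ_ge0 : 0 <= cJ).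
Hypothesis hJ : hemivariational_potential T J mJ cJ.
Hypothesis gap : cJ * `|N| ^+ 2 < mA.

Let mu := mA - cJ * `|N| ^+ 2.

Let mu_gt0 : 0 < mu. Proof. by rewrite subr_gt0. Qed.

Lemma potential_at t : t \in `[0, T] ->
  [/\ locally_lipschitz (J t), gradient_growth mJ (J t) & relaxed_monotone (J t) cJ].
Proof.
case: hJ => _ h2 h3 h4 tT; split; first exact: h2.
  by move=> u th; exact: h3.
by move=> y1 y2 th1 th2; exact: h4.
Qed.

(** The response [y] of the inclusion to the state [z], compared with any
    approximate response whose residual lies within [b] of the inclusion. *)
Lemma response_stability t v1 v2 y1 y2 zeta zeta' b : t \in `[0, T] ->
  Aop t y1 + zeta = g t v1 ->
  (adjoint N @` clarke_gradient (J t) (N y1)) zeta' -> `|zeta - zeta'| <= b ->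
  solves_inclusion N (Aop t) (J t) (g t v2) y2 ->
  `|y1 - y2| <= mg / mu * `|v1 - v2| + b / mu.
Proof.
move=> tT e1 hz' hb s2; have [_ _ moni] := potential_at tT.
have := inclusion_stability (Aop_mono tT) cJ_ge0 moni e1 hz' s2; rewrite -/mu => h.
have -> : mg / mu * `|v1 - v2| + b / mu = (mg * `|v1 - v2| + b) / mu by ring.
rewrite ler_pdivlMr// mulrC (le_trans h)// lerD//; exact: g_lip.
Qed.

Lemma response_lipschitz t v1 v2 y1 y2 : t \in `[0, T] ->
  solves_inclusion N (Aop t) (J t) (g t v1) y1 ->
  solves_inclusion N (Aop t) (J t) (g t v2) y2 ->
  `|y1 - y2| <= mg / mu * `|v1 - v2|.
Proof.
move=> tT [zeta hz e1] s2.
have := @response_stability t v1 v2 y1 y2 zeta zeta 0 tT e1 hz _ s2.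
by rewrite subrr normr0 mul0r addr0; apply.
Qed.

Lemma exists_response : exists S : R -> dual Z2 -> Z2, forall t w, t \in `[0, T] ->
  solves_inclusion N (Aop t) (J t) w (S t w).
Proof.
have h (p : R * dual Z2) : exists y, p.1 \in `[0, T] ->
    solves_inclusion N (Aop p.1) (J p.1) p.2 y.
  have [tT|tT] := pselect (p.1 \in `[0, T]); last by exists 0.
  have [lipi _ moni] := potential_at tT.
  have [y hy] := inclusion_solvable (Aop_mono tT) reflZ2 (Aop_demi tT) N_surj p.2
    cJ_ge0 lipi moni gap.
  by exists y.
have [S SP] := choice h.
by exists (fun t w => S (t, w)) => t w; exact: (SP (t, w)).
Qed.

Lemma data_cvg (F : set_system R) t0 v0 z : Filter F -> t0 \in `[0, T] -> F --> t0 ->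
  F `[0, T]%classic -> z @ F --> v0 -> g s (z s) @[s --> F] --> g t0 v0.
Proof.
move=> FF t0T Ft0 FT zv.
have h0 := within_cvg FF (@g_cont v0) t0T Ft0 FT.
rewrite -[X in _ --> X]add0r.
have -> : (fun s => g s (z s)) = (fun s => (g s (z s) - g s v0) + g s v0).
  by apply/funext => s; rewrite subrK.
apply: cvgD; last exact: h0.
apply/cvgrPdist_le => e e0; have e1 : 0 < e / (mg + 1) by rewrite divr_gt0// ltr_wpDl.
move/cvgrPdist_le : zv => /(_ _ e1); apply: filterS2 FT => s sT hs.
rewrite sub0r normrN (le_trans (g_lip _ _ sT))//.
rewrite distrC in hs; rewrite ler_pdivlMr ?ltr_wpDl// in hs.
by apply: le_trans hs; rewrite mulrC ler_wpM2l// lerDl.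
Qed.

Lemma response_cvg (S : R -> dual Z2 -> Z2) (F : set_system R) t0 v0 z :
  (forall t w, t \in `[0, T] -> solves_inclusion N (Aop t) (J t) w (S t w)) ->
  Filter F -> t0 \in `[0, T] -> F --> t0 ->
  F `[0, T]%classic -> z @ F --> v0 ->
  S s (g s (z s)) @[s --> F] --> S t0 (g t0 v0).
Proof.
move=> hS FF t0T Ft0 FT zv.
apply: (@inclusion_cvg R Z2 Y N mA mJ cJ cJ_ge0 gap N_compact R F FF `[0, T]%classic
  Aop J (fun s => g s (z s)) (fun s => S s (g s (z s))) (Aop t0) (J t0) (g t0 v0)) => //.
- by move=> i iT; exact: potential_at.
- exact: potential_at.
- by move=> i iT; exact: hS.
- exact: hS.
- exact: (within_cvg FF (@Aop_cont _) t0T Ft0 FT).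
- move=> u; case: hJ => cJt _ _ _; exact: (within_cvg FF (cJt u) t0T Ft0 FT).
- exact: data_cvg.
Qed.

Lemma forcing_cvg (F : set_system R) t0 v0 y0 z y : Filter F -> t0 \in `[0, T] ->
  F --> t0 -> F `[0, T]%classic -> z @ F --> v0 -> y @ F --> y0 ->
  f s (z s) (y s) @[s --> F] --> f t0 v0 y0.
Proof.
move=> FF t0T Ft0 FT zv yy.
have h0 := within_cvg FF (@f_cont v0 y0) t0T Ft0 FT.
rewrite -[X in _ --> X]add0r.
have -> : (fun s => f s (z s) (y s)) = (fun s => (f s (z s) (y s) - f s v0 y0) + f s v0 y0).
  by apply/funext => s; rewrite subrK.
apply: cvgD; last exact: h0.
apply/cvgrPdist_le => e e0.
have e1 : 0 < e / (2 * (M1 + 1)) by rewrite divr_gt0// mulr_gt0// ltr_wpDl.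
move/cvgrPdist_le : zv => /(_ _ e1) zv; move/cvgrPdist_le : yy => /(_ _ e1) yy.
near=> s.
have sT : s \in `[0, T] by near: s.
rewrite sub0r normrN (le_trans (f_lip _ _ _ _ sT))//.
have : `|z s - v0| <= e / (2 * (M1 + 1)) by rewrite distrC; near: s.
have : `|y s - y0| <= e / (2 * (M1 + 1)) by rewrite distrC; near: s.
rewrite !ler_pdivlMr ?mulr_gt0 ?ltr_wpDl// => h1 h2.
have := normr_ge0 (z s - v0); have := normr_ge0 (y s - y0); nra.
Unshelve. all: by end_near. Qed.

(** Substituting the response [S s (g s v)] for [y] leaves an integral equation
    for [z] alone, with a Lipschitz forcing. *)
Lemma solution_exists : exists z y, solution J z y.
Proof.
have [S hS] := exists_response.
pose resp s v := S s (g s v).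
pose H (z : R -> Z1) s := f s (z s) (resp s (z s)).
have L0 : 0 <= M1 * (1 + mg / mu) by rewrite mulr_ge0// addr_ge0// divr_ge0// ltW.
have Hlip z1 z2 s : s \in `[0, T] -> `|H z1 s - H z2 s| <= M1 * (1 + mg / mu) * `|z1 s - z2 s|.
  move=> sT; rewrite (le_trans (f_lip _ _ _ _ sT))// -mulrA ler_wpM2l// mulrDl mul1r.
  by rewrite lerD2l; exact: (response_lipschitz sT (hS _ _ sT) (hS _ _ sT)).
have ic_resp z : IC z -> IC (fun s => resp s (z s)).
  apply: (impulse_continuous_comp htau) => F t0 v0 FF t0T Ft0 FT zv.
  exact: response_cvg.
have HIC z : IC z -> IC (H z).
  apply: (impulse_continuous_comp htau (Phi := fun s v => f s v (resp s v)))
    => F t0 v0 FF t0T Ft0 FT zv.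
  by apply: forcing_cvg => //; exact: response_cvg.
have [z icz hz] := mild_fixed_point htau kappa_gt0 kappa_lt1 z0 (Gamma kappa)^-1
  d_ge0 Theta_lip sepZ1 L0 HIC Hlip.
exists z, (fun s => resp s (z s)); apply/is_solutionP; split => //; first exact: ic_resp.
by move=> t tT; exact: hS.
Qed.

Lemma solution_stability : exists2 K, 0 <= K &
  forall (J' : R -> Y -> R) z y z' y' b, 0 <= b ->
    solution J z y -> solution J' z' y' ->
    (forall t, t \in `[0, T] -> `|y' t - y t| <= mg / mu * `|z' t - z t| + b / mu) ->
    forall t, t \in `[0, T] -> `|z' t - z t| <= K * b /\ `|y' t - y t| <= K * b.
Proof.
have q0 : 0 <= mg / mu by rewrite divr_ge0// ltW.
have L0 : 0 <= M1 * (1 + mg / mu) by rewrite mulr_ge0// addr_ge0.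
have [K K0 hK] := mild_stability htau kappa_gt0 z0 (Gamma kappa)^-1 d_ge0 Theta_lip L0.
have imu0 : 0 <= mu^-1 by rewrite invr_ge0 ltW.
have KM0 : 0 <= K * (M1 / mu) by rewrite !mulr_ge0.
exists (K * (M1 / mu) + (mg / mu * (K * (M1 / mu)) + mu^-1)).
  by rewrite !addr_ge0// mulr_ge0.
move=> J' z y z' y' b b0 /is_solutionP[icz icy hz inc] /is_solutionP[icz' icy' hz' inc'] hy.
have hh s : s \in `[0, T] -> `|f s (z' s) (y' s) - f s (z s) (y s)| <=
    M1 * (1 + mg / mu) * `|z' s - z s| + M1 / mu * b.
  move=> sT; rewrite (le_trans (f_lip _ _ _ _ sT))//.
  have -> : M1 * (1 + mg / mu) * `|z' s - z s| + M1 / mu * b =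
    M1 * (`|z' s - z s| + (mg / mu * `|z' s - z s| + b / mu)) by ring.
  by rewrite ler_wpM2l// lerD2l hy.
have b'0 : 0 <= M1 / mu * b by rewrite !mulr_ge0.
move=> t tT; have hz2 := hK _ _ _ _ _ b'0 icz' icz hz' hz hh t tT.
have rest : 0 <= mg / mu * (K * (M1 / mu)) + mu^-1 by rewrite addr_ge0// mulr_ge0.
split.
  rewrite (le_trans hz2)// mulrA [K * _ * b]mulrC mulrDl [leLHS]mulrC lerDl.
  by rewrite mulr_ge0.
rewrite (le_trans (hy t tT))//.
have : mg / mu * `|z' t - z t| <= mg / mu * (K * (M1 / mu * b)) by rewrite ler_wpM2l.
have : 0 <= K * (M1 / mu) * b by rewrite mulr_ge0.
have -> : (K * (M1 / mu) + (mg / mu * (K * (M1 / mu)) + mu^-1)) * b =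
  K * (M1 / mu) * b + (mg / mu * (K * (M1 / mu * b)) + b / mu) by ring.
by lra.
Qed.

Lemma unique_solution_exists : exists z y, is_unique_solution T (solution J) z y.
Proof.
have [z [y sol]] := solution_exists; have [K K0 hK] := solution_stability.
exists z, y; split => // z' y' sol' t tT.
have [|hz hy] := hK J z y z' y' 0 (lexx _) sol sol' _ t tT.
  move=> s sT; rewrite mul0r addr0.
  have /is_solutionP[_ _ _ inc] := sol; have /is_solutionP[_ _ _ inc'] := sol'.
  exact: response_lipschitz sT (inc' s sT) (inc s sT).
rewrite mulr0 in hz hy.
by split; apply/eqP; rewrite -subr_eq0 -normr_le0.
Qed.

(** The response to the other potential is an approximate response for [J], with
    residual at most [b]. The monotonicity of [J] alone is used, so that [K] does
    not depend on [J']. *)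
Lemma perturbed_solution_stability : exists2 K, 0 <= K &
  forall (J' : R -> Y -> R) z y z' y' b, 0 <= b ->
    (forall (t : R) u zeta zeta', t \in `[0, T] ->
      (adjoint N @` clarke_gradient (J t) (N u)) zeta ->
      (adjoint N @` clarke_gradient (J' t) (N u)) zeta' -> `|zeta - zeta'| <= b) ->
    solution J z y -> solution J' z' y' ->
    forall t, t \in `[0, T] -> `|z' t - z t| <= K * b /\ `|y' t - y t| <= K * b.
Proof.
have [K K0 hK] := solution_stability; exists K => // J' z y z' y' b b0 hb sol sol'.
apply: (hK _ _ _ _ _ _ b0 sol sol') => s sT.
have /is_solutionP[_ _ _ inc] := sol; have /is_solutionP[_ _ _ inc'] := sol'.
have [zeta hzeta e] := inc' s sT; have [lipi _ _] := potential_at sT.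
have [th hth _] := clarke_gradient_max lipi (N (y' s)) 0.
have hz0 : (adjoint N @` clarke_gradient (J s) (N (y' s))) (adjoint N th) by exists th.
apply: (response_stability sT e hz0 _ (inc s sT)).
by rewrite distrC; exact: hb sT hz0 hzeta.
Qed.

End one_potential.
End coupled_problem.

(** * Perturbation of the potential *)

Theorem theorem4p1 (R : realType) (Y Z1 Z2 : completeNormedModType R)
  (reflY : reflexive_space Y) (reflZ1 : reflexive_space Z1)
  (reflZ2 : reflexive_space Z2)
  (sepY : separable_space Y) (sepZ1 : separable_space Z1)
  (sepZ2 : separable_space Z2)
  (T : R) (T_gt0 : 0 < T) (m : nat) (tau : nat -> R)
  (htau : impulse_times T m tau) (z0 : Z1)
  (f : R -> Z1 -> Z2 -> Z1) (A : R -> Z2 -> dual Z2) (N : bop Z2 Y)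
  (J : R -> Y -> R) (g : R -> Z1 -> dual Z2) (Theta : nat -> Z1 -> Z1)
  (kappa p : R) (p_gt0 : 0 < p) (p_lt_kappa : p < kappa) (kappa_lt1 : kappa < 1)
  (* Hf *)
  (Hf_cont : forall z y, {within `[0, T], continuous (fun t : R => f t z y)})
  (M1 : R) (M1_gt0 : 0 < M1)
  (Hf_lip : forall (t : R) z1 z2 y1 y2, t \in `[0, T] ->
    `|f t z1 y1 - f t z2 y2| <= M1 * (`|z1 - z2| + `|y1 - y2|))
  (phi : R -> R) (phi_ge0 : forall t : R, t \in `[0, T] -> 0 <= phi t)
  (phi_meas : measurable_fun `[0, T] phi)
  (phi_Lp : (\int[lebesgue_measure]_(t in `[0%R, T])
    (phi t `^ p^-1)%:E < +oo)%E)
  (Hf_bound : forall (t : R) z y, t \in `[0, T] -> `|f t z y| <= phi t)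
  (* HI *)
  (HI_bounded : forall j, (1 <= j <= m)%N -> bounded_map (Theta j))
  (dTheta : nat -> R) (dTheta_gt0 : forall j, (1 <= j <= m)%N -> 0 < dTheta j)
  (HI_lip : forall j z1 z2, (1 <= j <= m)%N ->
    `|Theta j z1 - Theta j z2| <= dTheta j * `|z1 - z2|)
  (* HA *)
  (HA_cont : forall y, {within `[0, T], continuous (fun t : R => A t y)})
  (HA_bounded : forall t : R, t \in `[0, T] -> bounded_map (A t))
  (HA_demicont : forall t : R, t \in `[0, T] -> demicontinuous (A t))
  (mA : R) (mA_gt0 : 0 < mA)
  (HA_mono : forall t : R, t \in `[0, T] -> strongly_monotone (A t) mA)
  (* HN *)
  (HN_compact : compact_operator N)
  (HN_surj : forall x : Y, exists v : Z2, N v = x)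
  (* HJ *)
  (mJ cJ : R) (mJ_gt0 : 0 < mJ) (cJ_gt0 : 0 < cJ)
  (hJ : hemivariational_potential T J mJ cJ)
  (* Hg *)
  (Hg_cont : forall z, {within `[0, T], continuous (fun t : R => g t z)})
  (mg : R) (mg_gt0 : 0 < mg)
  (Hg_lip : forall (t : R) z1 z2, t \in `[0, T] ->
    `|g t z1 - g t z2| <= mg * `|z1 - z2|)
  (* HO *)
  (HO_i : mA > cJ * `|N| ^+ 2)
  (HO_ii : T `^ kappa * M1 * mg
    / (kappa * (mA - cJ * `|N| ^+ 2) * Gamma kappa) < 1)
  (* the perturbed potentials *)
  (Jd : R -> R -> Y -> R) (mJd cJd : R -> R)
  (mJd_gt0 : forall delta, 0 < delta -> 0 < mJd delta)
  (cJd_gt0 : forall delta, 0 < delta -> 0 < cJd delta)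
  (hJd : forall delta, 0 < delta ->
    hemivariational_potential T (Jd delta) (mJd delta) (cJd delta))
  (* HJ* *)
  (V : R -> R) (V_ge0 : forall delta, 0 < delta -> 0 <= V delta)
  (HJs_i : forall (t : R) y delta zeta zetad, t \in `[0, T] -> 0 < delta ->
    (adjoint N @` clarke_gradient (J t) (N y)) zeta ->
    (adjoint N @` clarke_gradient (Jd delta t) (N y)) zetad ->
    `|zeta - zetad| <= V delta)
  (HJs_ii : V delta @[delta --> 0^'+] --> (0 : R))
  (* HO* *)
  (mA0 : R) (mA0_gt0 : 0 < mA0)
  (HOs_i : forall delta, 0 < delta -> mA > mA0 /\ mA0 > cJd delta * `|N| ^+ 2)
  (HOs_ii : forall delta, 0 < delta ->
    T `^ kappa * M1 * mg
      / (kappa * (mA - cJd delta * `|N| ^+ 2) * Gamma kappa) < 1) :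
  let solP := is_solution kappa T m tau z0 f Theta A N J g in
  let solPd delta := is_solution kappa T m tau z0 f Theta A N (Jd delta) g in
  (forall delta, 0 < delta ->
    exists zd yd, is_unique_solution T (solPd delta) zd yd) /\
  (exists z y, is_unique_solution T solP z y /\
    forall (zd : R -> R -> Z1) (yd : R -> R -> Z2),
      (forall delta, 0 < delta -> solPd delta (zd delta) (yd delta)) ->
      forall t : R, t \in `[0, T] ->
        (zd delta t, yd delta t) @[delta --> 0^'+] --> (z t, y t)).
Proof.
have kappa_gt0 : 0 < kappa by exact: lt_trans p_lt_kappa.
have d_ge0 j : (1 <= j <= m)%N -> 0 <= dTheta j by move=> /dTheta_gt0/ltW.
move=> solP solPd; split=> [delta delta_gt0|].
  have [mAmA0 mA0c] := HOs_i delta delta_gt0.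
  have gap := lt_trans mA0c mAmA0.
  exact: (unique_solution_exists htau kappa_gt0 kappa_lt1 reflZ2 sepZ1 z0
    (ltW M1_gt0) (ltW mg_gt0) Hf_cont Hf_lip d_ge0 HI_lip HA_cont HA_demicont
    HA_mono HN_compact HN_surj Hg_cont Hg_lip (ltW (mJd_gt0 _ delta_gt0))
    (ltW (cJd_gt0 _ delta_gt0)) (hJd _ delta_gt0) gap).
have [z [y [sol uniq]]] := unique_solution_exists htau kappa_gt0 kappa_lt1 reflZ2 sepZ1 z0
    (ltW M1_gt0) (ltW mg_gt0) Hf_cont Hf_lip d_ge0 HI_lip HA_cont HA_demicont
    HA_mono HN_compact HN_surj Hg_cont Hg_lip (ltW mJ_gt0) (ltW cJ_gt0) hJ HO_i.
exists z, y; split => // zd yd sold t tT.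
have [K K_ge0 hK] := perturbed_solution_stability htau kappa_gt0 kappa_lt1 z0
  (ltW M1_gt0) (ltW mg_gt0) Hf_lip d_ge0 HI_lip HA_mono Hg_lip (ltW cJ_gt0) hJ HO_i.
have bound delta : 0 < delta ->
    `|zd delta t - z t| <= K * V delta /\ `|yd delta t - y t| <= K * V delta.
  move=> delta_gt0; apply: (hK (Jd delta)) sol (sold delta delta_gt0) _ tT.
    exact: V_ge0.
  by move=> s u zeta zeta' sT; exact: HJs_i.
have KV : K * V delta @[delta --> 0^'+] --> (0 : R).
  by rewrite -[X in _ --> X](mulr0 K); apply: cvgMl_tmp.
have squeeze (W : normedModType R) (u : R -> W) (l : W) :
    (forall delta, 0 < delta -> `|u delta - l| <= K * V delta) ->
    u delta @[delta --> 0^'+] --> l.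
  move=> ul; apply/cvgrPdist_le => e e_gt0.
  move/cvgrPdist_le : KV => /(_ _ e_gt0) KVe; near=> delta.
  have delta_gt0 : 0 < delta by near: delta; exact: nbhs_right_gt.
  rewrite distrC (le_trans (ul _ delta_gt0))// (le_trans (ler_norm _))//.
  by rewrite -normrN -sub0r; near: delta.
apply: cvg_pair; apply: squeeze => delta /bound[] //.
Unshelve. all: by end_near. Qed.
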